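(* Let $\Omega\subset\mathbb{R}^n$ be a bounded open set with Lipschitz boundary, let $\xi_0\in\mathbb{R}^n$, and let $f:\mathbb{R}^n\to\mathbb{R}$ be a continuous function such that $f(\xi)\ge\gamma(|\xi|)$ for all $\xi\in\mathbb{R}^n$, where $\gamma:\mathbb{R}^+\to\mathbb{R}^+$ is a continuous increasing function with $\lim_{t\to+\infty}\gamma(t)=+\infty$. Assume that $f^{\rm lslc}(\xi_0)<f(\xi_0)$. Consider the problem $$(P)\quad \inf\Big\{\operatorname*{ess\,sup}_{x\in\Omega}f(\nabla u(x)):\ u\in u_{\xi_0}+W^{1,\infty}_0(\Omega)\Big\}.$$ Then $(P)$ admits a solution if and only if $f^{\rm lslc}$ is not strictly level convex at $\xi_0$ in any direction.
   Context: Notation and definitions. $\mathbb{R}^+=[0,+\infty)$. Functions $u$ are scalar valued. $W^{1,\infty}_0(\Omega)$ is the closure of $C_0^\infty(\Omega)$ in $W^{1,1}(\Omega)$ intersected with $W^{1,\infty}(\Omega)$. $u_{\xi_0}$ denotes an affine function $u_{\xi_0}(x)=\langle\xi_0,x\rangle+c$ for some $c\in\mathbb{R}$. A function $g:\mathbb{R}^n\to[-\infty,+\infty]$ is level convex if its sublevel sets $L_c(g)=\{\xi: g(\xi)\le c\}$ are convex for every $c\in\mathbb{R}$, and lower semicontinuous if they are all closed. The lower semicontinuous level convex envelope of $f$ is $$f^{\rm lslc}(\xi)=\sup\{g(\xi):\ g:\mathbb{R}^n\to[-\infty,+\infty],\ g\text{ lower semicontinuous and level convex},\ g\le f\}.$$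 A level convex function $g:\mathbb{R}^n\to\mathbb{R}$ is strictly level convex at $\xi_0$ in at least one direction if there exists $\alpha\in\mathbb{R}^n\setminus\{0\}$ such that, whenever $\eta_1,\eta_2\in\mathbb{R}^n$ and $t\in(0,1)$ satisfy $\xi_0=t\eta_1+(1-t)\eta_2$ and $g(\xi_0)=\max\{g(\eta_1),g(\eta_2)\}$, one has $\langle\eta_1-\eta_2,\alpha\rangle=0$. ''Not strictly level convex at $\xi_0$ in any direction'' means that no such $\alpha$ exists. A solution is an admissible $u$ at which the infimum is attained. *)

(* Defs.v *)
From HB Require Import structures.
From mathcomp Require Import all_boot all_order all_algebra.
From mathcomp Require Import all_classical all_reals all_analysis.
From mathcomp Require Import measurable_realfun ess_sup_inf hoelder lra.

Set Implicit Arguments.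
Unset Strict Implicit.
Unset Printing Implicit Defensive.

Import Order.TTheory GRing.Theory Num.Theory.
Import numFieldNormedType.Exports.

Local Open Scope classical_set_scope.
Local Open Scope ring_scope.

(* Matrices (in particular R^n = 'rV[R]_n) carry their Borel sigma-algebra. *)
Section borel_matrix.
Context {R : realType} (m n : nat).
Let opens : set (set 'M[R]_(m, n)) := open.

HB.instance Definition _ := @isMeasurable.Build (sigma_display opens)
  'M[R]_(m, n) <<s opens >> (@sigma_algebra0 _ setT opens)
  (@sigma_algebraC _ opens) (@sigma_algebra_bigcup _ setT opens).

Lemma open_measurable_mx (A : set 'M[R]_(m, n)) : open A -> measurable A.
Proof. by move=> oA; exact: sub_sigma_algebra. Qed.

End borel_matrix.

Section sigma_finite_copy.
Context d (T : measurableType d) (R : realType).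
Variable mu : {measure set T -> \bar R}.

(* A key on which a sigma-finiteness proof about mu is registered. *)
Definition sigma_finite_copy of sigma_finite [set: T] mu :
  set T -> \bar R := mu.

Hypothesis mu_sfin : sigma_finite [set: T] mu.

HB.instance Definition _ := Measure.on (sigma_finite_copy mu_sfin).
HB.instance Definition _ := Measure_isSigmaFinite.Build _ _ _
  (sigma_finite_copy mu_sfin) mu_sfin.

End sigma_finite_copy.

Section lebesgue_rV.
Context {R : realType}.

Definition cons_rV n (p : R * 'rV[R]_n) : 'rV[R]_n.+1 :=
  row_mx (p.1%:M : 'rV_1) p.2.

(* Iterated product of the one-dimensional Lebesgue measure, transported along
   the isomorphism R * R^n -> R^n.+1; see lebesgue_rV_box below. *)
Fixpoint lebesgue_rV n : set 'rV[R]_n -> \bar R :=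
  match n with
  | 0%N => @dirac _ 'rV[R]_0 0 R
  | n.+1 => pushforward (lebesgue_measure \x @lebesgue_rV n)%E (@cons_rV n)
  end.

End lebesgue_rV.

Section lebesgue_rV_theory.
Context {R : realType}.

Lemma measurable_coord_rV n (i : 'I_n) :
  measurable_fun [set: 'rV[R]_n] (fun v : 'rV[R]_n => v 0 i).
Proof.
apply: (@measurability _ _ _ _ _ _ _ (RGenOpens.measurableE R)).
move=> _ [_ [a [b ->]] <-].
rewrite setTI; apply: open_measurable_mx; apply: open_comp => //.
by move=> v _; exact: coord_continuous.
Qed.

Lemma measurable_rowP d (T : measurableType d) n (f : T -> 'rV[R]_n) :
  (forall i, measurable_fun [set: T] (fun x => f x 0 i)) ->
  measurable_fun [set: T] f.
Proof.
move=> mf; apply: (@measurability _ _ T _ setT f (@open 'rV[R]_n)) => // _ [U oU <-].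
pose box (q : 'rV[rat]_n * nat) : set 'rV[R]_n :=
  [set v | forall i, ball (ratr (q.1 0 i) : R) (q.2.+1%:R^-1) (v 0 i)].
have boxmx q : box q = ball (map_mx ratr q.1 : 'rV[R]_n) (q.2.+1%:R^-1).
  apply/seteqP; split => v /=.
    by move=> bv; split=> // i j; rewrite !mxE ord1; exact: bv.
  by case=> _ bv i; have := bv 0 i; rewrite mxE.
have -> : U = \bigcup_(q : 'rV[rat]_n * nat)
    (if `[< box q `<=` U >] then box q else set0).
  apply/seteqP; split => [v Uv|v [q _]]; last by case: asboolP => // bU /bU.
  move: oU; rewrite openE => /(_ _ Uv)/nbhs_ballP[e /= e0 eU].
  have [k] := @ltr_add_invr R 0 (e / 2) (divr_gt0 e0 (ltr0Sn _ 1)).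
  rewrite add0r => ke.
  have /choice[q qv] (i : 'I_n) :
      exists p : rat, ball (ratr p : R) k.+1%:R^-1 (v 0 i).
    have [p] : exists p, (ratr p : R) \in `]v 0 i - k.+1%:R^-1, v 0 i + k.+1%:R^-1[.
      by apply: rat_in_itvoo; rewrite ltrD2l gt0_cp ?invr_gt0.
    rewrite in_itv/= => /andP[p1 p2]; exists p.
    rewrite /ball/= ltr_norml; move: p1 p2; set c := _^-1 => p1 p2.
    by apply/andP; split; lra.
  have qb : box (\row_i q i, k) v by move=> i /=; rewrite mxE.
  exists (\row_i q i, k) => //; rewrite asboolT// => w.
  rewrite boxmx => bw; apply: eU.
  rewrite boxmx in qb; have := ball_triangle (ball_sym qb) bw.
  by apply: le_ball; move: ke => /=; set c := (X in X < _ -> _) => ke; rewrite [leRHS]splitr lerD// ltW.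
rewrite setTI preimage_bigcup.
apply: countable_bigcupT_measurable => [|q]; first exact: countableP.
case: asboolP => _; last by rewrite preimage_set0.
have -> : f @^-1` box q = \bigcap_(i in [set: 'I_n])
    ((fun x => f x 0 i) @^-1` ball (ratr (q.1 0 i) : R) q.2.+1%:R^-1).
  by apply/seteqP; split => [x bx i _|x bx i]; [exact: bx|exact: (bx i I)].
apply: fin_bigcap_measurable => // i _.
rewrite -[X in measurable X]setTI; apply: mf => //.
apply: open_measurable; apply: ball_open.
Qed.

Lemma cons_rV0 n (x : R) (v : 'rV[R]_n) : cons_rV (x, v) 0 ord0 = x.
Proof.
transitivity ((x%:M : 'rV_1) 0 0); last by rewrite mxE.
rewrite -(row_mxEl (x%:M : 'rV_1) v 0 0) /=; congr (row_mx _ _ _ _).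
exact: val_inj.
Qed.

Lemma cons_rVS n (x : R) (v : 'rV[R]_n) i :
  cons_rV (x, v) 0 (lift ord0 i) = v 0 i.
Proof.
rewrite -(row_mxEr (x%:M : 'rV_1) v 0 i) /=; congr (row_mx _ _ _ _).
exact: val_inj.
Qed.

Lemma measurable_cons_rV n : measurable_fun [set: R * 'rV[R]_n] (@cons_rV R n).
Proof.
apply: measurable_rowP => i; have [j|] := unliftP ord0 i => ->.
  rewrite (_ : (fun _ => _) = (fun v : 'rV_n => v 0 j) \o snd); last first.
    by apply/funext => -[x v]; exact: cons_rVS.
  exact: (measurableT_comp (@measurable_coord_rV n j) measurable_snd).
rewrite (_ : (fun _ => _) = fst); first exact: measurable_fst.
by apply/funext => -[x v]; exact: cons_rV0.
Qed.

Definition uncons_rV n (v : 'rV[R]_n.+1) : R * 'rV[R]_n :=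
  (v 0 ord0, \row_i v 0 (lift ord0 i)).

Lemma cons_rVK n : cancel (@cons_rV R n) (@uncons_rV n).
Proof.
move=> [x v]; rewrite /uncons_rV cons_rV0; congr pair.
by apply/rowP => i; rewrite mxE cons_rVS.
Qed.

Lemma measurable_uncons_rV n : measurable_fun [set: 'rV[R]_n.+1] (@uncons_rV n).
Proof.
apply: measurable_fun_pair; first exact: measurable_coord_rV.
apply: measurable_rowP => i; under eq_fun do rewrite mxE.
exact: measurable_coord_rV.
Qed.

Lemma lebesgue_rV_sigma_finite_measure n :
  exists mu : {sigma_finite_measure set 'rV[R]_n -> \bar R},
    @lebesgue_rV R n = mu.
Proof.
elim: n => [|n [mu IH]]; first by exists (@dirac _ 'rV[R]_0 0 R).
rewrite /= IH; pose leb1 : {sigma_finite_measure set (measurableTypeR R) -> \bar R} :=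
  @lebesgue_measure R.
pose lxmu : {measure set (measurableTypeR R * 'rV[R]_n)%type -> \bar R} :=
  product_measure1 leb1 mu.
have [nu nuE] : exists nu : {measure set 'rV[R]_n.+1 -> \bar R},
    pushforward lxmu (@cons_rV R n) = nu.
  unshelve eexists (pushforward lxmu (@cons_rV R n) : {measure set _ -> \bar _}) => //.
  exact: measurable_cons_rV.
have nu_sfin : sigma_finite setT nu.
  have /sigma_finiteP[F [FT ndF Foo]] := sigma_finiteT leb1.
  have /sigma_finiteP[G [GT ndG Goo]] := sigma_finiteT mu.
  exists (fun k => @uncons_rV n @^-1` (F k `*` G k)).
    rewrite -preimage_bigcup (_ : \bigcup_i _ = setT) ?preimage_setT//.
    rewrite -subTset => -[x y] _; have : [set: R] x by []; rewrite FT => -[i _ Fx].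
    have : [set: 'rV[R]_n] y by []; rewrite GT => -[j _ Gy].
    exists (maxn i j) => //; split.
    - by move: x Fx; exact/subsetPset/ndF/leq_maxl.
    - by move: y Gy; exact/subsetPset/ndG/leq_maxr.
  move=> k; have [mF Fk] := Foo k; have [mG Gk] := Goo k; split.
    rewrite -[X in measurable X]setTI; apply: measurable_uncons_rV => //.
    exact: measurableX.
  rewrite -nuE /pushforward -comp_preimage (_ : _ \o _ = id); last first.
    by apply/funext => p /=; rewrite cons_rVK.
  by rewrite preimage_id /lxmu /= product_measure1E// lte_mul_pinfty// ge0_fin_numE.
by exists (sigma_finite_copy nu_sfin).
Qed.

Let leb0 n : @lebesgue_rV R n set0 = 0%E.
Proof. by have [mu ->] := lebesgue_rV_sigma_finite_measure n. Qed.

Let leb_ge0 n A : (0 <= @lebesgue_rV R n A)%E.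
Proof. by have [mu ->] := lebesgue_rV_sigma_finite_measure n. Qed.

Let leb_sigma_additive n : semi_sigma_additive (@lebesgue_rV R n).
Proof.
have [mu ->] := lebesgue_rV_sigma_finite_measure n.
exact: measure_semi_sigma_additive.
Qed.

HB.instance Definition _ n := isMeasure.Build _ _ _ (@lebesgue_rV R n)
  (@leb0 n) (@leb_ge0 n) (@leb_sigma_additive n).

Let leb_sigma_finite n : sigma_finite setT (@lebesgue_rV R n).
Proof.
have [mu ->] := lebesgue_rV_sigma_finite_measure n.
exact: sigma_finiteT.
Qed.

HB.instance Definition _ n := Measure_isSigmaFinite.Build _ _ _
  (@lebesgue_rV R n) (@leb_sigma_finite n).

Lemma lebesgue_rV_box n (A : 'I_n -> set R) : (forall i, measurable (A i)) ->
  lebesgue_rV [set v : 'rV[R]_n | forall i, A i (v 0 i)] =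
  (\prod_(i < n) lebesgue_measure (A i))%E.
Proof.
elim: n A => [A _|n IH A mA].
  by rewrite big_ord0 /= diracE mem_set// => -[].
rewrite big_ord_recl -IH//=.
rewrite -[RHS](@product_measure1E _ _ _ _ R (@lebesgue_measure R) (@lebesgue_rV R n))//.
  rewrite /pushforward; congr product_measure1.
  apply/seteqP; split => [[x v] Axv|[x v] [Ax Av] i] /=.
    split=> [|i] /=; first by have := Axv ord0; rewrite cons_rV0.
    by have := Axv (lift ord0 i); rewrite cons_rVS.
  by have [j|] := unliftP ord0 i => ->; rewrite ?cons_rVS ?cons_rV0//; exact: Av.
  exact: mA.
rewrite [X in measurable X](_ : _ = \bigcap_(i in [set: 'I_n])
    ((fun v : 'rV[R]_n => v 0 i) @^-1` A (lift ord0 i))).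
  apply: fin_bigcap_measurable => // i _; rewrite -[X in measurable X]setTI.
  by apply: measurable_coord_rV => //; exact: mA.
by apply/seteqP; split => [v Av i _|v Av i]; [exact: Av|exact: (Av i I)].
Qed.

End lebesgue_rV_theory.

Section euclidean.
Context {R : realType} {n : nat}.
Implicit Types (u v : 'rV[R]_n).

Definition dotrV u v : R := \sum_(i < n) u 0 i * v 0 i.

(* The library norm `|_| on 'rV[R]_n is the sup norm: it induces the usual
   topology and bounded sets, but is not the Euclidean norm. *)
Definition normE u : R := Num.sqrt (dotrV u u).

Definition affine_rV (xi : 'rV[R]_n) (c : R) : 'rV[R]_n -> R :=
  fun x => dotrV xi x + c.

End euclidean.

(* Near each boundary point Omega is, in a suitable orthonormal frame (the
   coordinates x *m Q), the set lying above the graph of a Lipschitz function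
   of the n - 1 coordinates other than the i-th one. *)
Definition lipschitz_boundary (R : realType) (n : nat) (Omega : set 'rV[R]_n) :=
  forall p, (closure Omega `\` Omega°) p ->
    exists (Q : 'M[R]_n) (i : 'I_n) (phi : 'rV[R]_n.-1 -> R^o),
      [/\ Q *m Q^T = 1%:M, lipschitz phi &
        \forall x \near p, Omega x <-> phi (col' i (x *m Q)) < (x *m Q) 0 i].

Section sobolev.
Context {R : realType} {n : nat}.
Implicit Types (Omega : set 'rV[R]_n) (u phi : 'rV[R]_n -> R) (p : \bar R).

Local Notation leb := (@lebesgue_rV R n).

Definition partial (i : 'I_n) phi : 'rV[R]_n -> R :=
  'D_(delta_mx 0 i) (phi : 'rV[R]_n -> R^o).

Definition partials (s : seq 'I_n) phi := foldr partial phi s.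

Definition smooth phi := forall s : seq 'I_n,
  continuous (partials s phi) /\
  forall x i, derivable (partials s phi : 'rV[R]_n -> R^o) x (delta_mx 0 i).

(* C_0^oo(Omega): smooth functions with compact support in Omega. *)
Definition test_function Omega phi := smooth phi /\
  exists K, [/\ compact K, K `<=` Omega & forall x, ~ K x -> phi x = 0].

Definition loc_integrable Omega u := forall K, compact K -> K `<=` Omega ->
  leb.-integrable K (EFin \o u).

Definition is_weak_gradient Omega u (G : 'rV[R]_n -> 'rV[R]_n) :=
  [/\ loc_integrable Omega u,
      forall i, loc_integrable Omega (fun x => G x 0 i) &
      forall phi i, test_function Omega phi ->
        \int[leb]_(x in Omega) (u x * partial i phi x) =
        - \int[leb]_(x in Omega) (G x 0 i * phi x)].

(* A representative of the weak gradient (unique a.e. on Omega) if there is one,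
   and 0 otherwise. *)
Definition weak_gradient Omega u : 'rV[R]_n -> 'rV[R]_n :=
  xget (fun=> 0) [set G | is_weak_gradient Omega u G].

Definition Lp_norm Omega p u : \bar R :=
  Lnorm leb p (patch (fun=> 0%E) Omega (EFin \o u)).

(* Elements of L^p and W^{1,p} are given by representatives; functions are
   defined on the whole space but only their values on Omega matter. *)
Definition in_Lp Omega p u :=
  measurable_fun Omega u /\ (Lp_norm Omega p u < +oo)%E.

Definition in_W1p Omega p u :=
  [/\ in_Lp Omega p u,
      exists G, is_weak_gradient Omega u G &
      forall i, in_Lp Omega p (fun x => weak_gradient Omega u x 0 i)].

Definition W11_norm Omega u : \bar R :=
  (Lp_norm Omega 1 u +
   \sum_(i < n) Lp_norm Omega 1 (fun x => weak_gradient Omega u x 0%R i))%E.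

(* Closure of C_0^oo(Omega) in W^{1,1}(Omega). *)
Definition in_W110 Omega u := in_W1p Omega 1 u /\
  forall e : R, 0 < e ->
    exists2 phi, test_function Omega phi & (W11_norm Omega (u \- phi)%R < e%:E)%E.

Definition in_W1oo0 Omega u := in_W110 Omega u /\ in_W1p Omega +oo%E u.

End sobolev.

Section level_convexity.
Context {R : realType} {n : nat}.
Implicit Types (g : 'rV[R]_n -> \bar R) (f : 'rV[R]_n -> R) (xi : 'rV[R]_n).

Definition level_convex g :=
  forall c : R, @convex_set R 'rV[R]_n [set xi | (g xi <= c%:E)%E].

Lemma lower_semicontinuous_sublevel g : lower_semicontinuous g <->
  forall c : R, closed [set xi | (g xi <= c%:E)%E].
Proof.
rewrite lower_semicontinuousP.
have E (c : R) : [set xi | (c%:E < g xi)%E] = ~` [set xi | (g xi <= c%:E)%E].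
  by apply/seteqP; split=> xi /=; rewrite ltNge => /negP.
by split=> H c; have := H c; rewrite E ?openC ?closedC// => /closed_openC.
Qed.

(* The lower semicontinuous level convex envelope. *)
Definition lslc f xi : \bar R := ereal_sup [set g xi | g in
  [set g | [/\ lower_semicontinuous g, level_convex g &
               forall eta, (g eta <= (f eta)%:E)%E]]].

(* Strict level convexity of a level convex function at xi0 in at least one
   direction. *)
Definition strictly_level_convex_some_dir g (xi0 : 'rV[R]_n) :=
  exists2 alpha : 'rV[R]_n, alpha != 0 &
    forall (eta1 eta2 : 'rV[R]_n) (t : R), 0 < t < 1 ->
      xi0 = t *: eta1 + (1 - t) *: eta2 ->
      g xi0 = Order.max (g eta1) (g eta2) ->
      dotrV (eta1 - eta2) alpha = 0.

End level_convexity.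

Section supremal_problem.
Context {R : realType} {n : nat}.
Variables (Omega : set 'rV[R]_n) (f : 'rV[R]_n -> R).
Variables (xi0 : 'rV[R]_n) (c : R).

(* Essential supremum over Omega: the value -oo outside Omega is neutral. *)
Definition ess_sup_on (g : 'rV[R]_n -> R) : \bar R :=
  ess_sup (@lebesgue_rV R n) (patch (fun=> -oo%E) Omega (EFin \o g)).

Definition sup_energy (u : 'rV[R]_n -> R) : \bar R :=
  ess_sup_on (f \o weak_gradient Omega u).

Definition admissible : set ('rV[R]_n -> R) :=
  [set u | in_W1oo0 Omega (u \- affine_rV xi0 c)].

Definition has_solution := exists2 u, admissible u &
  sup_energy u = ereal_inf [set sup_energy v | v in admissible].

End supremal_problem.

(* Main.v *)
Require Import Defs.
From HB Require Import structures.
From mathcomp Require Import all_boot all_order all_algebra.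
From mathcomp Require Import all_classical all_reals all_analysis.
From mathcomp Require Import measurable_realfun ess_sup_inf ring lra.

(** Let [m] be the value of the envelope at [xi0], so that [m < f xi0], and for a
    real [k] let [K] be the level set of [f] at height [k]. Everything depends on
    whether [K] surrounds [xi0], i.e. whether [xi0] is interior to its convex hull.

    Convex analysis. Testing the envelope with functions that are constant on an
    open half-space and [-oo] elsewhere shows that [K] surrounds [xi0] for every
    [k > m] ([surrounds_above]), and that it does so for [k = m] if and only if the
    envelope is not strictly level convex at [xi0] in any direction
    ([strictly_level_convex_of_not_surrounds] and
    [not_strictly_level_convex_of_surrounds]).

    Lower bound. An admissible [u] is an affine function plus a perturbation [v]
    that is a limit of test functions, so the gradient of [u] has mean [xi0]. It
    cannot remain in a closed convex set that misses [xi0], and therefore no energy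
    is below [m] ([lslc_le_sup_energy]).

    Construction. Suppose [K] surrounds [xi0] and [k < f xi0]. Then there are
    finitely many nonzero [a], forming a set [A] that surrounds the origin, with
    [xi0 + a] in [K]. A perturbation [v] whose gradient takes its values in [A]
    ([piecewise_affine_exists]) makes the energy at most [k]
    ([surrounds_sup_energy]). Such a [v] is the distance, for the polyhedral gauge
    [max_(a in A) <a, x>], to the complement of [Omega] together with a grid that
    refines towards the boundary: locally it is a maximum over [A] and a minimum
    over finitely many centres of affine functions with slopes in [A]. It is in the
    Sobolev space because mollifications of its truncations from below converge to
    it ([piecewise_affine_W1oo0]). With [k > m] this identifies the infimum as [m],
    and with [k = m], when [K] surrounds [xi0], it gives a solution.

    Obstruction. Suppose conversely that some [u] has energy [m], and that the
    level set at height [m] lies in the half-space [<xi - xi0, al> <= 0]. Then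
    [<grad v, al> <= 0] with mean zero, so [<grad v, al> = 0] almost everywhere. As
    [v] has vanishing boundary values this forces [v = 0]
    ([weak_gradient_dir0_eq0]), and then [f xi0 <= m], which is impossible
    ([energy_le_surrounds]). *)

Set Implicit Arguments.
Unset Strict Implicit.
Unset Printing Implicit Defensive.

Import Order.TTheory GRing.Theory Num.Theory.
Import numFieldNormedType.Exports.

Local Open Scope classical_set_scope.
Local Open Scope ring_scope.

(** * Inner product and separation of convex sets *)

Section continuity.
Context {R : realType} {T : topologicalType}.
Implicit Types f g : T -> R.

Lemma contM f g : continuous f -> continuous g -> continuous (fun x => f x * g x).
Proof. move=> cf cg x; exact: (@cvgM R _ (nbhs x) _ f g _ _ (cf x) (cg x)). Qed.

Lemma contD f g : continuous f -> continuous g -> continuous (fun x => f x + g x).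
Proof. move=> cf cg x; exact: (@cvgD R R^o _ (nbhs x) _ f g _ _ (cf x) (cg x)). Qed.

Lemma contB f g : continuous f -> continuous g -> continuous (fun x => f x - g x).
Proof. move=> cf cg x; exact: (@cvgB R R^o _ (nbhs x) _ f g _ _ (cf x) (cg x)). Qed.

Lemma contC (a : R) : continuous (fun _ : T => a).
Proof. by move=> x; exact: cvg_cst. Qed.

Lemma sum_continuous I (r : seq I) (F : I -> T -> R) :
  (forall i, continuous (F i)) -> continuous (fun x => \sum_(i <- r) F i x).
Proof.
move=> cF; elim: r => [|i r IH].
  rewrite (_ : (fun _ => _) = fun=> 0); first exact: contC.
  by apply/funext => x; rewrite big_nil.
rewrite (_ : (fun _ => _) = fun x => F i x + \sum_(j <- r) F j x).
  exact: contD.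
by apply/funext => x; rewrite big_cons.
Qed.

End continuity.

Section dot_product.
Context {R : realType} {n : nat}.
Implicit Types (u v w : 'rV[R]_n) (a : R).

Lemma dotrVC u v : dotrV u v = dotrV v u.
Proof. by apply: eq_bigr => i _; rewrite mulrC. Qed.

Lemma dotrVDl u v w : dotrV (u + v) w = dotrV u w + dotrV v w.
Proof. by rewrite /dotrV -big_split; apply: eq_bigr => i _; rewrite mxE mulrDl. Qed.

Lemma dotrVZl a u v : dotrV (a *: u) v = a * dotrV u v.
Proof. by rewrite /dotrV mulr_sumr; apply: eq_bigr => i _; rewrite mxE mulrA. Qed.

Lemma dotrVNl u v : dotrV (- u) v = - dotrV u v.
Proof. by rewrite -scaleN1r dotrVZl mulN1r. Qed.

Lemma dotrVBl u v w : dotrV (u - v) w = dotrV u w - dotrV v w.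
Proof. by rewrite dotrVDl dotrVNl. Qed.

Lemma dotrVDr u v w : dotrV w (u + v) = dotrV w u + dotrV w v.
Proof. by rewrite dotrVC dotrVDl !(dotrVC w). Qed.

Lemma dotrVZr a u v : dotrV u (a *: v) = a * dotrV u v.
Proof. by rewrite dotrVC dotrVZl dotrVC. Qed.

Lemma dotrVNr u v : dotrV u (- v) = - dotrV u v.
Proof. by rewrite dotrVC dotrVNl dotrVC. Qed.

Lemma dotrVBr u v w : dotrV w (u - v) = dotrV w u - dotrV w v.
Proof. by rewrite dotrVDr dotrVNr. Qed.

Lemma dotrV0r u : dotrV u 0 = 0.
Proof. by rewrite -(scale0r 0) dotrVZr mul0r. Qed.

Lemma dotrV0l u : dotrV 0 u = 0.
Proof. by rewrite dotrVC dotrV0r. Qed.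

Lemma dotrV_delta u i : dotrV u (delta_mx 0 i) = u 0 i.
Proof.
rewrite /dotrV (bigD1 i)//= mxE !eqxx mulr1 big1 ?addr0// => j ji.
by rewrite mxE eqxx (negbTE ji) mulr0.
Qed.

Lemma dotrV_ge0 u : 0 <= dotrV u u.
Proof. by apply: sumr_ge0 => i _; rewrite -expr2 sqr_ge0. Qed.

Lemma dotrV_gt0 u : u != 0 -> 0 < dotrV u u.
Proof.
move=> u0; rewrite lt_neqAle dotrV_ge0 andbT eq_sym; apply: contra u0.
rewrite psumr_eq0 => [/allP h|i _]; last by rewrite -expr2 sqr_ge0.
apply/eqP/rowP => i; have := h i; rewrite mem_index_enum => /(_ isT)/eqP/eqP.
by rewrite mulf_eq0 orbb mxE => /eqP.
Qed.

Lemma coord_le_norm u i : `|u 0 i| <= `|u|.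
Proof.
rewrite [leRHS]/Num.norm /= mx_normrE.
exact: (@le_bigmax _ _ _ 0 (fun ij : 'I_1 * 'I_n => `|u ij.1 ij.2|) (0, i)).
Qed.

Lemma norm_leP u a : 0 <= a -> (forall i, `|u 0 i| <= a) -> `|u| <= a.
Proof.
move=> a0 ua; rewrite [leLHS]/Num.norm /= mx_normrE.
by apply/bigmax_leP; split => // -[i j] _ /=; rewrite ord1.
Qed.

Lemma norm_delta_le1 (i : 'I_n) : `|delta_mx 0 i : 'rV[R]_n| <= 1.
Proof.
by apply: norm_leP => // j; rewrite mxE; case: (_ && _); rewrite ?normr0 ?normr1.
Qed.

Lemma norm_dotrV_le u v : `|dotrV u v| <= (\sum_i `|u 0 i|) * `|v|.
Proof.
apply: (le_trans (ler_norm_sum _ _ _)); rewrite mulr_suml; apply: ler_sum => i _.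
by rewrite normrM ler_wpM2l// coord_le_norm.
Qed.

Lemma sqr_coord_le_dotrV u i : (u 0 i) ^+ 2 <= dotrV u u.
Proof.
rewrite /dotrV (bigD1 i)//= expr2 lerDl sumr_ge0// => j _.
by rewrite -expr2 sqr_ge0.
Qed.

Lemma norm_le_normE u : `|u| <= normE u.
Proof.
apply: norm_leP => [|i]; first exact: sqrtr_ge0.
by rewrite -sqrtr_sqr ler_sqrt ?dotrV_ge0// sqr_coord_le_dotrV.
Qed.

Lemma dotrV_continuous u : continuous (dotrV u).
Proof.
apply: sum_continuous => i; apply: contM; [exact: contC|exact: coord_continuous].
Qed.

Lemma closed_dotrV_le u a : closed [set x | dotrV x u <= a].
Proof.
rewrite (_ : [set x | _] = (fun v => dotrV u v) @^-1` [set y | y <= a]).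
  by apply: closed_comp => [x _|]; [exact: dotrV_continuous|exact: closed_le].
by apply/seteqP; split => x /=; rewrite dotrVC.
Qed.

Lemma closed_dotrV_ge u a : closed [set x | a <= dotrV x u].
Proof.
rewrite (_ : [set x | _] = (fun v => dotrV u v) @^-1` [set y | a <= y]).
  by apply: closed_comp => [x _|]; [exact: dotrV_continuous|exact: closed_ge].
by apply/seteqP; split => x /=; rewrite dotrVC.
Qed.

End dot_product.

Section separation.
Context {R : realType} {n : nat}.
Implicit Types (C : set 'rV[R]_n) (p q : 'rV[R]_n).

Lemma convex_setE C p q (t : R) : @convex_set R 'rV[R]_n C -> C p -> C q ->
  0 <= t <= 1 -> C (t *: p + (1 - t) *: q).
Proof.
move=> cC Cp Cq t01.
case/andP: t01 => t0 t1.
by have := cC p q (Itv01 t0 t1); rewrite !inE; apply.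
Qed.

(** The separating direction points from the nearest point of [C] to [p]; it
    separates because moving from that point towards another point of [C] cannot
    come closer to [p]. *)
Lemma convex_separation C p : closed C -> @convex_set R 'rV[R]_n C -> ~ C p ->
  exists al s, (forall x, C x -> dotrV x al <= s) /\ s < dotrV p al.
Proof.
move=> clC cvC nCp.
have [[c0 Cc0]|C0] := pselect (C !=set0); last first.
  exists 0, (-1); split => [x Cx|]; last by rewrite dotrV0r ltrN10.
  by exfalso; apply: C0; exists x.
pose d x := dotrV (x - p) (x - p).
have dcont : continuous d.
  apply: sum_continuous => i.
  have h : continuous (fun y : 'rV[R]_n => (y - p) 0 i).
    under eq_fun do rewrite !mxE.
    by apply: contB; [exact: coord_continuous|exact: contC].
  exact: contM.
pose B := C `&` [set x | d x <= d c0].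
have clB : closed B.
  apply: closedI => //; apply: (@closed_comp _ _ d [set y | y <= d c0]).
    by move=> x _; exact: dcont.
  exact: closed_le.
have bB : bounded_set B.
  exists (normE (c0 - p) + `|p|); split; first exact: num_real.
  move=> M hM x [_ /= dx]; apply: le_trans (ltW hM).
  rewrite -[x in leLHS](subrK p); apply: (le_trans (ler_normD _ _)).
  rewrite lerD2r; apply: (le_trans (norm_le_normE _)).
  by rewrite ler_sqrt// dotrV_ge0.
have [||q] := @EVT_min_rV R n d B _ (bounded_closed_compact bB clB) _.
- by exists c0; split => //=.
- exact: continuous_subspaceT.
rewrite inE => -[Cq dq] qmin.
have qmin' x : C x -> d q <= d x.
  move=> Cx; have [dx|dx] := leP (d x) (d c0); first by apply: qmin; rewrite inE.
  exact: le_trans (le_trans dq (ltW dx)) _.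
exists (p - q), (dotrV q (p - q)); split; last first.
  rewrite -subr_gt0 -dotrVBl dotrV_gt0// subr_eq0.
  by apply/eqP => pq; apply: nCp; rewrite pq.
move=> x Cx; rewrite -subr_ge0 -dotrVBl leNgt; apply/negP => h.
set b := dotrV (x - q) (x - q).
have b0 : 0 <= b by exact: dotrV_ge0.
set h' := dotrV (q - x) (p - q) in h.
(* the quadratic t |-> |q + t (x - q) - p|^2 decreases at t = 0 *)
pose t := Num.min 1 (- h' / (b + 1)).
have bp : 0 < b + 1 by lra.
have t0 : 0 < t by rewrite lt_min ltr01 divr_gt0// oppr_gt0.
have t1 : t <= 1 by rewrite ge_min lexx.
have tb : t * b < - h' * 2.
  have : t <= - h' / (b + 1) by rewrite ge_min lexx orbT.
  rewrite ler_pdivlMr// => ?; nra.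
have := qmin' _ (convex_setE cvC Cx Cq (t := t) _).
rewrite (ltW t0) t1 => /(_ isT); apply/negP; rewrite -ltNge.
have -> : d (t *: x + (1 - t) *: q) = d q + t * (2 * h' + t * b).
  rewrite /d /b /h'.
  rewrite (_ : t *: x + (1 - t) *: q - p = t *: (x - q) + (q - p)); last first.
    by apply/rowP => i; rewrite !mxE; ring.
  rewrite !(dotrVDl, dotrVDr, dotrVNl, dotrVNr, dotrVZl, dotrVZr).
  rewrite ?(dotrVC x q) ?(dotrVC x p) ?(dotrVC p q); ring.
have : t * (2 * h' + t * b) < 0 by rewrite pmulr_rlt0//; lra.
by move=> ?; lra.
Qed.

End separation.

(** * The envelope and its level sets *)

Section envelope.
Context {R : realType} {n : nat}.
Variable f : 'rV[R]_n -> R.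
Implicit Types (xi eta al : 'rV[R]_n).

Lemma lslc_le xi : (lslc f xi <= (f xi)%:E)%E.
Proof. by apply: ge_ereal_sup => _ [g [_ _ gf] <-]. Qed.

(** The function equal to [c] on an open half-space and to [-oo] elsewhere
    competes in the supremum that defines the envelope. All the lower bounds on
    the envelope below come from such competitors. *)
Lemma lslc_ge_halfspace al s c :
  (forall xi, s < dotrV xi al -> c <= f xi) ->
  forall eta, s < dotrV eta al -> (c%:E <= lslc f eta)%E.
Proof.
move=> fc eta es; pose g xi : \bar R := if s < dotrV xi al then c%:E else -oo%E.
have subg a : [set xi | (g xi <= a%:E)%E] =
    if c <= a then setT else [set xi | dotrV xi al <= s].
  rewrite /g; case: (leP c a) => ca; apply/seteqP; split => xi //=;
    case: (ltP s (dotrV xi al)) => //.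
  all: rewrite ?lee_fin ?leNye ?(leNgt c a) ?ca //.
have -> : c%:E = g eta by rewrite /g es.
apply: ereal_sup_ubound; exists g => //; split.
- apply/lower_semicontinuous_sublevel => a; rewrite subg; case: ifP => _.
    exact: closedT.
  exact: closed_dotrV_le.
- move=> a x y t; rewrite subg; case: ifP => _; rewrite ?inE// => /= xs ys.
  rewrite dotrVDl !dotrVZl.
  have key (k u v : R) : 0 <= k <= 1 -> u <= s -> v <= s -> k * u + (1 - k) * v <= s.
    by move=> /andP[k0 k1] us vs; nra.
  by apply: key => //; rewrite ge0 le1.
- by move=> xi; rewrite /g; case: ifPn => [/fc|_]; rewrite ?lee_fin// leNye.
Qed.

Hypothesis f_ge0 : forall xi, 0 <= f xi.

Lemma lslc_ge0 xi : (0 <= lslc f xi)%E.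
Proof.
apply: (@lslc_ge_halfspace 0 (-1)) => [eta _|]; first exact: f_ge0.
by rewrite dotrV0r ltrN10.
Qed.

Lemma lslc_fin xi : exists2 m, lslc f xi = m%:E & 0 <= m.
Proof.
have := lslc_le xi; have := lslc_ge0 xi; case: (lslc f xi) => // m m0 _.
by exists m => //; rewrite -lee_fin.
Qed.

End envelope.

Section surrounding.
Context {R : realType} {n : nat}.
Implicit Types (K : set 'rV[R]_n) (xi : 'rV[R]_n).

(** For [n > 0] this says that [xi] is interior to the convex hull of [K]; the
    formulation by half-spaces is the one that meets the weak gradients. *)
Definition surrounds K xi := forall al, al != 0 ->
  exists2 z, K z & 0 < dotrV (z - xi) al.

Lemma sphere_compact : compact [set x : 'rV[R]_n | `|x| = 1].
Proof.
apply: bounded_closed_compact.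
  by exists 1; split => // M M1 x /= ->; exact: ltW.
apply: (@closed_comp _ _ (fun x : 'rV[R]_n => `|x|) [set 1]).
  by move=> x _; exact: norm_continuous.
exact: closed_eq.
Qed.

(** Compactness of the sphere extracts finitely many points of [K] that already
    surround [xi], quantitatively. *)
Lemma surrounds_finite K xi : surrounds K xi -> exists (A : seq 'rV[R]_n) (d : R),
  [/\ 0 < d, forall a, a \in A -> K (xi + a) &
      forall x, x != 0 -> exists2 a, a \in A & d * `|x| <= dotrV a x].
Proof.
move=> Kxi; pose D := [set p : 'rV[R]_n * nat | K (xi + p.1)].
pose U (p : 'rV[R]_n * nat) := [set x : 'rV[R]_n | p.2.+1%:R^-1 < dotrV p.1 x].
have := sphere_compact; rewrite compact_cover => /(_ _ D U)[p _||B BD SB].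
- apply: (@open_comp _ _ (dotrV p.1) [set y | p.2.+1%:R^-1 < y]).
    by move=> x _; exact: dotrV_continuous.
  exact: open_gt.
- move=> x /= x1; have x0 : x != 0 by rewrite -normr_eq0 x1 oner_eq0.
  have [z Kz zx] := Kxi x x0.
  have [k kz] := @ltr_add_invr R 0 _ zx.
  exists (z - xi, k); first by rewrite /D/= addrC subrK.
  by rewrite /U/=; move: kz; rewrite add0r.
pose N := (\max_(p <- finmap.enum_fset B) p.2)%N.
exists [seq p.1 | p <- finmap.enum_fset B], (N.+1%:R^-1); split.
- by rewrite invr_gt0.
- by move=> a /mapP[p pB ->]; have := BD _ pB; rewrite inE.
move=> x x0; have nx : 0 < `|x| by rewrite normr_gt0.
have [|p pB] := SB (`|x|^-1 *: x).
  by rewrite /= normrZ normrV ?unitfE ?gt_eqF// normr_id mulVf// gt_eqF.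
rewrite /U /= dotrVZr => px; exists p.1; first by apply/mapP; exists p.
rewrite -ler_pdivlMr// mulrC; apply: le_trans (ltW px).
rewrite lef_pV2 ?posrE ?ltr0n// ler_nat ltnS.
by rewrite /N; apply: (@leq_bigmax_seq _ _ xpredT (fun q => q.2)).
Qed.

End surrounding.

Section level_sets.
Context {R : realType} {n : nat}.
Variable f : 'rV[R]_n -> R.
Hypothesis f_continuous : continuous f.
Hypothesis f_ge0 : forall xi, 0 <= f xi.
Hypothesis f_coercive : forall c, bounded_set [set xi | f xi <= c].
Implicit Types (xi eta al : 'rV[R]_n).

Lemma sublevel_compact c : compact [set xi | f xi <= c].
Proof.
apply: bounded_closed_compact => //.
apply: (@closed_comp _ _ f [set y | y <= c]) => [x _|]; first exact: f_continuous.
exact: closed_le.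
Qed.

Lemma coercive_gap (F : set 'rV[R]_n) m : closed F ->
  (forall xi, F xi -> m < f xi) ->
  exists2 c, m < c & forall xi, F xi -> c <= f xi.
Proof.
move=> cF mF; pose B := [set xi | f xi <= m + 1] `&` F.
have [B0|B0] := pselect (B !=set0); last first.
  exists (m + 1) => [|xi Fxi]; first by rewrite ltrDl.
  by rewrite leNgt; apply/negP => h; apply: B0; exists xi; split => //; exact: ltW.
have cB : compact B by apply: compact_closedI => //; exact: sublevel_compact.
have [|z] := EVT_min_rV B0 cB (f := f); first exact: continuous_subspaceT.
rewrite inE => -[zm Fz] zmin; exists (f z); first exact: mF.
move=> xi Fxi; have [h|h] := leP (f xi) (m + 1).
  by apply: zmin; rewrite inE.
exact: le_trans zm (ltW h).
Qed.

(** If [{f <= c}] lay on one side of a hyperplane through [xi0], then [f] would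
    be at least some [c' > m] on an open half-space that contains [xi0], and the
    envelope would exceed [m] at [xi0]. *)
Lemma surrounds_above xi0 m c : lslc f xi0 = m%:E -> m < c ->
  surrounds [set xi | f xi <= c] xi0.
Proof.
move=> hm mc al al0; apply: contrapT => nK.
have {}nK xi : f xi <= c -> dotrV (xi - xi0) al <= 0.
  by move=> fc; rewrite leNgt; apply/negP => h; apply: nK; exists xi.
pose c' := (m + c) / 2.
have mc' : m < c' by rewrite /c'; lra.
have cc' : c' < c by rewrite /c'; lra.
(* a point of the hyperplane with f <= c' < c could be pushed to its positive
   side without leaving {f <= c} *)
have fc' xi : 0 <= dotrV (xi - xi0) al -> c' < f xi.
  move=> xi_ge0; rewrite ltNge; apply/negP => fxi.
  have : \forall t \near (0 : R)^'+, f (xi + t *: al) < c.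
    have : f (xi + t *: al) @[t --> (0 : R)^'+] --> f (xi + 0 *: al).
      apply: continuous_cvg; first exact: f_continuous.
      apply: cvgD; first exact: cvg_cst.
      apply: cvgZr_tmp; apply: cvg_at_right_filter; exact: cvg_id.
    by rewrite scale0r addr0 => /cvgr_lt; apply; exact: le_lt_trans fxi cc'.
  move=> ft; have [t [t0 /ltW/nK]] := filter_ex (filterI (nbhs_right_gt (0:R)) ft).
  rewrite -addrA addrCA dotrVDl dotrVZl; apply/negP; rewrite -ltNge.
  by rewrite ltr_wpDr// mulr_gt0// dotrV_gt0.
(* by compactness the strict inequality survives a small shift of the plane *)
have [e e0 fe] : exists2 e, 0 < e & forall xi, - e < dotrV (xi - xi0) al -> c' <= f xi.
  have [S0|S0] := pselect ([set xi | f xi <= c'] !=set0); last first.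
    exists 1 => // xi _; rewrite leNgt; apply/negP => h; apply: S0.
    by exists xi => /=; exact: ltW.
  have [|z] := EVT_max_rV S0 (@sublevel_compact c') (f := fun xi => dotrV (xi - xi0) al).
    apply: continuous_subspaceT => x.
    rewrite (_ : (fun _ => _) = fun xi => dotrV al xi - dotrV xi0 al).
      by apply: contB; [exact: dotrV_continuous|exact: contC].
    by apply/funext => xi; rewrite dotrVBl (dotrVC xi).
  rewrite inE => /= fz zmax; have z0 : dotrV (z - xi0) al < 0.
    by rewrite ltNge; apply/negP => /fc'; rewrite ltNge fz.
  exists (- dotrV (z - xi0) al); first by rewrite oppr_gt0.
  move=> xi; rewrite opprK => zxi; rewrite leNgt; apply/negP => h.
  have := zmax xi; rewrite inE => /(_ (ltW h)).
  by rewrite leNgt zxi.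
have : (c'%:E <= lslc f xi0)%E.
  apply: (@lslc_ge_halfspace _ _ _ al (dotrV xi0 al - e)) => [xi h|].
    by apply: fe; rewrite dotrVBl ltrBrDl.
  by rewrite ltrBlDr ltrDl.
by rewrite hm lee_fin leNgt mc'.
Qed.

(** If [{f <= m}] lies on one side of a hyperplane through [xi0], so does the
    level set of the envelope; a segment of this level set through [xi0] then
    runs inside the hyperplane, whose normal is the direction of strictness. *)
Lemma strictly_level_convex_of_not_surrounds xi0 m : lslc f xi0 = m%:E ->
  ~ surrounds [set xi | f xi <= m] xi0 ->
  strictly_level_convex_some_dir (lslc f) xi0.
Proof.
move=> hm /existsNP[al /not_implyP[al0 nK]]; exists al => //.
have {}nK xi : f xi <= m -> dotrV (xi - xi0) al <= 0.
  by move=> fc; rewrite leNgt; apply/negP => h; apply: nK; exists xi.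
have side eta : (lslc f eta <= m%:E)%E -> dotrV (eta - xi0) al <= 0.
  move=> etam; rewrite leNgt; apply/negP => h.
  pose s := dotrV xi0 al + dotrV (eta - xi0) al / 2.
  have [|xi sxi|c mc fc] := @coercive_gap [set xi | s <= dotrV xi al] m.
  - exact: closed_dotrV_ge.
  - rewrite ltNge; apply/negP => /nK; rewrite dotrVBl => ?.
    by move: sxi; rewrite /s /=; lra.
  have : (c%:E <= lslc f eta)%E.
    apply: (@lslc_ge_halfspace _ _ _ al s) => [xi /ltW/fc//|].
    by move: h; rewrite /s dotrVBl; lra.
  by move=> /le_trans/(_ etam); rewrite lee_fin leNgt mc.
move=> eta1 eta2 t /andP[t0 t1] xi0E; rewrite hm => maxE.
have /side h1 : (lslc f eta1 <= m%:E)%E by rewrite maxE le_max lexx.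
have /side h2 : (lslc f eta2 <= m%:E)%E by rewrite maxE le_max lexx orbT.
have : t * dotrV (eta1 - xi0) al + (1 - t) * dotrV (eta2 - xi0) al = 0.
  rewrite -!dotrVZl -dotrVDl [X in dotrV X _](_ : _ = 0) ?dotrV0l//.
  transitivity (t *: eta1 + (1 - t) *: eta2 - xi0); last by rewrite -xi0E subrr.
  by apply/rowP => i; rewrite !mxE; ring.
move: h1 h2; rewrite !dotrVBl => h1 h2 h; nra.
Qed.

(** The envelope is at most [m] on the convex hull of [{f <= m}], hence near
    [xi0]. On a short segment centred at [xi0] the larger end value cannot be
    below [m] by level convexity, so it equals [m], in every direction. *)
Lemma not_strictly_level_convex_of_surrounds xi0 m : lslc f xi0 = m%:E ->
  surrounds [set xi | f xi <= m] xi0 ->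
  ~ strictly_level_convex_some_dir (lslc f) xi0.
Proof.
move=> hm Ks [al al0 strict].
have [A [d [d0 AK Ad]]] := surrounds_finite Ks.
(* [eta] is near [xi0], so no half-space containing [xi0 + A] leaves it out *)
have ball eta : \sum_i `|(eta - xi0) 0 i| <= d -> (lslc f eta <= m%:E)%E.
  move=> etad; apply: ge_ereal_sup => _ [g [lg cg gf] <-].
  apply: contrapT => geta.
  have [be [s [sep]]] := convex_separation
    (iffLR (lower_semicontinuous_sublevel g) lg m) (cg m) geta.
  have gA a : a \in A -> dotrV (xi0 + a) be <= s.
    move=> /AK/= fa; apply: sep => /=; apply: le_trans (gf _) _.
    by rewrite lee_fin.
  have [be0|be0] := eqVneq be 0.
    have [a aA _] := Ad _ al0; have := gA _ aA.
    by rewrite be0 !dotrV0r => s0 /(le_lt_trans s0); rewrite ltxx.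
  have [a aA abe] := Ad _ be0; have := gA _ aA.
  rewrite dotrVDl => h1 h2; have := norm_dotrV_le (eta - xi0) be.
  have nb : 0 < `|be| by rewrite normr_gt0.
  have := ler_norm (dotrV (eta - xi0) be).
  rewrite dotrVBl; nra.
pose S := \sum_i `|al 0 i|.
have S0 : 0 <= S by apply: sumr_ge0.
pose r := d / (S + 1).
have r0 : 0 < r by rewrite divr_gt0// ltr_wpDl.
have rS : r * S <= d.
  by rewrite /r -mulrA ler_piMr ?(ltW d0)// mulrC ler_pdivrMr ?ltr_wpDl// mul1r lerDl.
have b1 : (lslc f (xi0 + r *: al) <= m%:E)%E.
  apply: ball; apply: le_trans rS; rewrite addrC addKr /S mulr_sumr ler_sum// => i _.
  by rewrite mxE normrM gtr0_norm.
have b2 : (lslc f (xi0 - r *: al) <= m%:E)%E.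
  apply: ball; apply: le_trans rS; rewrite addrC addKr /S mulr_sumr ler_sum// => i _.
  by rewrite !mxE normrN normrM gtr0_norm.
have [m1 m1E _] := lslc_fin f_ge0 (xi0 + r *: al).
have [m2 m2E _] := lslc_fin f_ge0 (xi0 - r *: al).
have xi0E : xi0 = 2^-1 *: (xi0 + r *: al) + (1 - 2^-1) *: (xi0 - r *: al).
  by apply/rowP => i; rewrite !mxE; field.
have half : 0 < (2^-1 : R) < 1 by apply/andP; split; lra.
have mmax : m <= Num.max m1 m2.
  rewrite -lee_fin -hm; apply: ge_ereal_sup => _ [g [lg cg gf] <-].
  rewrite xi0E; have := @convex_setE _ _ _ (xi0 + r *: al) (xi0 - r *: al) 2^-1
    (cg (Num.max m1 m2)); apply; last by case/andP: half => ? ?; rewrite !ltW.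
  - rewrite /= (@le_trans _ _ m1%:E) ?lee_fin ?le_max ?lexx// -m1E.
    by apply: ereal_sup_ubound; exists g.
  - rewrite /= (@le_trans _ _ m2%:E) ?lee_fin ?le_max ?lexx ?orbT// -m2E.
    by apply: ereal_sup_ubound; exists g.
have := strict _ _ _ half xi0E; rewrite hm m1E m2E -EFin_max => h.
have {h} : dotrV (xi0 + r *: al - (xi0 - r *: al)) al = 0.
  apply: h; congr EFin; apply/le_anti; rewrite mmax/= ge_max.
  by rewrite -!lee_fin -m1E -m2E b1 b2.
rewrite (_ : _ - _ = (2 * r) *: al); last by apply/rowP => i; rewrite !mxE; ring.
rewrite dotrVZl => /eqP; rewrite mulf_eq0 (gt_eqF (dotrV_gt0 al0)) orbF.
by rewrite mulf_eq0 (gt_eqF r0) orbF pnatr_eq0.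
Qed.

End level_sets.

(** * Lebesgue measure of boxes, translations and hyperplanes *)

Section boxes.
Context {R : realType} {n : nat}.
Implicit Types (a b x y : 'rV[R]_n).
Local Notation leb := (@lebesgue_rV R n).

Definition box a b : set 'rV[R]_n := [set v | forall i, a 0 i < v 0 i < b 0 i].

Definition boxes : set (set 'rV[R]_n) := [set B | exists a b, B = box a b].

Lemma norm_ltP x (r : R) : 0 < r -> (`|x| < r) <-> (forall i, `|x 0 i| < r).
Proof.
move=> r0; split=> [xr i|xr]; first exact: le_lt_trans (coord_le_norm _ _) xr.
rewrite [ltLHS]/Num.norm /= mx_normrE.
by apply/bigmax_ltP; split => // -[i j] _ /=; rewrite ord1.
Qed.

Lemma ball_rVE x (r : R) : ball x r = [set y | `|x - y| < r].
Proof. by rewrite mx_norm_ball. Qed.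

Lemma ball_box x (r : R) : 0 < r ->
  ball x r = box (x - const_mx r) (x + const_mx r).
Proof.
move=> r0; rewrite ball_rVE; apply/seteqP; split => y /=.
  move/norm_ltP => /(_ r0) h i; have := h i; rewrite !mxE ltr_norml => /andP[? ?].
  by apply/andP; split; lra.
move=> h; apply/norm_ltP => // i; have := h i; rewrite !mxE ltr_norml => /andP[? ?].
by apply/andP; split; lra.
Qed.

Lemma open_box a b : open (box a b).
Proof.
rewrite openE => v abv; rewrite /interior.
apply: (@filter_forall _ _ (fun i (w : 'rV[R]_n) => a 0 i < w 0 i < b 0 i) _
  (nbhs_filter v)) => i.
have : nbhs (v 0 i) `]a 0 i, b 0 i[%classic.
  by apply: open_nbhs_nbhs; split; [exact: interval_open|rewrite /= in_itv/= abv].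
move=> /(@coord_continuous _ 1 n 0 i v) h.
by apply: (@filterS _ _ (nbhs_filter v) _ _ _ h) => w /=; rewrite in_itv.
Qed.

Lemma measurable_box a b : measurable (box a b).
Proof. by apply: open_measurable_mx; exact: open_box. Qed.

Lemma boxI a b a' b' : box a b `&` box a' b' =
  box (\row_i Num.max (a 0 i) (a' 0 i)) (\row_i Num.min (b 0 i) (b' 0 i)).
Proof.
apply/seteqP; split => [v [h1 h2] i|v h].
  by rewrite !mxE gt_max lt_min; have /andP[-> ->] := h1 i; exact: h2.
by split => i; have := h i; rewrite !mxE gt_max lt_min => /andP[/andP[? ?]/andP[? ?]];
  apply/andP.
Qed.

Lemma leb_boxE a b :
  leb (box a b) = (\prod_(i < n) lebesgue_measure `]a 0%R i, b 0%R i[%classic)%E.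
Proof.
rewrite -lebesgue_rV_box => [|i]; last exact: measurable_itv.
congr lebesgue_rV; apply/seteqP; split => v h i; have := h i; rewrite /= in_itv//.
Qed.

Lemma leb_box_lty a b : (leb (box a b) < +oo)%E.
Proof.
rewrite leb_boxE; suff [r ->] : exists r : R,
    (\prod_(i < n) lebesgue_measure `]a 0%R i, b 0%R i[%classic)%E = r%:E.
  exact: ltry.
elim/big_rec : _ => [|i x _ [r ->]]; first by exists 1.
rewrite lebesgue_measure_itv/=; case: ifP => _.
  by rewrite -EFinB -EFinM; eexists.
by rewrite mul0e; exists 0.
Qed.

Lemma leb_box_gt0 a b : (forall i, a 0 i < b 0 i) -> (0 < leb (box a b))%E.
Proof.
move=> ab; rewrite leb_boxE; elim/big_rec : _ => [|i x _ x0]; first exact: lte01.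
by rewrite lebesgue_measure_itv/= lte_fin ab -EFinB mule_gt0// lte_fin subr_gt0.
Qed.

Lemma bigcup_box : \bigcup_k box (const_mx (- k%:R)) (const_mx k%:R) = setT.
Proof.
rewrite -subTset => x _; exists (Num.truncn `|x|).+1 => // i; rewrite !mxE -ltr_norml.
exact: le_lt_trans (coord_le_norm _ _) (Num.Theory.truncnS_gt _).
Qed.

(** The closed boxes lie in [U] as well, which makes the open ones available to
    arguments on compact subsets of [U]. *)
Lemma open_bigcup_box (U : set 'rV[R]_n) : open U ->
  exists B : 'rV[rat]_n * nat -> set 'rV[R]_n, U = \bigcup_q B q /\
    forall q, B q = set0 \/ exists a b, [/\ B q = box a b, B q `<=` U &
      [set v : 'rV[R]_n | forall i, a 0 i <= v 0 i <= b 0 i] `<=` U].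
Proof.
move=> oU.
pose bx (q : 'rV[rat]_n * nat) := ball (map_mx ratr q.1 : 'rV[R]_n) q.2.+1%:R^-1.
pose cbx (q : 'rV[rat]_n * nat) :=
  [set v : 'rV[R]_n | `|map_mx ratr q.1 - v| <= q.2.+1%:R^-1].
exists (fun q => if `[< cbx q `<=` U >] then bx q else set0); split; last first.
  move=> q; case: asboolP => qU; [right|by left].
  exists (map_mx ratr q.1 - const_mx q.2.+1%:R^-1), (map_mx ratr q.1 + const_mx q.2.+1%:R^-1).
  split; first exact: ball_box.
    by apply: subset_trans qU => v; rewrite /bx ball_rVE /cbx /= => /ltW.
  apply: subset_trans qU => v h; apply: norm_leP => // i; have := h i.
  rewrite !mxE ler_norml; move: (ratr _) (_^-1) => r c /andP[? ?].
  by apply/andP; split; lra.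
apply/seteqP; split => [v Uv|v [q _]]; last first.
  by case: asboolP => // bU; rewrite /bx ball_rVE => /ltW; exact: bU.
move: oU; rewrite openE => /(_ _ Uv)/nbhs_ballP[e /= e0 eU].
have [k] := @ltr_add_invr R 0 (e / 2) (divr_gt0 e0 (ltr0Sn _ 1)).
rewrite add0r => ke.
have /choice[q qv] (i : 'I_n) :
    exists p : rat, `|ratr p - v 0 i| < k.+1%:R^-1.
  have [p] : exists p, (ratr p : R) \in `]v 0 i - k.+1%:R^-1, v 0 i + k.+1%:R^-1[.
    by apply: rat_in_itvoo; rewrite ltrD2l gt0_cp ?invr_gt0.
  rewrite in_itv/= => /andP[p1 p2]; exists p.
  by rewrite ltr_norml; move: p1 p2; set c := _^-1 => p1 p2; apply/andP; split; lra.
have qb : bx (\row_i q i, k) v.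
  by rewrite /bx ball_rVE /=; apply/norm_ltP => // i; rewrite !mxE.
exists (\row_i q i, k) => //; rewrite asboolT// => w.
rewrite /cbx/= => bw; apply: eU; rewrite ball_rVE/=.
move: qb; rewrite /bx ball_rVE /= distrC => qb.
have := ler_distD (map_mx ratr (\row_i q i)) v w; move: ke qb bw.
by set c := _^-1; set d1 := `|_|; set d2 := `|_|; set d3 := `|_| => *; lra.
Qed.

Lemma boxes_generate : @measurable _ 'rV[R]_n = <<s boxes>>.
Proof.
apply/seteqP; split; last first.
  apply: smallest_sub; first exact: sigma_algebra_measurable.
  by move=> _ [a [b ->]]; exact: measurable_box.
apply: smallest_sub; first exact: smallest_sigma_algebra.
move=> U /open_bigcup_box[B [-> BE]].
apply: (@countable_bigcupT_measurable _ (g_sigma_algebraType boxes)).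
  exact: countableP.
move=> q; have [->|[a [b [-> _ _]]]] := BE q; first exact: measurable0.
by apply: sub_sigma_algebra; exists a, b.
Qed.

Lemma rV_measure_unique (m1 m2 : {measure set 'rV[R]_n -> \bar R}) :
  (forall a b, m1 (box a b) = m2 (box a b)) ->
  (forall a b, (m1 (box a b) < +oo)%E) ->
  forall A, measurable A -> m1 A = m2 A.
Proof.
move=> m12 m1oo; apply: (measure_unique boxes
  (fun k => box (const_mx (- k%:R)) (const_mx k%:R))).
- exact: boxes_generate.
- by move=> _ _ [a [b ->]] [a' [b' ->]]; rewrite boxI; eexists; eexists.
- by move=> i; eexists; eexists.
- exact: bigcup_box.
- by move=> _ [a [b ->]].
- by move=> k; exact: m1oo.
Qed.

Lemma cont_measurable (f : 'rV[R]_n -> R) : continuous f -> measurable_fun setT f.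
Proof.
move=> cf; apply: (@measurability _ _ _ _ _ _ _ (RGenOpens.measurableE R)).
move=> _ [_ [a [b ->]] <-].
rewrite setTI; apply: open_measurable_mx; apply: open_comp => [x _|]; first exact: cf.
exact: interval_open.
Qed.

Definition shift_rV (h : 'rV[R]_n) : 'rV[R]_n -> 'rV[R]_n := fun x => x + h.

Lemma measurable_shift h : measurable_fun setT (shift_rV h).
Proof.
apply: measurable_rowP => i; apply: cont_measurable.
rewrite (_ : (fun _ => _) = fun x : 'rV[R]_n => x 0 i + h 0 i).
  by apply: contD; [exact: coord_continuous|exact: contC].
by apply/funext => x; rewrite mxE.
Qed.

(** Translation does not change the sides of a box, and boxes determine the
    measure. *)
Lemma leb_shift h A : measurable A -> leb (shift_rV h @^-1` A) = leb A.
Proof.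
move=> mA; have [nu nuE] : exists nu : {measure set 'rV[R]_n -> \bar R},
    pushforward leb (shift_rV h) = nu.
  by unshelve eexists (pushforward leb (shift_rV h) : {measure set _ -> \bar _});
    [exact: measurable_shift|].
have preE a b : shift_rV h @^-1` box a b = box (a - h) (b - h).
  apply/seteqP; split => x H i; have := H i; rewrite !mxE => /andP[? ?];
    by apply/andP; split; lra.
have nub a b : nu (box a b) = leb (box a b).
  rewrite -nuE /pushforward preE !leb_boxE; apply: eq_bigr => i _.
  rewrite !lebesgue_measure_itv/= !mxE !lte_fin ltrD2r.
  by case: ifP => // _; rewrite -!EFinB; congr EFin; ring.
transitivity (nu A); first by rewrite -nuE.
apply: (@rV_measure_unique nu leb) => // a b; rewrite nub; exact: leb_box_lty.
Qed.

Lemma leb_bounded_lty (A : set 'rV[R]_n) : measurable A -> bounded_set A ->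
  (leb A < +oo)%E.
Proof.
move=> mA [M [_ MA]]; have := MA (`|M| + 1) _ => /(_ _)h.
have AB : A `<=` box (const_mx (- (`|M| + 2))) (const_mx (`|M| + 2)).
  move=> x Ax i; rewrite !mxE -ltr_norml; apply: le_lt_trans (coord_le_norm _ _) _.
  have := h _ x Ax; have := ler_norm M => hM /(_ ltac:(lra))/= hh.
  by apply: le_lt_trans hh _; lra.
apply: le_lt_trans (leb_box_lty (const_mx (- (`|M| + 2))) (const_mx (`|M| + 2))).
by apply: le_measure => //; rewrite inE//; exact: measurable_box.
Qed.

Lemma leb_open_gt0 (A : set 'rV[R]_n) : open A -> A !=set0 -> (0 < leb A)%E.
Proof.
move=> oA [x Ax]; have mA := open_measurable_mx oA.
move: oA; rewrite openE => /(_ _ Ax)/nbhs_ballP[e /= e0 eA].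
rewrite ball_box// in eA.
apply: (@lt_le_trans _ _ (leb (box (x - const_mx e) (x + const_mx e)))).
  by apply: leb_box_gt0 => i; rewrite !mxE; lra.
by apply: le_measure => //; rewrite inE//; exact: measurable_box.
Qed.

(** Infinitely many translates of a bounded piece of a hyperplane fit, pairwise
    disjointly, in a set of finite measure. *)
Lemma leb_hyperplane (b : 'rV[R]_n) s : b != 0 -> leb [set x | dotrV b x = s] = 0%E.
Proof.
move=> b0; have [i0 bi0] : exists i, b 0 i != 0.
  by apply/existsP; apply: contra_neqT b0 => /existsPn b0; apply/rowP => i;
    have := b0 i; rewrite negbK mxE => /eqP.
pose B k : set 'rV[R]_n := box (const_mx (- k%:R)) (const_mx k%:R).
pose H k := [set x | dotrV b x = s] `&` B k.
have mplane c : measurable [set x | dotrV b x = c].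
  rewrite -[X in measurable X]setTI.
  apply: (cont_measurable (@dotrV_continuous _ _ b) measurableT (measurable_set1 c)).
have mH k : measurable (H k) by apply: measurableI => //; exact: measurable_box.
have H0 k : leb (H k) = 0%E.
  pose t j : R := j.+1%:R^-1.
  have t01 j : 0 < t j <= 1.
    by rewrite invr_gt0 ltr0n/= invf_le1 ?ler1n ?ltr0n.
  pose E j := shift_rV (t j *: delta_mx 0 i0) @^-1` H k.
  have mE j : measurable (E j).
    by rewrite -[X in measurable X]setTI; exact: measurable_shift.
  have EB j : E j `<=` B k.+1.
    move=> x [_ xk] i; have := xk i; rewrite /shift_rV !mxE -natr1.
    have := t01 j; set d := (_ && _)%:R.
    have : 0 <= d <= 1 by rewrite /d ler0n lern1 leq_b1.
    by move=> /andP[? ?] /andP[? ?] /andP[? ?]; apply/andP; split; nra.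
  have tE : trivIset setT E.
    apply/trivIsetP => j l _ _ jl; apply/seteqP; split => // x [[/= h1 _] [/= h2 _]].
    move: h1; rewrite -h2 /shift_rV !dotrVDr !dotrVZr dotrV_delta; move=> /addrI/mulIf.
    move=> /(_ bi0)/invr_inj/eqP; rewrite eqr_nat eqSS => jlE.
    by move: jl; rewrite jlE.
  have [r rE] : exists r, leb (H k) = r%:E.
    have : (leb (H k) < +oo)%E.
      apply: le_lt_trans (leb_box_lty (const_mx (- k%:R)) (const_mx k%:R)).
      by apply: le_measure; rewrite ?inE//; [exact: measurable_box|apply: subIsetr].
    by move=> h; exists (fine (leb (H k))); rewrite fineK// ge0_fin_numE.
  have [l lE] : exists l, leb (B k.+1) = l%:E.
    have := leb_box_lty (const_mx (- k.+1%:R)) (const_mx k.+1%:R).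
    by move=> h; exists (fine (leb (B k.+1))); rewrite fineK// ge0_fin_numE.
  have rl N : r *+ N <= l.
    rewrite -lee_fin -lE.
    have -> : (r *+ N)%:E = leb (\big[setU/set0]_(j < N) E j).
      rewrite measure_bigsetU//.
      rewrite (eq_bigr (fun=> r%:E)) => [|j _].
        by rewrite sumEFin sumr_const card_ord.
      by rewrite -rE; exact: leb_shift.
    apply: le_measure; rewrite ?inE.
    - by apply: bigsetU_measurable.
    - exact: measurable_box.
    - by rewrite -bigcup_mkord => x [j _]; exact: EB.
  rewrite rE; congr EFin; apply/eqP; rewrite eq_le.
  have -> : 0 <= r by rewrite -lee_fin -rE.
  rewrite andbT leNgt; apply/negP => r0.
  have := rl (Num.truncn (l / r)).+1; rewrite -mulr_natl leNgt => /negP; apply.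
  by rewrite -ltr_pdivrMr// truncnS_gt.
have -> : [set x | dotrV b x = s] = \bigcup_k H k.
  by rewrite -setI_bigcupr bigcup_box setIT.
apply/negligibleP; first exact: bigcupT_measurable.
by apply: negligible_bigcup => k; apply/(negligibleP _ (mH k)); exact: H0.
Qed.

End boxes.

Section translation_integral.
Context {R : realType} {n : nat}.
Local Notation leb := (@lebesgue_rV R n).

Lemma ge0_integral_shift h (f : 'rV[R]_n -> \bar R) : measurable_fun setT f ->
  (forall x, 0 <= f x)%E ->
  (\int[leb]_x f (x + h)%R = \int[leb]_x f x)%E.
Proof.
move=> mf f0.
have := @ge0_integral_pushforward _ _ _ _ R (shift_rV h) (measurable_shift h)
  leb setT f measurableT mf (fun x _ => f0 x).
rewrite preimage_setT => <-.
apply: eq_measure_integral; first exact: measurable_shift.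
by move=> ? A mA _; exact: leb_shift.
Qed.

Lemma integrable_shift h (f : 'rV[R]_n -> R) :
  leb.-integrable setT (EFin \o f) ->
  leb.-integrable setT (EFin \o (fun x => f (x + h))).
Proof.
move=> /integrableP[mf fi]; apply/integrableP; split.
  exact: (measurableT_comp mf (measurable_shift h)).
by rewrite (@ge0_integral_shift h (fun x => `|(f x)%:E|%E))//; exact: measurableT_comp.
Qed.

Lemma Rintegral_shift h (f : 'rV[R]_n -> R) :
  leb.-integrable setT (EFin \o f) ->
  \int[leb]_x f (x + h) = \int[leb]_x f x.
Proof.
move=> fi; have mf := measurable_int _ fi; congr fine.
have := @integral_pushforward _ _ _ _ R (shift_rV h) (measurable_shift h)
  leb setT (EFin \o f) mf; rewrite preimage_setT => <- //; last exact: integrable_shift.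
apply: eq_measure_integral; first exact: measurable_shift.
by move=> ? A mA _; exact: leb_shift.
Qed.

End translation_integral.

Lemma negligible_bigcup_countable d (T : measurableType d) (R : realType)
    (mu : {measure set T -> \bar R}) (I : countType) (F : I -> set T) :
  (forall i, mu.-negligible (F i)) -> mu.-negligible (\bigcup_i F i).
Proof.
move=> NF; pose G k := if @unpickle I k is Some i then F i else set0.
apply: (@negligibleS _ _ _ _ (\bigcup_k G k)).
  by move=> x [i _ Fx]; exists (pickle i) => //; rewrite /G pickleK.
apply: negligible_bigcup => k; rewrite /G; case: unpickle => [i|]; first exact: NF.
exact: negligible_set0.
Qed.

(** * Smooth functions *)

Section difference_quotients.
Context {R : realType} {V : normedModType R}.

Lemma cvg_is_derive (f : V -> R) a v d :
  h^-1 *: (f (h *: v + a) - f a) @[h --> (0 : R)^'] --> (d : R^o) ->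
  is_derive a v f d.
Proof. by move=> cf; apply: DeriveDef; [apply/cvg_ex; exists d|exact: cvg_lim]. Qed.

Lemma is_derive_cvg (f : V -> R) a v d : is_derive a v f d ->
  h^-1 *: (f (h *: v + a) - f a) @[h --> (0 : R)^'] --> (d : R^o).
Proof. by case=> df <-; exact: df. Qed.

End difference_quotients.

Section smooth_functions.
Context {R : realType} {n : nat}.
Implicit Types (phi psi : 'rV[R]_n -> R) (x v : 'rV[R]_n) (i j : 'I_n).
Local Notation e_ i := (delta_mx 0 i : 'rV[R]_n).

Lemma is_derive_lineP phi x v (h0 d : R) :
  is_derive (h0 *: v + x) v phi d <->
  is_derive h0 1 (fun h : R => phi (h *: v + x)) d.
Proof.
have e : (fun h : R => h^-1 *: (phi (h *: v + (h0 *: v + x)) - phi (h0 *: v + x))) =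
  (fun h : R => h^-1 *: (phi ((h *: 1 + h0) *: v + x) - phi (h0 *: v + x))).
  by apply/funext => h; rewrite addrA -scalerDl [h%:A]mulr1.
split=> /is_derive_cvg h; apply: cvg_is_derive; first by rewrite -e.
by rewrite e.
Qed.

(** Smoothness is coinductive: it suffices to find a set of functions that is
    stable under partial derivatives. *)
Lemma smooth_coind (P : set ('rV[R]_n -> R)) :
  (forall phi, P phi -> [/\ continuous phi,
     forall x i, derivable (phi : 'rV[R]_n -> R^o) x (e_ i) &
     forall i, P (partial i phi)]) ->
  forall phi, P phi -> smooth phi.
Proof.
move=> HP phi Pphi s; suff /HP[? ? _] : P (partials s phi) by [].
by elim: s => //= i s /HP[].
Qed.

Lemma smoothP phi : smooth phi -> [/\ continuous phi,
     forall x i, derivable (phi : 'rV[R]_n -> R^o) x (e_ i) &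
     forall i, smooth (partial i phi)].
Proof.
move=> sphi; have [c d] := sphi [::]; split; [exact: c|exact: d|move=> i s].
by have := sphi (rcons s i); rewrite /partials foldr_rcons.
Qed.

Lemma smooth_is_derive phi x i : smooth phi -> is_derive x (e_ i) phi (partial i phi x).
Proof. by move=> /smoothP[_ + _] => /(_ x i) d; apply: DeriveDef. Qed.

Lemma partialE phi i (d : 'rV[R]_n -> R) :
  (forall x, is_derive x (e_ i) phi (d x)) -> partial i phi = d.
Proof. by move=> H; apply/funext => x; have [_ <-] := H x. Qed.

(** A partial derivative of a product is a sum of products, so products alone
    are not a stable set: the whole algebra is needed. *)
Inductive smooth_algebra : ('rV[R]_n -> R) -> Prop :=
| smooth_algebra_base phi of smooth phi : smooth_algebra phi
| smooth_algebra_add phi psi of smooth_algebra phi & smooth_algebra psi :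
    smooth_algebra (fun x => phi x + psi x)
| smooth_algebra_mul phi psi of smooth_algebra phi & smooth_algebra psi :
    smooth_algebra (fun x => phi x * psi x).

Lemma is_derive_add phi psi x v d d' : is_derive x v phi d -> is_derive x v psi d' ->
  is_derive x v (fun x => phi x + psi x) (d + d').
Proof. by move=> h h'; exact: (@is_deriveD R 'rV[R]_n R^o). Qed.

Lemma is_derive_mul phi psi x v d d' : is_derive x v phi d -> is_derive x v psi d' ->
  is_derive x v (fun x => phi x * psi x) (phi x * d' + psi x * d).
Proof. by move=> h h'; exact: (@is_deriveM R 'rV[R]_n). Qed.

Lemma smooth_algebraP phi : smooth_algebra phi -> [/\ continuous phi,
     forall x i, derivable (phi : 'rV[R]_n -> R^o) x (e_ i) &
     forall i, smooth_algebra (partial i phi)].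
Proof.
elim=> {phi} [phi sphi|phi psi aphi [c d p] apsi [c' d' p']|
              phi psi aphi [c d p] apsi [c' d' p']].
- have [c d p] := smoothP sphi.
  by split => // i; apply: smooth_algebra_base; exact: p.
- have D x i := is_derive_add (DeriveDef (d x i) erefl) (DeriveDef (d' x i) erefl).
  split => [|x i|i]; first exact: contD.
    by have [] := D x i.
  by rewrite (partialE (D ^~ i)); apply: smooth_algebra_add; [exact: p|exact: p'].
- have D x i := is_derive_mul (DeriveDef (d x i) erefl) (DeriveDef (d' x i) erefl).
  split => [|x i|i]; first exact: contM.
    by have [] := D x i.
  rewrite (partialE (D ^~ i)); apply: smooth_algebra_add; apply: smooth_algebra_mul => //.
    exact: p'.
  exact: p.
Qed.

Lemma smooth_algebra_smooth phi : smooth_algebra phi -> smooth phi.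
Proof. by apply: smooth_coind; exact: smooth_algebraP. Qed.

Lemma smoothM phi psi : smooth phi -> smooth psi -> smooth (fun x => phi x * psi x).
Proof. by move=> *; apply/smooth_algebra_smooth/smooth_algebra_mul; exact: smooth_algebra_base. Qed.

Lemma is_derive_affine (u : 'rV[R]_n) c x i :
  is_derive x (e_ i) (affine_rV u c) (u 0 i).
Proof.
apply: cvg_is_derive; apply: (@cvg_trans _ (u 0 i @[h --> (0 : R)^'])); last exact: cvg_cst.
apply: near_eq_cvg; near=> h; have h0 : h != 0 by near: h; exact: nbhs_dnbhs_neq.
rewrite /affine_rV dotrVDr dotrVZr dotrV_delta.
rewrite [X in _ *: X](_ : _ = h * u 0 i); first by rewrite [RHS]mulKf.
by rewrite opprD addrA [X in X - _]addrC; ring.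
Unshelve. all: by end_near. Qed.

Lemma smooth_affine u c : smooth (affine_rV u c : 'rV[R]_n -> R).
Proof.
apply: (@smooth_coind [set phi | exists u c, phi = affine_rV u c]); last by exists u, c.
move=> _ [{}u [{}c ->]]; split => [|x i|i].
- by apply: contD; [exact: dotrV_continuous|exact: contC].
- by have [] := is_derive_affine u c x i.
- exists 0, (u 0 i); rewrite (partialE (fun x => is_derive_affine u c x i)).
  by apply/funext => x; rewrite /affine_rV dotrV0l add0r.
Qed.

Lemma smooth_cst (c : R) : smooth (fun _ : 'rV[R]_n => c).
Proof.
rewrite (_ : (fun _ => c) = affine_rV 0 c); first exact: smooth_affine.
by apply/funext => x; rewrite /affine_rV dotrV0l add0r.
Qed.

Lemma smooth_dotrV (u : 'rV[R]_n) : smooth (dotrV u).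
Proof.
rewrite (_ : dotrV u = affine_rV u 0); first exact: smooth_affine.
by apply/funext => x; rewrite /affine_rV addr0.
Qed.

Lemma smooth_prod I (r : seq I) (F : I -> 'rV[R]_n -> R) :
  (forall k, smooth (F k)) -> smooth (fun x => \prod_(k <- r) F k x).
Proof.
move=> sF; elim: r => [|k r IH].
  rewrite (_ : (fun _ => _) = fun=> 1); first exact: smooth_cst.
  by apply/funext => x; rewrite big_nil.
rewrite (_ : (fun _ => _) = fun x => F k x * \prod_(j <- r) F j x).
  by apply: smoothM => [|]; [exact: sF|exact: IH].
by apply/funext => x; rewrite big_cons.
Qed.

End smooth_functions.

Section flat_function.
Context {R : realType}.
Implicit Types (p : {poly R}) (t : R).

(** Differentiating [exp (- 1 / t)] only multiplies it by polynomials in [1 / t],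
    hence the polynomial factor [p]. *)
Definition flat p t : R := if 0 < t then p.[t^-1] * expR (- t^-1) else 0.

(** The quadratic bound yields the derivative at the origin; it holds because
    [exp s] dominates every [s ^+ (i + 2) / (i + 2)!]. *)
Lemma flat_le p : exists2 C : R, 0 <= C & forall t, `|flat p t| <= C * t ^+ 2.
Proof.
exists (\sum_(i < size p) `|p`_i| * (i.+2)`!%:R).
  by apply: sumr_ge0 => i _; rewrite mulr_ge0.
move=> t; rewrite /flat; case: ifPn => t0; last first.
  rewrite normr0 mulr_ge0 ?sqr_ge0//.
  by apply: sumr_ge0 => i _; rewrite mulr_ge0.
rewrite horner_coef mulr_suml mulr_suml.
apply: (le_trans (ler_norm_sum _ _ _)); apply: ler_sum => i _.
rewrite -!mulrA normrM ler_wpM2l// normrM ger0_norm; last first.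
  by rewrite exprn_ge0// invr_ge0 ltW.
rewrite ger0_norm ?expR_ge0// expRN ler_pdivrMr ?expR_gt0//.
have s0 : 0 <= t^-1 by rewrite invr_ge0 ltW.
have := @expR_ge1Dxn R _ i.+1 s0; set E := expR _ => hE.
have {hE} : t^-1 ^+ i.+2 / (i.+2)`!%:R <= E by lra.
rewrite ler_pdivrMr ?ltr0n ?fact_gt0// => hE.
rewrite (_ : t^-1 ^+ i = t^-1 ^+ i.+2 * t ^+ 2); last first.
  by rewrite -addn2 exprD -mulrA -exprMn mulVf ?expr1n ?mulr1 ?gt_eqF.
by have := ler_wpM2r (sqr_ge0 t) hE; lra.
Qed.

Lemma is_derive_inv t : t != 0 -> is_derive t 1 (fun s : R => s^-1) (- t ^- 2).
Proof.
move=> t0; apply: DeriveDef.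
  by apply: (@derivableV _ _ id) => //; exact: derivable_id.
by rewrite (@deriveV _ _ id)// derive_id [LHS]mulr1.
Qed.

Lemma is_derive_flat p t :
  is_derive t 1 (flat p) (flat ('X^2 * (p - p^`())) t).
Proof.
have [t0|t0|->] := ltgtP t 0.
- rewrite [X in is_derive _ _ _ X](_ : _ = 0); last by rewrite /flat ltNge (ltW t0).
  apply: (@near_eq_is_derive _ _ _ (cst 0)); rewrite ?oner_eq0//.
  near=> s; rewrite /flat ifF//; apply/negbTE; rewrite -leNgt ltW//.
  by near: s; exact: lt_nbhsl.
- apply: (@near_eq_is_derive R R^o R^o (fun s : R => p.[s^-1] * expR (- s^-1))).
    near=> s; rewrite /flat ifT//; near: s; exact: lt_nbhsr.
  have tn0 : t != 0 by rewrite gt_eqF.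
  have dV := is_derive_inv tn0.
  have dN : is_derive t 1 (fun s : R => - s^-1) (- (- t ^- 2)) by exact: is_deriveN.
  have d1 : is_derive t 1 (fun s : R => p.[s^-1]) (p^`().[t^-1] * (- t ^- 2)).
    exact: (@is_derive1_comp _ (horner p) (fun s => s^-1) _ _ _ (is_derive_poly p t^-1) dV).
  have d2 : is_derive t 1 (fun s : R => expR (- s^-1)) (expR (- t^-1) * (- (- t ^- 2))).
    exact: (@is_derive1_comp _ expR (fun s => - s^-1) _ _ _ (is_derive_expR (- t^-1)) dN).
  apply: is_derive_eq (@is_deriveM R R^o _ _ _ _ _ _ d1 d2) _.
  rewrite /flat t0 !hornerE opprK -!exprVn -![_ *: _]/(_ * _) /=.
  by ring.
- have [C C0 CF] := flat_le p.
  rewrite {2}/flat ltxx; apply: cvg_is_derive; apply/cvgr0Pnorm_le => e e0.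
  near=> h; rewrite addr0 [h%:A]mulr1 {2}/flat ltxx subr0 normrZ.
  have h0 : h != 0 by near: h; exact: nbhs_dnbhs_neq.
  apply: (@le_trans _ _ (`|h^-1| * (C * h ^+ 2))); first by rewrite ler_wpM2l.
  rewrite -[h ^+ 2]ger0_norm ?sqr_ge0// normrX normfV mulrCA expr2 mulKf ?normr_eq0//.
  have : `|h| <= e / (C + 1) by near: h; apply: dnbhs0_le; rewrite divr_gt0// ltr_wpDl.
  rewrite ler_pdivlMr ?ltr_wpDl// => he.
  by have := normr_ge0 h; nra.
Unshelve. all: by end_near. Qed.

Lemma flat_continuous p : continuous (flat p).
Proof.
move=> t; apply/differentiable_continuous/derivable1_diffP.
by have [] := is_derive_flat p t.
Qed.

End flat_function.

Section smooth_flat.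
Context {R : realType} {n : nat}.

Lemma smooth_flat (p : {poly R}) (a b : R) (j : 'I_n) :
  smooth (fun x : 'rV[R]_n => flat p (a * x 0 j + b)).
Proof.
pose P := [set phi : 'rV[R]_n -> R | exists c q, phi = fun x => c * flat q (a * x 0 j + b)].
apply: (@smooth_coind _ _ P); last first.
  by exists 1, p; apply/funext => x; rewrite mul1r.
move=> _ [c [q ->]].
have D (x : 'rV[R]_n) i : is_derive x (delta_mx 0 i)
    (fun x : 'rV[R]_n => c * flat q (a * x 0 j + b))
    ((c * (a * (delta_mx 0 i : 'rV[R]_n) 0 j)) * flat ('X^2 * (q - q^`())) (a * x 0 j + b)).
  rewrite -[x in is_derive x _ _ _]add0r -[X in is_derive (X + _) _ _ _](scale0r (delta_mx 0 i)).
  apply/is_derive_lineP.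
  set d := (delta_mx 0 i : 'rV[R]_n) 0 j.
  rewrite (_ : (fun _ => _) = (fun t => c * flat q (a * d * t + (a * x 0 j + b)))); last first.
    by apply/funext => h; rewrite !mxE -/d; congr (_ * flat _ _); rewrite /d !mxE; ring.
  have dl : is_derive (0 : R) 1 (fun t : R => a * d * t + (a * x 0 j + b)) (a * d).
    apply: cvg_is_derive; apply: (@cvg_trans _ (a * d @[h --> (0 : R)^'])); last exact: cvg_cst.
    apply: near_eq_cvg; near=> h; have h0 : h != 0 by near: h; exact: nbhs_dnbhs_neq.
    rewrite [h%:A]mulr1; rewrite [X in _ *: X](_ : _ = h * (a * d)); last by ring.
    by rewrite [RHS]mulKf.
  have df : is_derive (a * d * 0 + (a * x 0 j + b)) 1 (flat q)
      (flat ('X^2 * (q - q^`())) (a * x 0 j + b)).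
    by rewrite mulr0 add0r; exact: is_derive_flat.
  have dc := @is_derive1_comp _ (flat q) (fun t => a * d * t + (a * x 0 j + b))
    0 _ _ df dl.
  apply: is_derive_eq (is_deriveZ c dc) _.
  by rewrite -[_ *: _]/(_ * _); ring.
split => [|x i|i].
- apply: contM; first exact: contC.
  move=> x; apply: (@continuous_comp _ _ _ (fun x : 'rV[R]_n => a * x 0 j + b) (flat q)).
    move: x; apply: contD; last exact: contC.
    by apply: contM; [exact: contC|exact: coord_continuous].
  exact: flat_continuous.
- by have [] := D x i.
- exists (c * (a * (delta_mx 0 i : 'rV[R]_n) 0 j)), ('X^2 * (q - q^`())).
  exact: partialE (D ^~ i).
Unshelve. all: by end_near. Qed.

End smooth_flat.

(** * Test functions and integration by parts *)

Section bounded_support.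
Context {R : realType} {n : nat}.
Local Notation leb := (@lebesgue_rV R n).
Implicit Types (f : 'rV[R]_n -> R).

Lemma norm_cball_closed (r : R) : closed [set x : 'rV[R]_n | `|x| <= r].
Proof.
apply: (@closed_comp _ _ (fun x : 'rV[R]_n => `|x|) [set y | y <= r]).
  by move=> x _; exact: norm_continuous.
exact: closed_le.
Qed.

Lemma closed_measurable_rV (C : set 'rV[R]_n) : closed C -> measurable C.
Proof.
by move=> /closed_openC/open_measurable_mx/measurableC; rewrite setCK.
Qed.

Lemma norm_cball_bounded (r : R) : bounded_set [set x : 'rV[R]_n | `|x| <= r].
Proof. by exists r; split => [|M rM x /= xr]; [exact: num_real|rewrite (le_trans xr)// ltW]. Qed.

Lemma bounded_integrable (D : set 'rV[R]_n) f (M : R) : measurable D -> bounded_set D ->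
  measurable_fun D f -> (forall x, D x -> `|f x| <= M) ->
  leb.-integrable D (EFin \o f).
Proof.
move=> mD bD mf fM; apply: measurable_bounded_integrable => //.
  exact: leb_bounded_lty.
by exists M; split => [|M' MM' x Dx /=]; [exact: num_real|exact: le_trans (fM _ Dx) (ltW MM')].
Qed.

Lemma bounded_support_integrable f (M r : R) : measurable_fun setT f ->
  (forall x, `|f x| <= M) -> (forall x, r < `|x| -> f x = 0) ->
  leb.-integrable setT (EFin \o f).
Proof.
move=> mf fM fr; pose D := [set x : 'rV[R]_n | `|x| <= r].
have mD : measurable D by apply: closed_measurable_rV; exact: norm_cball_closed.
rewrite (_ : EFin \o f = (EFin \o f) \_ D).
  apply/(integrable_mkcond _ mD); apply: (@bounded_integrable _ _ M) => //.
    exact: norm_cball_bounded.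
  exact: measurable_funTS.
apply/funext => x; rewrite patchE; case: ifPn => //= xD; rewrite fr//.
by rewrite ltNge; apply: contra xD => ?; rewrite inE.
Qed.

Lemma Rintegral_supp (Omega : set 'rV[R]_n) f : (forall x, ~ Omega x -> f x = 0) ->
  \int[leb]_(x in Omega) f x = \int[leb]_x f x.
Proof.
move=> f0; rewrite Rintegral_mkcond; congr (Rintegral _ _ _); apply/funext => x.
by rewrite patchE; case: ifPn => // /negP xO; rewrite f0// => Ox; apply: xO; rewrite inE.
Qed.

End bounded_support.

Section test_functions.
Context {R : realType} {n : nat}.
Local Notation leb := (@lebesgue_rV R n).
Local Notation e_ i := (delta_mx 0 i : 'rV[R]_n).
Implicit Types (Omega : set 'rV[R]_n) (phi psi : 'rV[R]_n -> R) (i : 'I_n).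

Lemma test_smooth Omega phi : test_function Omega phi -> smooth phi.
Proof. by case. Qed.

Lemma test_continuous Omega phi : test_function Omega phi -> continuous phi.
Proof. by move=> /test_smooth/smoothP[]. Qed.

Lemma test_measurable Omega phi : test_function Omega phi -> measurable_fun setT phi.
Proof. by move=> /test_continuous/cont_measurable. Qed.

Lemma test_out Omega phi x : test_function Omega phi -> ~ Omega x -> phi x = 0.
Proof. by move=> [_ [K [_ KO Kphi]]] Ox; apply: Kphi => /KO. Qed.

Lemma test_partial Omega phi i : test_function Omega phi ->
  test_function Omega (partial i phi).
Proof.
move=> [sphi [K [cK KO Kphi]]]; split.
  by have [_ _ h] := smoothP sphi; exact: h.
exists K; split => // x Kx.
have oK : open (~` K).
  apply: closed_openC; apply: compact_closed => //; exact: norm_hausdorff.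
have : is_derive x (e_ i) phi (0 : R).
  apply: (@near_eq_is_derive R 'rV[R]_n R^o (cst 0)).
  by move: oK; rewrite openE => /(_ _ Kx); apply: filterS => y Ky; rewrite Kphi.
by case.
Qed.

Lemma test_bounded Omega phi : test_function Omega phi ->
  exists M r : R, [/\ 0 <= M, 0 <= r, forall x, `|phi x| <= M &
    forall x, r < `|x| -> phi x = 0].
Proof.
move=> tphi; have cphi := test_continuous tphi.
case: tphi => _ [K [cK KO Kphi]].
have [r [_ Kr]] := compact_bounded cK.
have : compact (phi @` K) by apply: continuous_compact => //; exact: continuous_subspaceT.
move=> /compact_bounded[M [_ KM]].
exists (`|M| + 1), (`|r| + 1); split; rewrite ?addr_ge0//.
- move=> x; have [Kx|Kx] := pselect (K x).
    apply: (KM (`|M| + 1)); last by exists x.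
    by rewrite (le_lt_trans (ler_norm M))// ltrDl.
  by rewrite Kphi// normr0 addr_ge0.
- move=> x rx; apply: Kphi => Kx; move: rx; rewrite ltNge => /negP; apply.
  by apply: Kr => //; rewrite (le_lt_trans (ler_norm r))// ltrDl.
Qed.

Lemma test_mul Omega phi psi : test_function Omega phi -> smooth psi ->
  test_function Omega (fun x => phi x * psi x).
Proof.
move=> [sphi [K [cK KO Kphi]]] spsi; split; first exact: smoothM.
by exists K; split => // x Kx; rewrite Kphi// mul0r.
Qed.

Lemma test_integrable Omega phi : test_function Omega phi ->
  leb.-integrable setT (EFin \o phi).
Proof.
move=> tphi; have [M [r [_ _ PM Pr]]] := test_bounded tphi.
exact: (bounded_support_integrable (test_measurable tphi) PM Pr).
Qed.

Lemma loc_integrable_mul_test Omega (w : 'rV[R]_n -> R) phi : measurable Omega ->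
  loc_integrable Omega w -> test_function Omega phi ->
  leb.-integrable Omega (EFin \o (fun x => w x * phi x)).
Proof.
move=> mO lw tphi; have mphi := test_measurable tphi.
have [M [_ [M0 _ PM _]]] := test_bounded tphi.
case: tphi => _ [K [cK KO Kphi]]; have wK := lw K cK KO.
have mK : measurable K.
  by apply: closed_measurable_rV; apply: compact_closed => //; exact: norm_hausdorff.
have h : leb.-integrable K (EFin \o (fun x => w x * phi x)).
  apply: (@le_integrable _ _ _ leb K mK _ (fun x => M%:E * (w x)%:E)%E).
  - apply/measurable_EFinP; apply: measurable_funM; last exact: measurable_funTS.
    by apply/measurable_EFinP; exact: measurable_int wK.
  - move=> x _; rewrite /= lee_fin mulrC !normrM (ger0_norm M0).
    by rewrite ler_wpM2r.
  - exact: integrableZl.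
apply/(integrable_mkcond _ mO).
rewrite (_ : _ \_ _ = (EFin \o (fun x => w x * phi x)) \_ K).
  exact: (iffLR (integrable_mkcond _ mK) h).
apply/funext => x; rewrite !patchE.
have [Kx|Kx] := pselect (K x); first by rewrite !mem_set//; exact: KO.
by rewrite [x \in K]memNset//=; case: ifP => //=; rewrite Kphi// mulr0.
Qed.

Lemma line_MVT phi x i (h : R) : smooth phi -> exists2 t : R, `|t| <= `|h| &
  phi (x + h *: e_ i) - phi x = h * partial i phi (x + t *: e_ i).
Proof.
move=> sphi; pose g t := phi (t *: e_ i + x).
have dg (t : R) : is_derive t 1 g (partial i phi (t *: e_ i + x)).
  by apply/is_derive_lineP; exact: smooth_is_derive.
have cg : continuous g.
  move=> t; apply/differentiable_continuous/derivable1_diffP.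
  by have [] := dg t.
have g0 : g 0 = phi x by rewrite /g scale0r add0r.
have [h0|h0|->] := ltgtP h 0.
- have [t] := MVT h0 (fun t _ => dg t) (continuous_subspaceT cg).
  rewrite in_itv/= => /andP[ht t0]; rewrite g0 sub0r => e.
  exists t; first by rewrite !ltr0_norm// lerN2 ltW.
  by rewrite !(addrC x) -/(g h); lra.
- have [t] := MVT h0 (fun t _ => dg t) (continuous_subspaceT cg).
  rewrite in_itv/= => /andP[t0 ht]; rewrite g0 subr0 => e.
  exists t; first by rewrite !gtr0_norm// ltW.
  by rewrite !(addrC x) -/(g h); lra.
- by exists 0; rewrite ?normr0// scale0r addr0 subrr mul0r.
Qed.

Lemma test_lipschitz Omega phi i : test_function Omega phi -> exists2 M : R, 0 <= M &
  forall x h, `|phi (x + h *: e_ i) - phi x| <= M * `|h|.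
Proof.
move=> tphi; have [M [_ [M0 _ PM _]]] := test_bounded (test_partial i tphi).
exists M => // x h; have [t _ ->] := line_MVT x i h (test_smooth tphi).
by rewrite normrM mulrC ler_wpM2r.
Qed.

Lemma test_taylor Omega phi i : test_function Omega phi -> exists2 M : R, 0 <= M &
  forall x h, `|phi (x + h *: e_ i) - phi x - h * partial i phi x| <= M * h ^+ 2.
Proof.
move=> tphi; have [M M0 HM] := test_lipschitz i (test_partial i tphi).
exists M => // x h; have [t th ->] := line_MVT x i h (test_smooth tphi).
rewrite -mulrBr normrM -[h ^+ 2]ger0_norm ?sqr_ge0// normrX expr2 mulrCA ler_wpM2l//.
by apply: le_trans (HM x t) _; rewrite ler_wpM2l.
Qed.

(** The integral of a difference quotient vanishes by translation invariance,
    and by the Taylor bound difference quotients converge uniformly. *)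
Lemma Rintegral_partial Omega phi i : test_function Omega phi ->
  \int[leb]_x partial i phi x = 0.
Proof.
move=> tphi; set I := Rintegral _ _ _.
have [M M0 HM] := test_taylor i tphi.
have [_ [r [_ r0 _ Pr]]] := test_bounded tphi.
have [_ [r' [_ r'0 _ Pr']]] := test_bounded (test_partial i tphi).
have iphi := test_integrable tphi; have idphi := test_integrable (test_partial i tphi).
pose s := r + r' + 1.
have ms : measurable [set x : 'rV[R]_n | `|x| <= s].
  by apply: closed_measurable_rV; exact: norm_cball_closed.
pose V := fine (leb [set x : 'rV[R]_n | `|x| <= s]).
have V0 : 0 <= V by rewrite /V fine_ge0.
have ne1 := norm_delta_le1 (R := R) i.
have main h : 0 < h <= 1 -> h * `|I| <= M * h ^+ 2 * V.
  move=> /andP[h0 h1]; pose g x := phi (x + h *: e_ i) - phi x - h * partial i phi x.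
  have ish := integrable_shift (h *: e_ i) iphi.
  have i1 : leb.-integrable setT (EFin \o (fun x => phi (x + h *: e_ i) - phi x)).
    by have := integrableB measurableT ish iphi; apply: eq_integrable.
  have i2 : leb.-integrable setT (EFin \o (fun x => h * partial i phi x)).
    by have := @integrableZl _ _ _ leb _ measurableT h _ idphi; apply: eq_integrable.
  have ig : leb.-integrable setT (EFin \o g).
    by have := integrableB measurableT i1 i2; apply: eq_integrable.
  have gI : \int[leb]_x g x = - (h * I).
    rewrite RintegralB// RintegralB// Rintegral_shift// subrr sub0r.
    by rewrite RintegralZl.
  rewrite -{1}(gtr0_norm h0) -normrM -normrN -gI.
  apply: (le_trans (le_normr_Rintegral measurableT ig)).
  have g0 x : ~ `|x| <= s -> `|g x| = 0.
    move=> /negP; rewrite -ltNge => sx.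
    have rx' : r' < `|x| by apply: le_lt_trans sx; rewrite /s addrAC lerDr addr_ge0.
    have rx : r < `|x| by apply: le_lt_trans sx; rewrite /s -addrA lerDl addr_ge0.
    have rxh : r < `|x + h *: e_ i|.
      have he : h * `|e_ i| <= 1 by apply: mulr_ile1 => //; exact: ltW.
      apply: (@lt_le_trans _ _ (`|x| - 1)).
        by rewrite ltrBrDr; apply: le_lt_trans sx; rewrite /s lerD2r lerDl.
      rewrite lerBlDr; apply: (@le_trans _ _ (`|x + h *: e_ i| + h * `|e_ i|)).
        rewrite -{2}(gtr0_norm h0) -normrZ; have := ler_normB (x + h *: e_ i) (h *: e_ i).
        by rewrite addrK.
      by rewrite lerD2l.
    by rewrite /g Pr'// !Pr// mulr0 !subr0 normr0.
  rewrite -(@Rintegral_supp _ _ [set x | `|x| <= s])//.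
  rewrite -Rintegral_cst//; apply: le_Rintegral => //.
  - apply: (@bounded_integrable _ _ _ _ (M * h ^+ 2)) => //.
    + exact: norm_cball_bounded.
    + apply: measurable_funTS; apply: measurableT_comp => //.
      by apply/measurable_EFinP; exact: measurable_int ig.
    + by move=> x _; rewrite normr_id; exact: HM.
  - apply: (@bounded_integrable _ _ _ _ (`|M * h ^+ 2|)) => //.
    exact: norm_cball_bounded.
  - by move=> x _; exact: HM.
apply/eqP; rewrite -normr_eq0 eq_le normr_ge0 andbT; apply/ler_addgt0Pr => e e0.
rewrite add0r; pose h := Num.min 1 (e / (M * V + 1)).
have MV : 0 < M * V + 1 by rewrite ltr_wpDl// mulr_ge0.
have h0 : 0 < h by rewrite lt_min ltr01 divr_gt0.
have h1 : h <= 1 by rewrite ge_min lexx.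
have he : h * (M * V + 1) <= e.
  by rewrite -ler_pdivlMr// ge_min lexx orbT.
have := main h; rewrite h0 h1 => /(_ isT).
rewrite expr2 (_ : M * (h * h) * V = h * (h * (M * V))); last by ring.
rewrite ler_pM2l// => /le_trans; apply; apply: le_trans he.
by apply: ler_wpM2l; [exact: ltW|rewrite lerDl].
Qed.

Lemma partial_mul phi psi i : smooth phi -> smooth psi ->
  partial i (fun x => phi x * psi x) =
  (fun x => phi x * partial i psi x + psi x * partial i phi x).
Proof.
move=> sphi spsi; apply: partialE => x.
by apply: is_derive_mul; exact: smooth_is_derive.
Qed.

Lemma ibp Omega phi psi i : test_function Omega phi -> smooth psi ->
  \int[leb]_(x in Omega) (psi x * partial i phi x) =
  - \int[leb]_(x in Omega) (partial i psi x * phi x).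
Proof.
move=> tphi spsi; have tphi' := test_partial i tphi.
rewrite (@Rintegral_supp _ _ _ (fun x => psi x * partial i phi x)); last first.
  by move=> x Ox; rewrite (test_out tphi' Ox) mulr0.
rewrite (@Rintegral_supp _ _ _ (fun x => partial i psi x * phi x)); last first.
  by move=> x Ox; rewrite (test_out tphi Ox) mulr0.
apply/eqP; rewrite -subr_eq0 opprK; apply/eqP.
have [_ _ /(_ i) spsi'] := smoothP spsi.
rewrite -RintegralD//; last 2 first.
- have := test_integrable (test_mul tphi' spsi); apply: eq_integrable => // x _ /=.
  by rewrite mulrC.
- have := test_integrable (test_mul tphi spsi'); apply: eq_integrable => // x _ /=.
  by rewrite mulrC.
rewrite -(Rintegral_partial i (test_mul tphi spsi)) (partial_mul i (test_smooth tphi) spsi).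
by apply: eq_Rintegral => x _; ring.
Qed.

End test_functions.

(** * The fundamental lemma of the calculus of variations *)

Section bumps.
Context {R : realType} {n : nat}.
Implicit Types (a b x : 'rV[R]_n) (k : nat).

Definition cbox a b : set 'rV[R]_n := [set x | forall i, a 0 i <= x 0 i <= b 0 i].

(** Each factor tends to [1] inside the box when [k] grows and vanishes outside,
    so that these bumps converge to the indicator of the open box. *)
Definition box_bump a b k x : R := \prod_(j < n)
  (flat 1 (k.+1%:R * x 0 j + (- k.+1%:R * a 0 j)) *
   flat 1 (- k.+1%:R * x 0 j + k.+1%:R * b 0 j)).

Lemma box_cbox a b : box a b `<=` cbox a b.
Proof. by move=> x abx i; have /andP[/ltW -> /ltW ->] := abx i. Qed.

Lemma closed_cbox a b : closed (cbox a b).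
Proof.
rewrite (_ : cbox a b = \bigcap_(i in [set: 'I_n])
    ((fun v : 'rV[R]_n => v 0 i) @^-1` `[a 0 i, b 0 i]%classic)).
  apply: closed_bigI => i _; apply: closed_comp => [x _|]; first exact: coord_continuous.
  exact: interval_closed.
apply/seteqP; split => [v abv i _|v abv i]; first by rewrite /= in_itv /=.
by have := abv i I; rewrite /= in_itv.
Qed.

Lemma measurable_cbox a b : measurable (cbox a b).
Proof. by apply: closed_measurable_rV; exact: closed_cbox. Qed.

Lemma bounded_cbox a b : bounded_set (cbox a b).
Proof.
exists (`|a| + `|b|); split => [|M ltM x abx]; first exact: num_real.
apply: le_trans (ltW ltM); apply: norm_leP => [|i]; first exact: addr_ge0.
have /andP[ax xb] := abx i.
have := coord_le_norm a i; have := coord_le_norm b i.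
rewrite !ler_norml => /andP[b1 b2] /andP[a1 a2]; apply/andP; split.
  by have := normr_ge0 b; lra.
by have := normr_ge0 a; lra.
Qed.

Lemma compact_cbox a b : compact (cbox a b).
Proof. by apply: bounded_closed_compact; [exact: bounded_cbox|exact: closed_cbox]. Qed.

Lemma flat1E (t : R) : flat 1 t = if 0 < t then expR (- t^-1) else 0.
Proof. by rewrite /flat hornerC mul1r. Qed.

Lemma flat1_ge0 (t : R) : 0 <= flat 1 t.
Proof. by rewrite flat1E; case: ifP => // _; exact: expR_ge0. Qed.

Lemma flat1_le1 (t : R) : flat 1 t <= 1.
Proof.
by rewrite flat1E; case: ifP => // t0; rewrite expR_le1 oppr_le0 invr_ge0 ltW.
Qed.

Lemma flat1_gt0 (t : R) : 0 < t -> 0 < flat 1 t.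
Proof. by move=> t0; rewrite flat1E t0 expR_gt0. Qed.

Lemma smooth_bump a b k : smooth (box_bump a b k).
Proof.
apply: smooth_prod => j; apply: smoothM; exact: smooth_flat.
Qed.

Lemma bump_ge0 a b k x : 0 <= box_bump a b k x.
Proof. by apply: prodr_ge0 => j _; rewrite mulr_ge0// flat1_ge0. Qed.

Lemma bump_le1 a b k x : box_bump a b k x <= 1.
Proof.
apply: prodr_ile1 => j _; rewrite mulr_ge0 ?flat1_ge0//=.
by rewrite mulr_ile1 ?flat1_ge0 ?flat1_le1.
Qed.

Lemma bumpE a b k x : box_bump a b k x = \prod_(j < n)
  (flat 1 (k.+1%:R * (x 0 j - a 0 j)) * flat 1 (k.+1%:R * (b 0 j - x 0 j))).
Proof.
by apply: eq_bigr => j _; congr (flat _ _ * flat _ _); ring.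
Qed.

Lemma bump_out a b k x : ~ box a b x -> box_bump a b k x = 0.
Proof.
move=> /existsNP[j /negP]; rewrite negb_and -!leNgt => abx.
apply/eqP; rewrite bumpE prodf_seq_eq0; apply/hasP; exists j; first exact: mem_index_enum.
rewrite mulf_eq0 !flat1E; apply/orP; move: abx => /orP[xa|bx]; [left|right].
  rewrite ifF// ltNge; apply/negbF.
  by rewrite pmulr_rle0 ?ltr0n// subr_le0.
rewrite ifF// ltNge; apply/negbF.
by rewrite pmulr_rle0 ?ltr0n// subr_le0.
Qed.

Lemma bump_gt0 a b k x : box a b x -> 0 < box_bump a b k x.
Proof.
move=> abx; rewrite bumpE; apply: prodr_gt0 => j _; have /andP[ax xb] := abx j.
by rewrite mulr_gt0// flat1_gt0// mulr_gt0// subr_gt0.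
Qed.

Lemma cvg_flat1 (s : R) : 0 < s -> flat 1 (k.+1%:R * s) @[k --> \oo] --> (1 : R).
Proof.
move=> s0; under eq_fun do rewrite flat1E mulr_gt0 ?ltr0n//.
suff : expR (- (k.+1%:R * s)^-1) @[k --> \oo] --> expR (- (0 * s^-1)).
  by rewrite mul0r oppr0 expR0.
apply: continuous_cvg; first exact: continuous_expR.
apply: cvgN; under eq_fun do rewrite invfM.
by apply: cvgM; [exact: (@cvg_harmonic R)|exact: cvg_cst].
Qed.

Lemma cvg_bump a b x : box_bump a b k x @[k --> \oo] --> (\1_(box a b) x : R).
Proof.
rewrite indicE; have [abx|/negP abx] := boolP (x \in box a b); last first.
  rewrite (_ : (fun _ => _) = fun=> 0); first exact: cvg_cst.
  by apply/funext => k; rewrite bump_out// => h; apply: abx; rewrite inE.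
rewrite inE in abx; under eq_fun do rewrite bumpE.
suff : \prod_(j < n) (flat 1 (k.+1%:R * (x 0 j - a 0 j)) *
    flat 1 (k.+1%:R * (b 0 j - x 0 j))) @[k --> \oo] --> \prod_(j < n) (1 * 1 : R).
  by rewrite mulr1 big1_eq.
elim: (index_enum _) => [|j r IH].
  by rewrite big_nil; under eq_fun do rewrite big_nil; exact: cvg_cst.
rewrite big_cons; under eq_fun do rewrite big_cons.
apply: cvgM IH; have /andP[ax xb] := abx j.
apply: cvgM.
  apply: cvg_flat1.
  by rewrite subr_gt0.
apply: cvg_flat1.
by rewrite subr_gt0.
Qed.

Lemma test_bump (Omega : set 'rV[R]_n) a b k : cbox a b `<=` Omega ->
  test_function Omega (box_bump a b k).
Proof.
move=> abO; split; first exact: smooth_bump.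
exists (cbox a b); split => //; first exact: compact_cbox.
by move=> x abx; apply: bump_out => /box_cbox.
Qed.

End bumps.

Section du_bois_reymond.
Context {R : realType} {n : nat}.
Local Notation leb := (@lebesgue_rV R n).
Variables (Omega : set 'rV[R]_n) (w : 'rV[R]_n -> R).
Hypothesis oO : open Omega.
Hypothesis lw : loc_integrable Omega w.
Hypothesis w0 : forall phi, test_function Omega phi ->
  \int[leb]_(x in Omega) (w x * phi x) = 0.

Lemma integral_box0 a b : cbox a b `<=` Omega ->
  (\int[leb]_(x in box a b) (w x)%:E = 0)%E.
Proof.
move=> abO; have iw := lw (@compact_cbox _ _ a b) abO.
have mO := open_measurable_mx oO.
have mC := measurable_cbox a b; have mB := measurable_box a b.
have mw := measurable_int _ iw.
pose f_ k x := (w x * box_bump a b k x)%:E; pose f x := (w x * \1_(box a b) x)%:E.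
have [|||||_ _] := @dominated_convergence _ _ _ leb _ mC f_ f (fun x => `|(w x)%:E|%E).
- move=> k; apply/measurable_EFinP; apply: measurable_funM; first exact/measurable_EFinP.
  by apply: measurable_funTS; exact: test_measurable (test_bump k abO).
- apply/measurable_EFinP; apply: measurable_funM; first exact/measurable_EFinP.
  exact: measurable_funTS.
- apply: aeW => x _; apply: cvg_EFin; first exact: nearW.
  by apply: cvgM; [exact: cvg_cst|exact: cvg_bump].
- exact: integrable_abse.
- apply: aeW => x k _; rewrite /f_ lee_fin normrM ler_piMr//.
  by rewrite ger0_norm ?bump_ge0// bump_le1.
have -> : [sequence (\int[leb]_(x in cbox a b) f_ k x)%E]_k = fun=> 0%E.
  apply/funext => k /=.
  have tb := test_bump k abO.
  have ib := loc_integrable_mul_test mO lw tb.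
  have := w0 tb; rewrite /Rintegral => h.
  have {}h : (\int[leb]_(x in Omega) f_ k x = 0)%E.
    by rewrite -[LHS]fineK ?h//; exact: integrable_fin_num.
  rewrite -h [in LHS]integral_mkcond [in RHS]integral_mkcond; apply: eq_integral => x _.
  rewrite !patchE; have [xC|xC] := pselect (cbox a b x).
    by rewrite !mem_set//; exact: abO.
  rewrite memNset//; case: ifP => // _.
  by rewrite /f_ bump_out ?mulr0// => /box_cbox.
move=> /cvg_lim => /(_ (@ereal_hausdorff _)) h.
have {h} : (\int[leb]_(x in cbox a b) f x = 0)%E.
  by rewrite -h; apply/cvg_lim; [exact: ereal_hausdorff|exact: cvg_cst].
move=> <-; rewrite [in LHS]integral_mkcond [in RHS]integral_mkcond.
apply: eq_integral => x _; rewrite !patchE /f indicE.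
have [xB|xB] := pselect (box a b x).
  by rewrite !mem_set//; [rewrite mulr1|exact: box_cbox].
by rewrite [x \in box _ _]memNset//= mulr0 if_same.
Qed.

(** The Borel sets on whose trace on the box [w] has zero integral form a Dynkin
    system that contains the boxes. *)
Lemma ae_eq0_box a b : cbox a b `<=` Omega ->
  leb.-negligible (box a b `&` [set x | w x != 0]).
Proof.
move=> abO; have mB := measurable_box a b.
have iw : leb.-integrable (box a b) (EFin \o w).
  apply: (integrableS (measurable_cbox a b) mB (@box_cbox _ _ a b)).
  exact: lw (@compact_cbox _ _ a b) abO.
have iwE E : measurable E -> leb.-integrable (E `&` box a b) (EFin \o w).
  by move=> mE; exact: (integrableS mB (measurableI _ _ mE mB) (@subIsetr _ _ _) iw).
have P E : measurable E -> (\int[leb]_(x in E `&` box a b) (w x)%:E = 0)%E.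
  rewrite boxes_generate; move: E.
  apply: (@dynkin_induction _ 'rV[R]_n boxes
      (fun E => (\int[leb]_(x in E `&` box a b) (w x)%:E = 0)%E)).
  - exact: boxes_generate.
  - by move=> _ _ [a1 [b1 ->]] [a2 [b2 ->]]; rewrite boxI; eexists; eexists.
  - by rewrite setTI; exact: integral_box0.
  - move=> _ [a' [b' ->]]; rewrite boxI; apply: integral_box0 => x h.
    apply: abO => i; have := h i; rewrite !mxE ge_max le_min.
    by move=> /andP[/andP[_ ->] /andP[_ ->]].
  - move=> S mS S0; have := integral_box0 abO.
    rewrite -[X in integral _ X _](setIT (box a b)) -(setUv S) setIUr !(setIC (box a b)).
    rewrite integral_setU_EFin//.
    + by rewrite S0 add0e.
    + exact: measurableI.
    + by apply: measurableI => //; exact: measurableC.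
    + rewrite -setIUl setUv setTI; apply/measurable_EFinP; exact: measurable_int iw.
    + by apply/disj_setPS => x [[? _] [? _]].
  - move=> F mF tF F0; rewrite setI_bigcupl integral_bigcup.
    + by apply: eseries0 => k _ _; exact: F0.
    + by apply: trivIset_setIr.
    + by move=> k; exact: measurableI.
    + by rewrite -setI_bigcupl; apply: iwE; exact: bigcupT_measurable.
have h : ae_eq leb (box a b) (EFin \o w) (cst 0%E).
  apply: integral_ae_eq => //.
  move=> E EB mE; rewrite integral_cst// mul0e -[in LHS](setIidl EB); exact: P.
case: h => N [mN N0 HN]; exists N; split => // x [xB /= wx]; apply: HN => /= h.
by move: wx; have [->] := h xB; rewrite eqxx.
Qed.

(** Bumps approximate the indicator of every box in [Omega] and boxes generate
    the Borel sets, so [w] vanishes almost everywhere on each box. Countably many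
    boxes cover [Omega]. *)
Theorem du_bois_reymond : {ae leb, forall x, Omega x -> w x = 0}.
Proof.
have [B [OE BE]] := open_bigcup_box oO.
apply: (@negligibleS _ _ _ _ (\bigcup_q (B q `&` [set x | w x != 0]))).
  move=> x /= /not_implyP[]; rewrite {1}OE => -[q _ Bqx] wx.
  by exists q => //; split => //; apply/eqP.
have H q : leb.-negligible (B q `&` [set x | w x != 0]).
  have [->|[a [b [-> _ abO]]]] := BE q; first by rewrite set0I; exact: negligible_set0.
  exact: ae_eq0_box.
exact: negligible_bigcup_countable.
Qed.

End du_bois_reymond.

(** * Integrals of real functions *)

Section real_integrals.
Context {R : realType} {n : nat}.
Local Notation leb := (@lebesgue_rV R n).
Implicit Types (D : set 'rV[R]_n) (f g : 'rV[R]_n -> R).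

Local Notation intg D f := (leb.-integrable D (EFin \o f)).

Lemma intgD D f g : measurable D -> intg D f -> intg D g -> intg D (fun x => f x + g x).
Proof. by move=> mD fi gi; have := integrableD mD fi gi; apply: eq_integrable. Qed.

Lemma intgB D f g : measurable D -> intg D f -> intg D g -> intg D (fun x => f x - g x).
Proof. by move=> mD fi gi; have := integrableB mD fi gi; apply: eq_integrable. Qed.

Lemma intgZ D (k : R) f : measurable D -> intg D f -> intg D (fun x => k * f x).
Proof. by move=> mD fi; have := integrableZl mD k fi; apply: eq_integrable. Qed.

Lemma intg_norm D f : measurable D -> intg D f -> intg D (fun x => `|f x|).
Proof. by move=> mD fi; have := integrable_abse fi; apply: eq_integrable. Qed.

Lemma intg_measurable D f : intg D f -> measurable_fun D f.
Proof. by move=> fi; apply/measurable_EFinP; exact: measurable_int fi. Qed.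

Lemma intg_sum D I (r : seq I) (c : I -> R) (F : I -> 'rV[R]_n -> R) : measurable D ->
  (forall i, intg D (F i)) ->
  intg D (fun x => \sum_(i <- r) c i * F i x) /\
  \int[leb]_(x in D) (\sum_(i <- r) c i * F i x) =
  \sum_(i <- r) c i * \int[leb]_(x in D) F i x.
Proof.
move=> mD iF; elim: r => [|i r [ir rE]].
  have e : (fun x => \sum_(i <- [::]) c i * F i x) = fun=> 0.
    by apply/funext => x; rewrite big_nil.
  by rewrite e big_nil Rintegral_cst// mul0r; split => //; exact: integrable0.
have e : (fun x => \sum_(i <- i :: r) c i * F i x) =
    fun x => c i * F i x + \sum_(i <- r) c i * F i x.
  by apply/funext => x; rewrite big_cons.
have ici : intg D (fun x => c i * F i x) by exact: intgZ.
rewrite e big_cons; split; first exact: intgD.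
by rewrite RintegralD// RintegralZl// rE.
Qed.

Lemma ae_eq_intg D f g : measurable D -> intg D f -> measurable_fun D g ->
  ae_eq leb D f g -> intg D g.
Proof.
move=> mD fi mg fg; apply/integrableP; split; first exact/measurable_EFinP.
have mf := intg_measurable fi.
case/integrableP : fi => _; rewrite (@ge0_ae_eq_integral _ _ _ _ _ _
  (fun x => `|(g x)%:E|%E))//.
- by apply/measurable_EFinP; apply: measurableT_comp.
- by apply/measurable_EFinP; apply: measurableT_comp.
- by apply: filterS fg => x h Dx /=; rewrite h.
Qed.

Lemma ae_eq_Rint D f g : measurable D -> measurable_fun D f -> measurable_fun D g ->
  ae_eq leb D f g -> \int[leb]_(x in D) f x = \int[leb]_(x in D) g x.
Proof.
move=> mD mf mg fg; congr fine; apply: ae_eq_integral => //.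
- exact/measurable_EFinP.
- exact/measurable_EFinP.
- by apply: filterS fg => x h Dx /=; rewrite h.
Qed.

Lemma ae_le_Rint D f g : measurable D -> intg D f -> intg D g ->
  {ae leb, forall x, D x -> f x <= g x} ->
  \int[leb]_(x in D) f x <= \int[leb]_(x in D) g x.
Proof.
move=> mD fi gi fg; pose h x := Num.max (f x) (g x).
have mf := intg_measurable fi; have mg := intg_measurable gi.
have mh : measurable_fun D h by exact: measurable_maxr.
have hg : ae_eq leb D g h.
  by apply: filterS fg => x + Dx => /(_ Dx) fgx; rewrite /h max_r.
rewrite (ae_eq_Rint mD mg mh hg); apply: le_Rintegral => //.
  exact: ae_eq_intg hg.
by move=> x _; rewrite /h le_max lexx.
Qed.

(** The bound on [g] holds only almost everywhere, so [g] is first replaced by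
    its truncation. *)
Lemma intg_mul D f g (M : R) : measurable D -> intg D f -> measurable_fun D g ->
  {ae leb, forall x, D x -> `|g x| <= M} ->
  intg D (fun x => g x * f x) /\
  `|\int[leb]_(x in D) (g x * f x)| <= M * \int[leb]_(x in D) `|f x|.
Proof.
move=> mD fi mg gM; pose N := `|M|.
have mf := intg_measurable fi.
pose g' x := Num.max (- N) (Num.min (g x) N).
have N0 : 0 <= N by exact: normr_ge0.
have mg' : measurable_fun D g'.
  by apply: measurable_maxr => //; apply: measurable_minr.
have g'N x : `|g' x| <= N.
  rewrite /g' ler_norml le_max lexx/= ge_max ge_min lexx orbT andbT.
  by rewrite (le_trans _ N0)// oppr_le0.
have gg' : ae_eq leb D g' g.
  apply: filterS gM => x + Dx => /(_ Dx) gx.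
  have : `|g x| <= N by apply: le_trans gx _; exact: ler_norm.
  by rewrite ler_norml => /andP[a b]; rewrite /g' min_l// max_r.
have ig'f : intg D (fun x => g' x * f x).
  apply: (@le_integrable _ _ _ leb D mD _ (fun x => N%:E * (f x)%:E)%E).
  - by apply/measurable_EFinP; exact: measurable_funM.
  - by move=> x _; rewrite /= lee_fin !normrM (ger0_norm N0) ler_wpM2r.
  - exact: integrableZl.
have mgf : measurable_fun D (fun x => g x * f x) by exact: measurable_funM.
have gfe : ae_eq leb D (fun x => g' x * f x) (fun x => g x * f x).
  by apply: filterS gg' => x h Dx /=; rewrite h.
have igf := ae_eq_intg mD ig'f mgf gfe.
split => //; apply: le_trans (le_normr_Rintegral mD igf) _.
rewrite -RintegralZl//; last exact: intg_norm.
apply: ae_le_Rint => //.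
- exact: intg_norm.
- by apply: intgZ => //; exact: intg_norm.
- apply: filterS gM => x + Dx => /(_ Dx) gx.
  by rewrite normrM ler_wpM2r.
Qed.

Lemma Rint_norm_eq0 D f : measurable D -> intg D f ->
  \int[leb]_(x in D) `|f x| = 0 -> {ae leb, forall x, D x -> f x = 0}.
Proof.
move=> mD fi f0; have mf := intg_measurable fi.
have : (\int[leb]_(x in D) `|(f x)%:E| = 0)%E.
  rewrite -[LHS]fineK; first by congr EFin; exact: f0.
  by apply: integrable_fin_num => //; exact: integrable_abse fi.
move=> /(ae_eq_integral_abs leb mD) => /(_ _)/wrap[]; first exact/measurable_EFinP.
by apply: filterS => x + Dx => /(_ Dx)/= [].
Qed.

Lemma Rint_sqr_eq0 D f : measurable D -> intg D (fun x => f x * f x) ->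
  \int[leb]_(x in D) (f x * f x) = 0 -> {ae leb, forall x, D x -> f x = 0}.
Proof.
move=> mD fi f0; have : {ae leb, forall x, D x -> f x * f x = 0}.
  apply: (Rint_norm_eq0 mD fi); rewrite -[RHS]f0; apply: eq_Rintegral => x _.
  by rewrite ger0_norm// -expr2 sqr_ge0.
by apply: filterS => x + Dx => /(_ Dx)/eqP; rewrite mulf_eq0 orbb => /eqP.
Qed.

End real_integrals.

(** * Weak gradients *)

Section weak_gradients.
Context {R : realType} {n : nat}.
Local Notation leb := (@lebesgue_rV R n).
Variable Omega : set 'rV[R]_n.
Hypothesis oO : open Omega.
Implicit Types (u v phi psi : 'rV[R]_n -> R) (G H : 'rV[R]_n -> 'rV[R]_n).

Let mO : measurable Omega := open_measurable_mx oO.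

Local Notation intg D f := (leb.-integrable D (EFin \o f)).

Lemma compact_measurable_rV (K : set 'rV[R]_n) : compact K -> measurable K.
Proof.
by move=> cK; apply: closed_measurable_rV; apply: compact_closed => //; exact: norm_hausdorff.
Qed.

Lemma loc_integrableD u v : loc_integrable Omega u -> loc_integrable Omega v ->
  loc_integrable Omega (fun x => u x + v x).
Proof.
move=> lu lv K cK KO; apply: intgD; first exact: compact_measurable_rV.
  exact: lu.
exact: lv.
Qed.

Lemma continuous_loc_integrable u : continuous u -> loc_integrable Omega u.
Proof.
move=> cu K cK KO.
have : compact (u @` K) by apply: continuous_compact => //; exact: continuous_subspaceT.
move=> /compact_bounded[M [_ KM]].
apply: (@bounded_integrable _ _ _ _ (`|M| + 1)).
- exact: compact_measurable_rV.
- exact: compact_bounded.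
- by apply: measurable_funTS; exact: cont_measurable.
- move=> x Kx; apply: (KM (`|M| + 1)); last by exists x.
  by rewrite (le_lt_trans (ler_norm M))// ltrDl.
Qed.

Lemma loc_integrable_measurable u : loc_integrable Omega u -> measurable_fun Omega u.
Proof.
move=> lu _ Y mY; have [B [OE BE]] := open_bigcup_box oO.
rewrite {1}OE setI_bigcupl; apply: countable_bigcupT_measurable => [|q].
  exact: countableP.
have [->|[a [b [-> _ abO]]]] := BE q; first by rewrite set0I; exact: measurable0.
have iu := lu _ (@compact_cbox _ _ a b) abO.
have mu : measurable_fun (box a b) u.
  apply: measurable_funS (intg_measurable iu) => //; first exact: measurable_cbox.
  exact: box_cbox.
by apply: mu => //; exact: measurable_box.
Qed.

Lemma weak_gradientD u v G H : is_weak_gradient Omega u G ->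
  is_weak_gradient Omega v H ->
  is_weak_gradient Omega (fun x => u x + v x) (fun x => G x + H x).
Proof.
move=> [lu lG uG] [lv lH vH]; split; first exact: loc_integrableD.
  move=> i; rewrite (_ : (fun _ => _) = fun x => G x 0 i + H x 0 i).
    exact: loc_integrableD.
  by apply/funext => x; rewrite mxE.
move=> phi i tphi; have tphi' := test_partial i tphi.
under eq_Rintegral do rewrite mulrDl.
rewrite RintegralD//; [|exact: loc_integrable_mul_test..].
rewrite uG// vH// -opprD; congr (- _).
under [RHS]eq_Rintegral do rewrite mxE mulrDl.
by rewrite RintegralD//; exact: loc_integrable_mul_test.
Qed.

Lemma weak_gradientN u G : is_weak_gradient Omega u G ->
  is_weak_gradient Omega (fun x => - u x) (fun x => - G x).
Proof.
have E v : (fun x => - v x) = (fun x => -1 * v x) :> ('rV[R]_n -> R).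
  by apply/funext => x; rewrite mulN1r.
move=> [lu lG uG]; split.
- move=> K cK KO; rewrite E; apply: intgZ; first exact: compact_measurable_rV.
  exact: lu.
- move=> i K cK KO; rewrite (_ : (fun _ => _) = fun x => - 1 * G x 0 i); last first.
    by apply/funext => x; rewrite mxE mulN1r.
  apply: intgZ; first exact: compact_measurable_rV.
  exact: lG.
move=> phi i tphi; have tphi' := test_partial i tphi.
under eq_Rintegral do rewrite mulNr -mulN1r.
under [in RHS]eq_Rintegral do rewrite mxE mulNr -mulN1r.
rewrite !RintegralZl//; [|exact: loc_integrable_mul_test..].
by rewrite uG// !mulN1r.
Qed.

Lemma weak_gradientB u v G H : is_weak_gradient Omega u G ->
  is_weak_gradient Omega v H ->
  is_weak_gradient Omega (fun x => u x - v x) (fun x => G x - H x).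
Proof. by move=> uG /weak_gradientN vH; exact: weak_gradientD. Qed.

Lemma smooth_weak_gradient psi : smooth psi ->
  is_weak_gradient Omega psi (fun x => \row_i partial i psi x).
Proof.
move=> spsi; have [cpsi _ spsi'] := smoothP spsi; split.
- exact: continuous_loc_integrable.
- move=> i; rewrite (_ : (fun _ => _) = partial i psi).
    by apply: continuous_loc_integrable; have [h _ _] := smoothP (spsi' i); exact: h.
  by apply/funext => x; rewrite mxE.
- move=> phi i tphi; rewrite (ibp i tphi spsi); congr (- _).
  by apply: eq_Rintegral => x _; rewrite mxE.
Qed.

Lemma affine_weak_gradient (xi : 'rV[R]_n) c :
  is_weak_gradient Omega (affine_rV xi c) (fun=> xi).
Proof.
rewrite (_ : (fun=> xi) = fun x => \row_i partial i (affine_rV xi c) x).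
  by apply: smooth_weak_gradient; exact: smooth_affine.
apply/funext => x; apply/rowP => i; rewrite mxE.
by rewrite (partialE (fun x => is_derive_affine xi c x i)).
Qed.

(** The difference of two weak gradients integrates to zero against every test
    function. *)
Lemma weak_gradient_unique u G H : is_weak_gradient Omega u G ->
  is_weak_gradient Omega u H -> {ae leb, forall x, Omega x -> G x = H x}.
Proof.
move=> uG uH; have [_ lD D0] := weak_gradientB uG uH.
have [lu lG uG'] := uG; have [_ lH uH'] := uH.
have H0 i : {ae leb, forall x, Omega x -> (G x - H x) 0 i = 0}.
  apply: (du_bois_reymond oO (lD i)) => phi tphi.
  have tphi' := test_partial i tphi.
  have := D0 _ i tphi.
  rewrite (_ : \int[leb]_(x in _) _ = 0); last first.
    under eq_Rintegral do rewrite subrr mul0r.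
    by rewrite Rintegral_cst// mul0r.
  by move=> /esym/eqP; rewrite oppr_eq0 => /eqP.
have := @filter_forall _ _ _ _ (ae_filter_ringOfSetsType leb) H0.
apply: filterS => x h Ox; apply/rowP => i; have := h i Ox.
by rewrite !mxE => /eqP; rewrite subr_eq0 => /eqP.
Qed.

Lemma weak_gradientP u : (exists G, is_weak_gradient Omega u G) ->
  is_weak_gradient Omega u (weak_gradient Omega u).
Proof.
move=> [G uG].
by apply: (@xgetPex _ (fun=> 0) [set G | is_weak_gradient Omega u G]); exists G.
Qed.

Lemma weak_gradient_ae u G : is_weak_gradient Omega u G ->
  {ae leb, forall x, Omega x -> weak_gradient Omega u x = G x}.
Proof.
move=> uG; have h := weak_gradientP (ex_intro _ _ uG).
exact: weak_gradient_unique h uG.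
Qed.

End weak_gradients.

Section W110_functions.
Context {R : realType} {n : nat}.
Local Notation leb := (@lebesgue_rV R n).
Variable Omega : set 'rV[R]_n.
Hypothesis oO : open Omega.
Hypothesis Omega0 : Omega !=set0.
Hypothesis bO : bounded_set Omega.
Implicit Types (u v phi psi : 'rV[R]_n -> R) (G H : 'rV[R]_n -> 'rV[R]_n).

Let mO : measurable Omega := open_measurable_mx oO.
Let muO : (leb Omega < +oo)%E := leb_bounded_lty mO bO.

Local Notation intg D f := (leb.-integrable D (EFin \o f)).

Lemma Lp_norm1E u : Lp_norm Omega 1 u = (\int[leb]_(x in Omega) `|(u x)%:E|)%E.
Proof.
rewrite /Lp_norm Lnorm1 [RHS]integral_mkcond; apply: eq_integral => x _.
by rewrite !patchE; case: ifP => //; rewrite abse0.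
Qed.

Lemma Lp1_intg u : in_Lp Omega 1 u -> intg Omega u.
Proof.
move=> [mu u1]; apply/integrableP; split; first exact/measurable_EFinP.
by rewrite -Lp_norm1E.
Qed.

Lemma leb_setT_gt0 : (0 < leb setT)%E.
Proof.
apply: (lt_le_trans (leb_open_gt0 oO Omega0)).
by apply: le_measure; rewrite ?inE.
Qed.

Lemma Lpoo_bounded u : in_Lp Omega +oo%E u -> exists2 M : R, 0 <= M &
  {ae leb, forall x, Omega x -> `|u x| <= M}.
Proof.
move=> [mu]; rewrite /Lp_norm unlock leb_setT_gt0; set s := ess_sup _ _ => soo.
have hs := ess_sup_ge leb (abse \o patch (fun=> 0%E) Omega (EFin \o u)).
exists (`|fine s|) => //; apply: filterS hs => x + Ox.
rewrite -/s /= patchE mem_set//= => hx.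
have : s \is a fin_num.
  rewrite fin_numE -ltey soo andbT; apply/eqP => sE.
  by move: hx; rewrite sE.
move=> /fineK sE; rewrite -lee_fin; apply: le_trans hx _.
by rewrite -sE lee_fin ler_norm.
Qed.

(** The distance of [v] to a test function in the Sobolev norm is a sum of
    nonnegative terms, and almost everywhere the weak gradient of [v - phi] is
    the difference of the gradients. *)
Lemma W110_approx v : in_W110 Omega v -> forall e : R, 0 < e ->
  exists phi, [/\ test_function Omega phi,
    \int[leb]_(x in Omega) `|v x - phi x| <= e &
    forall i, \int[leb]_(x in Omega)
      `|partial i phi x - weak_gradient Omega v x 0 i| <= e].
Proof.
move=> [[Lv exG LG] cl] e e0; have [phi tphi He] := cl e e0.
exists phi.
have vG := weak_gradientP exG.
have sphi := test_smooth tphi.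
have D := weak_gradientB oO vG (smooth_weak_gradient Omega sphi).
have Dae := weak_gradient_ae oO D.
have lep (p q : \bar R) : (0 <= p -> 0 <= q -> p + q < e%:E -> p < e%:E /\ q < e%:E)%E.
  by move=> p0 q0 pq; split; apply: le_lt_trans pq; rewrite ?leeDl ?leeDr.
have [||h1 h2] := lep _ _ _ _ He.
  by rewrite Lnorm_ge0.
  by apply: sume_ge0 => i _; rewrite Lnorm_ge0.
split => //.
- rewrite -lee_fin; apply: le_trans (ltW h1).
  rewrite Lp_norm1E /Rintegral fineK//; last first.
    rewrite ge0_fin_numE ?integral_ge0//; apply: lt_trans (ltry e).
    by apply: le_lt_trans h1; rewrite Lp_norm1E.
- move=> i.
  have h2i : (Lp_norm Omega 1 (fun x => weak_gradient Omega (v \- phi)%R x 0%R i) < e%:E)%E.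
    apply: le_lt_trans h2; rewrite (bigD1 i)//= leeDl//.
    by apply: sume_ge0 => j _; rewrite Lnorm_ge0.
  rewrite Lp_norm1E in h2i.
  have mD : measurable_fun Omega (fun x => weak_gradient Omega (v \- phi)%R x 0 i).
    have [_ lD _] := weak_gradientP (ex_intro _ _ D).
    exact: loc_integrable_measurable (lD i).
  have mG : measurable_fun Omega (fun x => partial i phi x - weak_gradient Omega v x 0 i).
    apply: measurable_funB; last by have [] := LG i.
    by apply: measurable_funTS; exact: test_measurable (test_partial i tphi).
  have E : (\int[leb]_(x in Omega) `|(weak_gradient Omega (v \- phi)%R x 0%R i)%:E| =
     \int[leb]_(x in Omega) `|(partial i phi x - weak_gradient Omega v x 0%R i)%:E|)%E.
    apply: ge0_ae_eq_integral => //.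
    + by apply/measurable_EFinP; exact: measurableT_comp.
    + by apply/measurable_EFinP; exact: measurableT_comp.
    + apply: filterS Dae => x h Ox; rewrite /= h// !mxE.
      by congr (_%:E); rewrite distrC.
  rewrite E in h2i.
  rewrite -lee_fin /Rintegral fineK//; first exact: ltW.
  by rewrite ge0_fin_numE ?integral_ge0//; apply: lt_trans (ltry e).
Qed.

End W110_functions.

(** * Sobolev functions with vanishing boundary values *)

Section vanishing_trace.
Context {R : realType} {n : nat}.
Local Notation leb := (@lebesgue_rV R n).
Variable Omega : set 'rV[R]_n.
Hypothesis oO : open Omega.
Hypothesis Omega0 : Omega !=set0.
Hypothesis bO : bounded_set Omega.

Let mO : measurable Omega := open_measurable_mx oO.

Local Notation intg D f := (leb.-integrable D (EFin \o f)).

Variable v : 'rV[R]_n -> R.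
Hypothesis v0 : in_W1oo0 Omega v.
Let G := weak_gradient Omega v.

Let vG : is_weak_gradient Omega v G.
Proof. by case: v0 => [] [[_ exG _] _] _; exact: weak_gradientP. Qed.

Let iG i : intg Omega (fun x => G x 0 i).
Proof. by case: v0 => [] [[_ _ LG] _] _; exact: Lp1_intg. Qed.

Let iv : intg Omega v.
Proof. by case: v0 => [] [[Lv _ _] _] _; exact: Lp1_intg. Qed.

Let mv : measurable_fun Omega v.
Proof. exact: intg_measurable iv. Qed.

Let itest phi : test_function Omega phi -> intg Omega phi.
Proof.
by move=> tphi; apply: (integrableS measurableT mO _ (test_integrable tphi)).
Qed.

(** The mean of a partial derivative is zero for test functions and continuous
    for the Sobolev norm. *)
Lemma mean_weak_gradient i : \int[leb]_(x in Omega) G x 0 i = 0.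
Proof.
apply/eqP; rewrite -normr_eq0 eq_le normr_ge0 andbT; apply/ler_addgt0Pr => e e0.
rewrite add0r; have [v1 _] := v0.
have [phi [tphi _ /(_ i) He]] := W110_approx oO v1 e0.
have tphi' := test_partial i tphi.
apply: le_trans He; rewrite -normrN.
have E : \int[leb]_(x in Omega) (partial i phi x - G x 0 i) = - \int[leb]_(x in Omega) G x 0 i.
  rewrite RintegralB//; last exact: itest.
  rewrite (@Rintegral_supp _ _ _ (partial i phi)) ?(Rintegral_partial i tphi) ?sub0r//.
  by move=> x; exact: test_out tphi'.
rewrite -E; apply: le_normr_Rintegral => //.
by apply: intgB => //; exact: itest.
Qed.

Lemma mean_weak_gradient_dot al : intg Omega (fun x => dotrV (G x) al) /\
  \int[leb]_(x in Omega) dotrV (G x) al = 0.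
Proof.
have [h1 h2] := @intg_sum _ _ _ _ (index_enum 'I_n) (fun i => al 0 i) _ mO iG.
have e : (fun x => dotrV (G x) al) = (fun x => \sum_i al 0 i * G x 0 i).
  by apply/funext => x; rewrite dotrVC.
rewrite e; split => //; rewrite h2 big1// => i _.
by rewrite mean_weak_gradient mulr0.
Qed.

(** A function that is constant along the lines of direction [al] and vanishes
    at the boundary is zero. To avoid slicing along these lines, test the weak
    gradient against [<al, x> phi] where [phi] is close to [v]: this gives
    [|al|^2 \int v phi = - \int v <al, x> <grad phi, al>], and the right-hand
    side is small because [<grad v, al> = 0]. *)
Lemma weak_gradient_dir0 al : al != 0 ->
  {ae leb, forall x, Omega x -> dotrV (G x) al = 0} ->
  {ae leb, forall x, Omega x -> v x = 0}.
Proof.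
move=> al0 G0; have [v1 [_ _ _]] := v0; have [M M0 vM] : exists2 M : R, 0 <= M &
    {ae leb, forall x, Omega x -> `|v x| <= M}.
  by case: v0 => [_ [Lv _ _]]; exact: (Lpoo_bounded oO Omega0 Lv).
have [r [r0 Or]] : exists r : R, 0 <= r /\ forall x, Omega x -> `|x| <= r.
  case: bO => r [_ hr]; exists (`|r| + 1); split; first exact: addr_ge0.
  by move=> x Ox; apply: (hr (`|r| + 1)) => //; rewrite (le_lt_trans (ler_norm r))// ltrDl.
pose S := dotrV al al; have S0 : 0 < S by exact: dotrV_gt0.
pose A := \sum_i `|al 0 i|; have A0 : 0 <= A by apply: sumr_ge0.
pose B := A * r; have B0 : 0 <= B by exact: mulr_ge0.
have xB x : Omega x -> `|dotrV al x| <= B.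
  by move=> Ox; apply: le_trans (norm_dotrV_le _ _) _; rewrite ler_wpM2l// Or.
have [ivv _] := intg_mul mO iv mv vM.
apply: (Rint_sqr_eq0 mO ivv).
have vv0 : 0 <= \int[leb]_(x in Omega) (v x * v x).
  by apply: Rintegral_ge0 => x _; rewrite -expr2 sqr_ge0.
apply/eqP; rewrite eq_le vv0 andbT; apply/ler_addgt0Pr => e e0; rewrite add0r.
pose C := (S * M + M * B * A + 1) / S.
have C0 : 0 < C by rewrite divr_gt0// ltr_wpDl// addr_ge0// !mulr_ge0// ltW.
have eC0 : 0 < e / C by exact: divr_gt0.
have [phi [tphi vphi Gphi]] := W110_approx oO v1 eC0.
have sal := smooth_dotrV al.
have sphi := test_smooth tphi.
pose psi x := phi x * dotrV al x.
have tpsi : test_function Omega psi by exact: test_mul.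
have dal i : partial i (dotrV al) = fun=> al 0 i.
  apply: partialE => x; rewrite (_ : dotrV al = affine_rV al 0); first exact: is_derive_affine.
  by apply/funext => y; rewrite /affine_rV addr0.
have dpsi i x : partial i psi x = phi x * al 0 i + dotrV al x * partial i phi x.
  by rewrite /psi partial_mul// dal.
have [_ _ vG'] := vG.
have ip i : intg Omega (fun x => partial i phi x - G x 0 i).
  by apply: intgB => //; apply: itest; exact: test_partial.
pose q x := \sum_i al 0 i * (partial i phi x - G x 0 i).
have [iq _] := @intg_sum _ _ _ _ (index_enum 'I_n) (fun i => al 0 i) _ mO ip.
have qE : \int[leb]_(x in Omega) `|q x| <= A * (e / C).
  have ip' i : intg Omega (fun x => `|partial i phi x - G x 0 i|) by exact: intg_norm.
  have [iS SE] := @intg_sum _ _ _ _ (index_enum 'I_n) (fun i => `|al 0 i|) _ mO ip'.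
  apply: (@le_trans _ _ (\int[leb]_(x in Omega)
     \sum_i `|al 0 i| * `|partial i phi x - G x 0 i|)).
    apply: le_Rintegral => //; first exact: intg_norm.
    move=> x _; apply: le_trans (ler_norm_sum _ _ _) _.
    by apply: ler_sum => i _; rewrite normrM.
  by rewrite SE /A mulr_suml ler_sum// => i _; rewrite ler_wpM2l.
have mal : measurable_fun Omega (dotrV al).
  by apply: measurable_funTS; apply: cont_measurable; exact: dotrV_continuous.
have iphi := itest tphi.
have ivphi : intg Omega (fun x => v x * phi x) by have [] := intg_mul mO iphi mv vM.
(* [q] is the derivative of [phi] along [al], up to a term that vanishes a.e. *)
have key : S * \int[leb]_(x in Omega) (v x * phi x) =
    - \int[leb]_(x in Omega) (v x * (dotrV al x * q x)).
  have ivd i : intg Omega (fun x => v x * partial i psi x).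
    by have [] := intg_mul mO (itest (test_partial i tpsi)) mv vM.
  have iGpsi i : intg Omega (fun x => G x 0 i * psi x).
    by have [_ lG _] := vG; exact: loc_integrable_mul_test.
  have [_ h1] := @intg_sum _ _ _ _ (index_enum 'I_n) (fun i => al 0 i) _ mO ivd.
  have [iGs h2] := @intg_sum _ _ _ _ (index_enum 'I_n) (fun i => al 0 i) _ mO iGpsi.
  have h3 : \int[leb]_(x in Omega) \sum_i al 0 i * (v x * partial i psi x) = 0.
    rewrite h1 (eq_bigr (fun i => - (al 0 i * \int[leb]_(x in Omega) (G x 0 i * psi x)))).
      rewrite sumrN -h2 -[RHS]oppr0; congr (- _).
      rewrite (ae_eq_Rint (g := fun=> 0) mO (intg_measurable iGs))//.
        by rewrite Rintegral_cst// mul0r.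
      apply: filterS G0 => x h Ox.
      transitivity (dotrV (G x) al * psi x); last by rewrite h// mul0r.
      by rewrite /dotrV mulr_suml; apply: eq_bigr => i _; ring.
    by move=> i _; rewrite vG'// mulrN.
  have ix : intg Omega (fun x => v x * (dotrV al x * q x)).
    have [h _] := intg_mul mO iq mal (aeW leb xB).
    by have [] := intg_mul mO h mv vM.
  rewrite -RintegralZl//; apply/eqP; rewrite -subr_eq0 opprK; apply/eqP.
  rewrite -RintegralD//; last exact: intgZ.
  rewrite -h3; apply: ae_eq_Rint => //.
  - by apply: intg_measurable; apply: intgD => //; exact: intgZ.
  - by have [h _] := @intg_sum _ _ _ _ (index_enum 'I_n) (fun i => al 0 i) _ mO ivd;
      exact: intg_measurable h.
  - apply: filterS G0 => x h Ox.
    have qx : q x = \sum_i al 0 i * partial i phi x.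
      rewrite /q (eq_bigr (fun i => al 0 i * partial i phi x - G x 0 i * al 0 i)).
        by rewrite sumrB -/(dotrV (G x) al) h// subr0.
      by move=> i _; ring.
    rewrite (eq_bigr (fun i => v x * phi x * (al 0 i * al 0 i) +
        v x * dotrV al x * (al 0 i * partial i phi x))).
      by rewrite big_split/= -!mulr_sumr -qx -/(dotrV al al) -/S; ring.
    by move=> i _; rewrite dpsi; ring.
have ivmphi : intg Omega (fun x => v x - phi x) by exact: intgB.
have [_ b1] := intg_mul mO ivmphi mv vM.
have mvx : measurable_fun Omega (fun x => v x * dotrV al x) by exact: measurable_funM.
have vxMB : {ae leb, forall x, Omega x -> `|v x * dotrV al x| <= M * B}.
  by apply: filterS vM => x h Ox; rewrite normrM ler_pM// ?h// xB.
have [_ b2] := intg_mul mO iq mvx vxMB.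
have split1 : \int[leb]_(x in Omega) (v x * v x) =
    \int[leb]_(x in Omega) (v x * (v x - phi x)) + \int[leb]_(x in Omega) (v x * phi x).
  have [h _] := intg_mul mO ivmphi mv vM.
  by rewrite -RintegralD//; apply: eq_Rintegral => x _; ring.
have b2' : `|\int[leb]_(x in Omega) (v x * (dotrV al x * q x))| <= M * B * (A * (e / C)).
  rewrite (eq_Rintegral _ (g := fun x => v x * dotrV al x * q x)); last first.
    by move=> x _; rewrite mulrA.
  by apply: le_trans b2 _; rewrite ler_wpM2l// mulr_ge0.
have b1' : `|\int[leb]_(x in Omega) (v x * (v x - phi x))| <= M * (e / C).
  by apply: le_trans b1 _; rewrite ler_wpM2l.
rewrite -(ler_pM2l S0) split1 mulrDr key.
have h1 := le_trans (ler_norm _) b1'.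
have h2' : (- \int[leb]_(x in Omega) (v x * (dotrV al x * q x)))%R <= M * B * (A * (e / C)).
  have := ler_norm (- \int[leb]_(x in Omega) (v x * (dotrV al x * q x))).
  by rewrite normrN => /le_trans; apply; exact: b2'.
have CE : S * e = (S * M + M * B * A + 1) * (e / C).
  by rewrite /C invf_div; field; rewrite !gt_eqF//= ?ltr_wpDl// addr_ge0// !mulr_ge0// ltW.
rewrite CE -subr_ge0; have := ltW eC0; move: h1 h2'.
set I1 := Rintegral _ _ _; set I2 := Rintegral _ _ _; set d := e / C => h1 h2' d0.
by have := ler_wpM2l (ltW S0) h1; lra.
Qed.

Lemma weak_gradient_dir0_eq0 al : al != 0 ->
  {ae leb, forall x, Omega x -> dotrV (G x) al = 0} ->
  {ae leb, forall x, Omega x -> G x = 0}.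
Proof.
move=> al0 G0; have v00 := weak_gradient_dir0 al0 G0.
apply: (weak_gradient_unique oO vG); have [lv lG uG] := vG.
split => //.
- by move=> i K cK KO; under eq_fun do rewrite mxE; exact: integrable0.
- move=> phi i tphi; under [in RHS]eq_Rintegral do rewrite mxE mul0r.
  rewrite Rintegral_cst// mul0r oppr0.
  have h := loc_integrable_mul_test mO lv (test_partial i tphi).
  rewrite (ae_eq_Rint (g := fun=> 0) mO (intg_measurable h))//.
    by rewrite Rintegral_cst// mul0r.
  by apply: filterS v00 => x H Ox; rewrite H// mul0r.
Qed.

End vanishing_trace.

(** * Mollification *)

Section lipschitz_functions.
Context {R : realType} {n : nat}.

Lemma lipschitz_cont (F : 'rV[R]_n -> R) (C : R) :
  (forall x y, `|F x - F y| <= C * `|x - y|) -> continuous F.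
Proof.
move=> FC x.
apply: (iffRL (@cvgrPdist_le R R^o _ (nbhs x) (nbhs_filter x) F (F x))) => e e0.
have C0 : 0 < `|C| + 1 by rewrite ltr_wpDl.
apply/nbhs_ballP; exists (e / (`|C| + 1)); first exact: divr_gt0.
move=> y xy; have /ltW h0 : `|x - y| < e / (`|C| + 1).
  by move: xy; rewrite ball_rVE.
have h : `|x - y| * (`|C| + 1) <= e by rewrite -ler_pdivlMr.
apply: le_trans (FC x y) _; apply: le_trans h; rewrite mulrC ler_wpM2l//.
by apply: (le_trans (ler_norm C)); rewrite lerDl.
Qed.

Lemma is_derive_lipschitz (F : 'rV[R]_n -> R) x i (C d : R) :
  (forall h : R, `|F (x + h *: delta_mx 0 i) - F x| <= C * `|h|) ->
  is_derive x (delta_mx 0 i) F d -> `|d| <= C.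
Proof.
move=> FC /is_derive_cvg cv; apply/ler_addgt0Pr => e e0.
have near_d := iffLR (@cvgrPdist_le R R^o _ _ _ _ d) cv e e0.
have [h [hd h0]] := filter_ex (filterI (near_d _) (@nbhs_dnbhs_neq R 0)).
set q := h^-1 *: _ in hd.
have qC : `|q| <= C.
  rewrite /q normrZ normfV mulrC ler_pdivrMr ?normr_gt0// [h *: _ + x]addrC.
  exact: FC.
rewrite -(subrK q d); apply: le_trans (ler_normD _ _) _.
by rewrite addrC lerD.
Qed.

End lipschitz_functions.

Section mollifier.
Context {R : realType} {n : nat}.
Local Notation leb := (@lebesgue_rV R n).
Local Notation e_ i := (delta_mx 0 i : 'rV[R]_n).
Local Notation intg D f := (leb.-integrable D (EFin \o f)).

Lemma mollifier_exists (d : R) : 0 < d -> exists eta : 'rV[R]_n -> R,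
  [/\ test_function setT eta, forall y, 0 <= eta y,
      forall y, d < `|y| -> eta y = 0 & \int[leb]_x eta x = 1].
Proof.
move=> d0; pose a : 'rV[R]_n := const_mx (- d); pose b : 'rV[R]_n := const_mx d.
have tb : test_function setT (box_bump a b 0) by apply: test_bump.
have ib := test_integrable tb.
pose c := \int[leb]_x box_bump a b 0 x.
have c0 : 0 <= c by apply: Rintegral_ge0 => x _; exact: bump_ge0.
have c1 : c != 0.
  apply/eqP => cE; have : ae_eq leb setT (EFin \o box_bump a b 0) (cst 0%E).
    apply/(ae_eq_integral_abs leb measurableT).
      by apply/measurable_EFinP; exact: test_measurable tb.
    under eq_integral do rewrite /= ger0_norm ?bump_ge0//.
    by rewrite -[LHS]fineK ?integrable_fin_num//; congr EFin.
  move=> [N [mN N0 HN]]; have := leb_box_gt0 (a := a) (b := b).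
  have -> : leb (box a b) = 0%E.
    apply/eqP; rewrite -measure_le0 -N0; apply: le_measure; rewrite ?inE//.
      exact: measurable_box.
    move=> x abx; apply: HN => /= /(_ I)[] E.
    by have := bump_gt0 0 abx; rewrite E ltxx.
  by rewrite ltxx => /(_ _)/wrap[] // i; rewrite !mxE; lra.
exists (fun x => box_bump a b 0 x * c^-1); split.
- by apply: test_mul => //; exact: smooth_cst.
- by move=> y; rewrite mulr_ge0 ?bump_ge0// invr_ge0.
- move=> y dy; rewrite bump_out ?mul0r// => aby; move: dy; rewrite ltNge => /negP; apply.
  apply: norm_leP => [|i]; first exact: ltW.
  by have := aby i; rewrite !mxE => /andP[? ?]; rewrite ler_norml !ltW.
- by rewrite RintegralZr// mulfV.
Qed.

Implicit Types (psi : 'rV[R]_n -> R) (x y : 'rV[R]_n).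
Variables (w : 'rV[R]_n -> R) (L W r : R).
Hypothesis wL : forall x y, `|w x - w y| <= L * `|x - y|.
Hypothesis wW : forall x, `|w x| <= W.
Hypothesis wr : forall x, r < `|x| -> w x = 0.

(** A correlation: without the reflection of the usual convolution, a derivative
    changes sign when it passes to [psi]. *)
Definition mollify (psi : 'rV[R]_n -> R) (x : 'rV[R]_n) : R :=
  \int[leb]_y (w y * psi (y - x)).

Let w_cont : continuous w := lipschitz_cont wL.
Let mw : measurable_fun setT w := cont_measurable w_cont.
Let iw : intg setT w := bounded_support_integrable mw wW wr.

Let ae_norm_le (f : 'rV[R]_n -> R) (M : R) (D : set 'rV[R]_n) :
  (forall x, `|f x| <= M) -> {ae leb, forall x, D x -> `|f x| <= M}.
Proof. by move=> fM; apply: aeW => x _. Qed.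

Lemma mollify_intg psi x : test_function setT psi ->
  intg setT (fun y => w y * psi (y - x)).
Proof.
move=> tpsi; have i := integrable_shift (- x) (test_integrable tpsi).
by have [] := intg_mul measurableT i mw (ae_norm_le setT wW).
Qed.

Lemma mollify_intg_shift psi x : test_function setT psi ->
  intg setT (fun y => w (x + y) * psi y).
Proof.
move=> tpsi; have := integrable_shift x (mollify_intg x tpsi).
by apply: eq_integrable => // y _ /=; rewrite addrK addrC.
Qed.

(** In this form the regularity of [w] passes to its average, whereas the
    definition displays the regularity inherited from [psi]. *)
Lemma mollify_shift psi x : test_function setT psi ->
  mollify psi x = \int[leb]_y (w (x + y) * psi y).
Proof.
move=> tpsi; rewrite /mollify -(Rintegral_shift x (mollify_intg x tpsi)).
by apply: eq_Rintegral => y _; rewrite addrK addrC.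
Qed.

Lemma mollify_lipschitz psi x x' : test_function setT psi ->
  `|mollify psi x - mollify psi x'| <=
  (L * \int[leb]_y `|psi y|) * `|x - x'|.
Proof.
move=> tpsi; have ipsi := test_integrable tpsi.
have i1 := mollify_intg_shift x tpsi; have i2 := mollify_intg_shift x' tpsi.
rewrite !mollify_shift// -RintegralB//.
rewrite (eq_Rintegral _ (g := fun y => (w (x + y) - w (x' + y)) * psi y)); last first.
  by move=> y _; rewrite mulrBl.
have mwx (z : 'rV[R]_n) : measurable_fun setT (fun y : 'rV[R]_n => w (z + y)).
  apply: cont_measurable; apply: (lipschitz_cont (C := L)) => y y'.
  by apply: le_trans (wL _ _) _; rewrite opprD addrACA subrr add0r.
have bd y : `|w (x + y) - w (x' + y)| <= L * `|x - x'|.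
  by apply: le_trans (wL _ _) _; rewrite opprD addrACA subrr addr0.
have [_ h] := intg_mul measurableT ipsi (measurable_funB (mwx x) (mwx x'))
  (ae_norm_le setT bd).
by apply: le_trans h _; rewrite mulrAC.
Qed.

Lemma test_opp psi : test_function setT psi -> test_function setT (fun x : 'rV[R]_n => psi x * -1).
Proof. by move=> tpsi; apply: test_mul => //; exact: smooth_cst. Qed.

(** The Taylor bound for [psi] is uniform in the variable of integration, so
    the difference quotients converge under the integral. *)
Lemma mollify_is_derive psi x i : test_function setT psi ->
  is_derive x (e_ i) (mollify psi) (mollify (fun y => partial i psi y * -1) x).
Proof.
move=> tpsi; have td := test_opp (test_partial i tpsi).
have [M M0 HM] := test_taylor i tpsi.
set D := mollify _ x; pose N := \int[leb]_y `|w y|.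
have N0 : 0 <= N by exact: Rintegral_ge0.
have main (h : R) : `|mollify psi (h *: e_ i + x) - mollify psi x - h * D| <= M * h ^+ 2 * N.
  have i1 := mollify_intg (h *: e_ i + x) tpsi; have i2 := mollify_intg x tpsi.
  have i3 := mollify_intg x td.
  pose g (y : 'rV[R]_n) := psi (y - (h *: e_ i + x)) - psi (y - x) + h * partial i psi (y - x).
  have cpsi := test_continuous tpsi; have cdpsi := test_continuous (test_partial i tpsi).
  have csh (z : 'rV[R]_n) (f : 'rV[R]_n -> R) : continuous f -> continuous (fun y => f (y - z)).
    move=> cf y; apply: (@continuous_comp _ _ _ (fun y => y - z) f); last exact: cf.
    exact: (@cvgB R 'rV[R]_n _ (nbhs y) (nbhs_filter y) id (fun=> z) y z cvg_id (cvg_cst _)).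
  have mg : measurable_fun setT g.
    apply: cont_measurable; apply: contD; first by apply: contB; exact: csh.
    by apply: contM; [exact: contC|exact: csh].
  have gM y : `|g y| <= M * h ^+ 2.
    have := HM (y - x) (- h); rewrite sqrrN.
    rewrite (_ : y - x + - h *: e_ i = y - (h *: e_ i + x)) ?mulNr ?opprK//.
    by rewrite scaleNr opprD [RHS]addrA [RHS]addrAC.
  have [igw le1] := intg_mul measurableT iw mg (ae_norm_le setT gM).
  apply: le_trans le1; rewrite le_eqVlt; apply/orP; left; apply/eqP; congr (`| _ |).
  rewrite /D /mollify -RintegralZl// -RintegralB// -RintegralB//.
  - by apply: eq_Rintegral => y _; rewrite /g; ring.
  - exact: intgB.
  - exact: intgZ.
apply: cvg_is_derive.
have MN : 0 < M * N + 1 by rewrite ltr_wpDl// mulr_ge0.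
apply: (iffRL (@cvgrPdist_le R R^o _ _ _ _ D)) => e e0; near=> h.
have h0 : h != 0 by near: h; exact: nbhs_dnbhs_neq.
rewrite distrC (_ : h^-1 *: _ - D =
  h^-1 * (mollify psi (h *: e_ i + x) - mollify psi x - h * D)); last first.
  by rewrite mulrBr mulKf.
rewrite normrM; apply: (@le_trans _ _ (`|h^-1| * (M * h ^+ 2 * N))).
  by rewrite ler_wpM2l.
rewrite -[h ^+ 2]ger0_norm ?sqr_ge0// normrX normfV expr2.
rewrite [leLHS](_ : _ = M * N * `|h|); last by field; rewrite normr_eq0.
have : `|h| <= e / (M * N + 1) by near: h; apply: dnbhs0_le; rewrite divr_gt0.
rewrite ler_pdivlMr// => he.
by have := normr_ge0 h; lra.
Unshelve. all: by end_near. Qed.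

Lemma smooth_mollify psi : test_function setT psi -> smooth (mollify psi).
Proof.
move=> tpsi.
apply: (@smooth_coind _ _ [set F | exists2 p, test_function setT p & F = mollify p]).
  move=> _ [p tp ->]; split => [|x i|i].
  - by apply: lipschitz_cont => x x'; exact: mollify_lipschitz.
  - by have [] := mollify_is_derive x i tp.
  - exists (fun y => partial i p y * -1); first exact/test_opp/test_partial.
    by apply: partialE => x; exact: mollify_is_derive.
by exists psi.
Qed.

Section density.
Variables (eta : 'rV[R]_n -> R) (d : R).
Hypothesis teta : test_function setT eta.
Hypothesis eta_ge0 : forall y, 0 <= eta y.
Hypothesis eta_supp : forall y, d < `|y| -> eta y = 0.
Hypothesis eta1 : \int[leb]_x eta x = 1.

Let ieta : intg setT eta := test_integrable teta.

Lemma mollify_close x (c e : R) : (forall y, `|y| <= d -> `|w (x + y) - c| <= e) ->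
  `|mollify eta x - c| <= e.
Proof.
move=> He; have i1 := mollify_intg_shift x teta.
have i2 : intg setT (fun y => c * eta y) by exact: intgZ.
have -> : mollify eta x - c = \int[leb]_y ((w (x + y) - c) * eta y).
  rewrite -[X in _ - X]mulr1 -eta1 mollify_shift// -RintegralZl// -RintegralB//.
  by apply: eq_Rintegral => y _; rewrite mulrBl.
have i3 : intg setT (fun y => (w (x + y) - c) * eta y).
  have := intgB measurableT i1 i2; apply: eq_integrable => // y _ /=.
  by rewrite mulrBl.
apply: le_trans (le_normr_Rintegral measurableT i3) _.
rewrite -[e]mulr1 -eta1 -RintegralZl//; apply: le_Rintegral => //.
- exact: intg_norm.
- exact: intgZ.
- move=> y _; have [yd|yd] := leP `|y| d; last by rewrite eta_supp// !mulr0 normr0.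
  by rewrite normrM (ger0_norm (eta_ge0 y)) ler_wpM2r// He.
Qed.

Lemma mollify_norm_diff x x' : `|mollify eta x - mollify eta x'| <= L * `|x - x'|.
Proof.
have := mollify_lipschitz x x' teta.
rewrite (eq_Rintegral _ (g := eta)) ?eta1 ?mulr1// => y _.
by rewrite ger0_norm.
Qed.

(** Where [w] is affine the average may shift its constant term, as [eta] need
    not be centred, but it keeps its slope. *)
Lemma mollify_affine x a s : d < s ->
  (forall z, `|z - x| < s -> w z = w x + dotrV a (z - x)) ->
  forall i, partial i (mollify eta) x = a 0 i.
Proof.
move=> ds Hw i; have d0 : 0 <= d.
  rewrite leNgt; apply/negP => d0; move: eta1.
  rewrite (eq_Rintegral _ (g := fun=> 0)) => [|y _].
    by rewrite Rintegral_cst// mul0r => /esym/eqP; rewrite oner_eq0.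
  by rewrite eta_supp// (lt_le_trans d0).
have near_aff x' : `|x - x'| < s - d -> mollify eta x' = affine_rV a (mollify eta x - dotrV a x) x'.
  move=> xx'; rewrite /affine_rV addrCA -dotrVBr -[dotrV a (x' - x)]mulr1 -eta1.
  rewrite -RintegralZl// !mollify_shift// -RintegralD//.
  - apply: eq_Rintegral => y _; rewrite -mulrDl.
    have [yd|yd] := leP `|y| d; last by rewrite eta_supp// !mulr0.
    congr (_ * _); rewrite (Hw (x' + y)) ?(Hw (x + y)).
    + rewrite (addrC x' y) -addrA (addrC x y) addrK !dotrVDr; ring.
    + by rewrite addrC addKr; apply: le_lt_trans yd ds.
    + rewrite addrAC; apply: le_lt_trans (ler_normD _ _) _.
      by rewrite distrC -ltrBrDr; apply: lt_le_trans xx' _; rewrite lerD2l lerN2.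
  - exact: mollify_intg_shift.
  - exact: intgZ.
have : is_derive x (e_ i) (mollify eta) (a 0 i).
  apply: (@near_eq_is_derive R 'rV[R]_n R^o (affine_rV a (mollify eta x - dotrV a x))).
    apply/nbhs_ballP; exists (s - d); first by rewrite /= subr_gt0.
    by move=> x'; rewrite ball_rVE /= => /near_aff.
  exact: is_derive_affine.
by case.
Qed.

End density.

End mollifier.

(** * Piecewise affine Sobolev functions *)

(** A Lipschitz function that vanishes off [Omega] is a Sobolev function with
    vanishing boundary values; the local affinity makes this elementary.
    Mollifying the truncations [max (v - 1 / k) 0] gives test functions [phi k] that converge to
    [v], and whose partial derivatives are bounded and eventually equal to the
    slope of [v] at almost every point: by dominated convergence they converge
    in the Sobolev norm. *)
Section piecewise_affine_sobolev.
Context {R : realType} {n : nat}.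
Local Notation leb := (@lebesgue_rV R n).
Local Notation intg D f := (leb.-integrable D (EFin \o f)).
Variable Omega : set 'rV[R]_n.
Hypothesis oO : open Omega.
Hypothesis Omega0 : Omega !=set0.
Hypothesis bO : bounded_set Omega.
Variables (v : 'rV[R]_n -> R) (L : R) (A : set 'rV[R]_n).
Hypothesis L0 : 0 <= L.
Hypothesis v_ge0 : forall x, 0 <= v x.
Hypothesis v_out : forall x, ~ Omega x -> v x = 0.
Hypothesis vL : forall x y, `|v x - v y| <= L * `|x - y|.
Hypothesis A0 : ~ A 0.
Hypothesis v_aff : {ae leb, forall x, Omega x -> exists2 a, A a &
  exists2 s : R, 0 < s & forall z, `|z - x| < s -> v z = v x + dotrV a (z - x)}.

Let mO : measurable Omega := open_measurable_mx oO.
Let v_cont : continuous v := lipschitz_cont vL.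

Let eps k : R := k.+1%:R^-1.
(* [v] varies by at most half of [eps k] on the cubes of half-side [del k] *)
Let del k : R := eps k / (2 * (L + 1)).

Let eps_gt0 k : 0 < eps k. Proof. by rewrite invr_gt0. Qed.
Let del_gt0 k : 0 < del k. Proof. by rewrite divr_gt0// mulr_gt0// ltr_wpDl. Qed.

Let Ldel k : L * del k <= eps k / 2.
Proof.
have L1 : 0 < 2 * (L + 1) by rewrite mulr_gt0// ltr_wpDl.
rewrite /del mulrA ler_pdivrMr//.
by have := eps_gt0 k; lra.
Qed.

Let w k x : R := Num.max (v x - eps k) 0.

Let w_le k x : `|w k x - v x| <= eps k.
Proof.
have := v_ge0 x; have := eps_gt0 k; rewrite /w ler_norml.
case: (leP (v x - eps k) 0) => *.
  by apply/andP; split; lra.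
by apply/andP; split; lra.
Qed.

Let wL k x y : `|w k x - w k y| <= L * `|x - y|.
Proof.
apply: le_trans (vL x y); have := ler_norm (v x - v y); have := ler_norm (- (v x - v y)).
rewrite normrN; move: (`|v x - v y|) => d h1 h2.
by rewrite /w ler_norml; case: (leP (v x - eps k) 0) => ?;
  case: (leP (v y - eps k) 0) => ?; apply/andP; split; lra.
Qed.

Let exr : exists r : R, forall x, r < `|x| -> ~ Omega x.
Proof.
case: bO => r [_ hr]; exists (`|r| + 1) => x rx Ox.
have : `|x| <= `|r| + 1.
  by apply: (hr (`|r| + 1)) => //; rewrite (le_lt_trans (ler_norm r))// ltrDl.
by rewrite leNgt rx.
Qed.

Let wr k x : sval (cid exr) < `|x| -> w k x = 0.
Proof.
by move=> /(svalP (cid exr)) Ox; rewrite /w v_out// max_r// sub0r oppr_le0 ltW.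
Qed.

Let W := `|v 0| + L * `|sval (cid exr)|.

Let vW x : `|v x| <= W.
Proof.
have [Ox|Ox] := pselect (Omega x); last first.
  by rewrite v_out// normr0 addr_ge0// mulr_ge0.
have xr : `|x| <= sval (cid exr).
  by rewrite leNgt; apply/negP => /(svalP (cid exr)).
have := vL x 0; rewrite subr0 => h.
rewrite -(subrK (v 0) (v x)); apply: le_trans (ler_normD _ _) _.
rewrite addrC lerD2l; apply: le_trans h _; rewrite ler_wpM2l//.
exact: le_trans xr (ler_norm _).
Qed.

Let wW k x : `|w k x| <= W.
Proof.
apply: le_trans (vW x); have := v_ge0 x; have := eps_gt0 k => e0 vx0.
by rewrite (ger0_norm vx0) /w; case: (leP (v x - eps k) 0) => *;
  rewrite ?normr0//= ger0_norm; lra.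
Qed.

Let exeta k := mollifier_exists (n := n) (del_gt0 k).
Let eta k := sval (cid (exeta k)).
Let etaP k : [/\ test_function setT (eta k), forall y, 0 <= eta k y,
  forall y, del k < `|y| -> eta k y = 0 & \int[leb]_x eta k x = 1] :=
  svalP (cid (exeta k)).

Let phi k := mollify (w k) (eta k).

Let phi_close k x : `|phi k x - v x| <= 2 * eps k.
Proof.
have [t p s i] := etaP k; apply: (mollify_close (wL k) (wW k) t p s i) => y yd.
rewrite -(subrK (v (x + y)) (w k (x + y))) -addrA.
apply: le_trans (ler_normD _ _) _; rewrite mulr2n mulrDl mul1r.
apply: lerD; first exact: w_le.
apply: le_trans (vL _ _) _; rewrite addrAC subrr add0r.
apply: (@le_trans _ _ (L * del k)); first by rewrite ler_wpM2l.
by apply: le_trans (Ldel k) _; have := eps_gt0 k; lra.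
Qed.

Let phi_test k : test_function Omega (phi k).
Proof.
have [t p s i] := etaP k; split; first exact: (smooth_mollify (wL k) (wW k) (@wr k) t).
exists [set x | eps k / 2 <= v x]; split.
- apply: bounded_closed_compact.
    case: bO => r [rr hr]; exists r; split => // M rM x /= vx; apply: (hr M rM).
    apply: contrapT => /v_out vx0; move: vx; rewrite vx0 => h.
    by have := eps_gt0 k; lra.
  apply: (@closed_comp _ _ v [set y | eps k / 2 <= y]) => [x _|]; first exact: v_cont.
  exact: closed_ge.
- move=> x /= vx; apply: contrapT => /v_out vx0; move: vx; rewrite vx0 => h.
  by have := eps_gt0 k; lra.
- move=> x /negP; rewrite -ltNge => vx; apply/eqP; rewrite -normr_le0 -[phi k x]subr0.
  apply: (mollify_close (wL k) (wW k) t p s i) => y yd.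
  rewrite subr0 /w max_r ?normr0// subr_le0.
  have := vL (x + y) x; rewrite addrAC subrr add0r => h.
  have := ler_norm (v (x + y) - v x); have := Ldel k.
  have : L * `|y| <= L * del k by rewrite ler_wpM2l.
  by lra.
Qed.

Let dphi_le k i x : `|partial i (phi k) x| <= L.
Proof.
have [t p s ii] := etaP k.
apply: (is_derive_lipschitz _ (smooth_is_derive x i (test_smooth (phi_test k)))) => h.
apply: le_trans (mollify_norm_diff (wL k) (wW k) t p ii _ _) _.
rewrite addrAC subrr add0r normrZ ler_wpM2l// ler_piMr//.
exact: norm_delta_le1.
Qed.

(** At a point around which [v] is affine, [v] is positive because its slope is
    nonzero there, so truncation and averaging do not change the slope. *)
Let dphi_near x a : A a -> (exists2 s : R, 0 < s & forall z, `|z - x| < s ->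
    v z = v x + dotrV a (z - x)) ->
  forall i, \forall k \near \oo, partial i (phi k) x = a 0 i.
Proof.
move=> Aa [s s0 vs] i.
have a0 : a != 0 by apply/eqP => a0; apply: A0; rewrite -a0.
have vx : 0 < v x.
  have na : 0 < `|a| by rewrite normr_gt0.
  pose t := s / 2 / `|a|; have t0 : 0 < t by rewrite !divr_gt0.
  have := vs (x - t *: a); rewrite addrAC subrr add0r normrN normrZ gtr0_norm//.
  rewrite divfK ?gt_eqF// => /(_ ltac:(lra)) h.
  have := v_ge0 (x - t *: a); rewrite h dotrVNr dotrVZr subr_ge0.
  by apply: lt_le_trans; rewrite mulr_gt0// dotrV_gt0.
pose u := v x / 2; have u0 : 0 < u by rewrite divr_gt0.
pose s1 := Num.min s (u / (L + 1)).
have L1 : 0 < L + 1 by rewrite ltr_wpDl.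
have s10 : 0 < s1 by rewrite lt_min s0 divr_gt0.
have c0 : eps k @[k --> \oo] --> 0 by exact: (@cvg_harmonic R).
near=> k.
have ek : eps k < u.
  by near: k; apply: cvgr_lt c0 _ u0.
have dk : del k < s1.
  have : eps k < s1 * (2 * (L + 1)).
    by near: k; apply: cvgr_lt c0 _ _; rewrite !mulr_gt0.
  by rewrite /del ltr_pdivrMr// mulr_gt0.
have [tt p ss ii] := etaP k.
apply: (mollify_affine (wL k) (wW k) tt ss ii dk) => z zx.
have zs : `|z - x| < s by apply: lt_le_trans zx _; rewrite ge_min lexx.
have zu : L * `|z - x| <= u.
  have : `|z - x| <= u / (L + 1).
    by apply: le_trans (ltW zx) _; rewrite ge_min lexx orbT.
  by rewrite ler_pdivlMr// => h; have := normr_ge0 (z - x); lra.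
have vz : u <= v z.
  have := vL z x; have := ler_norm (- (v z - v x)); rewrite normrN /u; rewrite /u in zu.
  lra.
rewrite /w !max_l ?subr_ge0; first by rewrite vs//; ring.
  by rewrite (le_trans (ltW ek))// /u; lra.
exact: le_trans (ltW ek) vz.
Unshelve. all: by end_near. Qed.

(* an upper limit only to have a measurable function defined everywhere *)
Let g i x : R := fine (limn_esup (fun k => (partial i (phi k) x)%:E)).

Let g_good x a : A a -> (exists2 s : R, 0 < s & forall z, `|z - x| < s ->
    v z = v x + dotrV a (z - x)) -> forall i, g i x = a 0 i.
Proof.
move=> Aa vs i; rewrite /g.
have h : (fun k => (partial i (phi k) x)%:E) @ \oo --> (a 0 i)%:E.
  apply: cvg_near_cst; have := dphi_near Aa vs i.
  by apply: filterS => k ->.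
by have [_ ->] := cvg_limn_einf_sup h.
Qed.

Let mg i : measurable_fun setT (g i).
Proof.
apply: measurableT_comp; first exact: fine_measurable.
apply: measurable_fun_limn_esup => k; apply/measurable_EFinP.
exact: test_measurable (test_partial i (phi_test k)).
Qed.

Let dphi_cvg i : intg Omega (g i) /\
  \int[leb]_(x in Omega) `|partial i (phi k) x - g i x| @[k --> \oo] --> 0.
Proof.
have mp k : measurable_fun Omega (partial i (phi k)).
  by apply: measurable_funTS; exact: test_measurable (test_partial i (phi_test k)).
have [|||||ig cv _] := @dominated_convergence _ _ _ leb _ mO
  (fun k x => (partial i (phi k) x)%:E) (EFin \o g i) (fun=> L%:E).
- by move=> k; apply/measurable_EFinP.
- by apply/measurable_EFinP; exact: measurable_funTS.
- apply: filterS v_aff => x H Ox; have [a Aa vs] := H Ox.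
  rewrite /= (g_good Aa vs); apply: cvg_near_cst; have := dphi_near Aa vs i.
  by apply: filterS => k ->.
- apply: (@bounded_integrable _ _ _ _ `|L|) => //.
- by apply: aeW => x k _; rewrite lee_fin.
split => //; apply: (@cvg_trans _ (fine (\int[leb]_(x in Omega)
  `|(partial i (phi k) x)%:E - (EFin \o g i) x|)%E @[k --> \oo])); last first.
  by move/fine_cvg: cv.
by apply: near_eq_cvg; near=> k.
Unshelve. all: by end_near. Qed.

Let G x : 'rV[R]_n := \row_i g i x.

Let iv : intg Omega v.
Proof.
apply: (@bounded_integrable _ _ _ _ W) => //.
by apply: measurable_funTS; exact: cont_measurable.
Qed.

Let phi_cvg k : \int[leb]_(x in Omega) `|v x - phi k x| <= 2 * eps k * fine (leb Omega).
Proof.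
have ip : intg Omega (phi k).
  by apply: (integrableS measurableT mO) => //; exact: test_integrable (phi_test k).
rewrite -Rintegral_cst//; apply: le_Rintegral => //.
- by apply: intg_norm => //; exact: intgB.
- exact: (@bounded_integrable _ _ _ _ `|2 * eps k|).
- by move=> x _; rewrite distrC.
Qed.

Let eps_cvg : eps k @[k --> \oo] --> (0 : R).
Proof. exact: (@cvg_harmonic R). Qed.

Let vG : is_weak_gradient Omega v G.
Proof.
split.
- exact: continuous_loc_integrable.
- move=> i K cK KO; rewrite (_ : (fun _ => _) = g i); last by apply/funext => x; rewrite mxE.
  have [ig _] := dphi_cvg i; apply: (integrableS mO) => //.
  exact: compact_measurable_rV.
move=> psi i tpsi; have tpsi' := test_partial i tpsi.
have ipsi : intg Omega psi.
  by apply: (integrableS measurableT mO) => //; exact: test_integrable tpsi.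
have [M [_ [M0 _ psiM _]]] := test_bounded tpsi.
have [M' [_ [M'0 _ psiM' _]]] := test_bounded tpsi'.
have mpsi : measurable_fun Omega psi by apply: measurable_funTS; exact: test_measurable tpsi.
have mpsi' : measurable_fun Omega (partial i psi).
  by apply: measurable_funTS; exact: test_measurable tpsi'.
have [ig cg] := dphi_cvg i.
have ae (f : 'rV[R]_n -> R) (B : R) : (forall x, `|f x| <= B) ->
    {ae leb, forall x, Omega x -> `|f x| <= B} by move=> fB; apply: aeW => x _.
have [iI1 _] := intg_mul mO iv mpsi' (ae _ _ psiM').
have [iI2 _] := intg_mul mO ig mpsi (ae _ _ psiM).
rewrite (eq_Rintegral _ (g := fun x => partial i psi x * v x)); last first.
  by move=> x _; rewrite mulrC.
rewrite [in RHS](eq_Rintegral _ (g := fun x => psi x * g i x)); last first.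
  by move=> x _; rewrite mxE mulrC.
set I1 := Rintegral _ _ _ in iI1 *; set I2 := Rintegral _ _ _.
apply/eqP; rewrite -subr_eq0 opprK -normr_eq0 eq_le normr_ge0 andbT.
(* for [phi k] in place of [v] the identity holds; the bound is the error *)
have bound k : `|I1 + I2| <= M' * (2 * eps k * fine (leb Omega)) +
    M * \int[leb]_(x in Omega) `|partial i (phi k) x - g i x|.
  have tp := phi_test k; have tp' := test_partial i tp.
  have ip : intg Omega (phi k).
    by apply: (integrableS measurableT mO) => //; exact: test_integrable tp.
  have ip' : intg Omega (partial i (phi k)).
    by apply: (integrableS measurableT mO) => //; exact: test_integrable tp'.
  have [j1 b1] := intg_mul mO (intgB mO iv ip) mpsi' (ae _ _ psiM').
  have [j2 b2] := intg_mul mO (intgB mO ip' ig) mpsi (ae _ _ psiM).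
  have [j3 _] := intg_mul mO ip mpsi' (ae _ _ psiM').
  have [j4 _] := intg_mul mO ip' mpsi (ae _ _ psiM).
  have E := ibp i tpsi (test_smooth tp).
  rewrite (eq_Rintegral _ (g := fun x => partial i psi x * phi k x)) in E; last first.
    by move=> x _; rewrite mulrC.
  rewrite [in RHS](eq_Rintegral _ (g := fun x => psi x * partial i (phi k) x)) in E; last first.
    by move=> x _; rewrite mulrC.
  have -> : I1 + I2 = (\int[leb]_(x in Omega) (partial i psi x * (v x - phi k x))) -
      (\int[leb]_(x in Omega) (psi x * (partial i (phi k) x - g i x))).
    have -> : \int[leb]_(x in Omega) (partial i psi x * (v x - phi k x)) =
        I1 - \int[leb]_(x in Omega) (partial i psi x * phi k x).
      by rewrite /I1 -RintegralB//; apply: eq_Rintegral => x _; rewrite mulrBr.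
    have -> : \int[leb]_(x in Omega) (psi x * (partial i (phi k) x - g i x)) =
        \int[leb]_(x in Omega) (psi x * partial i (phi k) x) - I2.
      by rewrite /I2 -RintegralB//; apply: eq_Rintegral => x _; rewrite mulrBr.
    by rewrite E; ring.
  apply: le_trans (ler_normB _ _) _; apply: lerD.
    by apply: le_trans b1 _; rewrite ler_wpM2l// phi_cvg.
  exact: b2.
have lim0 : M' * (2 * eps k * fine (leb Omega)) +
    M * \int[leb]_(x in Omega) `|partial i (phi k) x - g i x| @[k --> \oo] --> (0 : R).
  have : M' * (2 * eps k * fine (leb Omega)) +
      M * \int[leb]_(x in Omega) `|partial i (phi k) x - g i x| @[k --> \oo] -->
      M' * (2 * 0 * fine (leb Omega)) + M * 0.
    apply: cvgD; last by apply: cvgM; [exact: cvg_cst|exact: cg].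
    apply: cvgM; first exact: cvg_cst.
    apply: cvgM; last exact: cvg_cst.
    by apply: cvgM; [exact: cvg_cst|exact: eps_cvg].
  by rewrite mulr0 mul0r !mulr0 addr0.
exact: (ler_cvg_to (cvg_cst `|I1 + I2|) lim0 (nearW _ bound)).
Qed.

Let Aae : {ae leb, forall x, Omega x -> A (G x)}.
Proof.
apply: filterS v_aff => x H Ox; have [a Aa vs] := H Ox.
suff -> : G x = a by [].
by apply/rowP => i; rewrite mxE (g_good Aa vs).
Qed.

Lemma piecewise_affine_gradient_in :
  {ae leb, forall x, Omega x -> A (weak_gradient Omega v x)}.
Proof.
have := weak_gradient_ae oO vG.
have F := ae_filter_ringOfSetsType leb.
apply: filterS2 Aae => x h1 h2 Ox; rewrite (h2 Ox); exact: h1.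
Qed.

Let g_le i : {ae leb, forall x, Omega x -> `|g i x| <= L}.
Proof.
apply: filterS v_aff => x H Ox; have [a Aa vs] := H Ox.
rewrite (g_good Aa vs); have [k <-] := filter_ex (dphi_near Aa vs i).
exact: dphi_le.
Qed.

Let wg_ae i : {ae leb, forall x, Omega x -> g i x = weak_gradient Omega v x 0 i}.
Proof.
apply: filterS (weak_gradient_ae oO vG) => x h Ox.
by rewrite h// mxE.
Qed.

Let wg_intg i : intg Omega (fun x => weak_gradient Omega v x 0 i).
Proof.
have [ig _] := dphi_cvg i; apply: (ae_eq_intg mO ig _ (wg_ae i)).
have [_ lG _] := weak_gradientP (ex_intro _ _ vG).
exact: loc_integrable_measurable (lG i).
Qed.

Let Lp1_of_intg (u : 'rV[R]_n -> R) : intg Omega u -> in_Lp Omega 1 u.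
Proof.
move=> iu; split; first exact: intg_measurable iu.
by rewrite Lp_norm1E; case/integrableP : iu.
Qed.

Let Lpoo_of_bounded (u : 'rV[R]_n -> R) (M : R) : measurable_fun Omega u ->
  {ae leb, forall x, Omega x -> `|u x| <= M} -> in_Lp Omega +oo%E u.
Proof.
move=> mu uM; split => //; rewrite /Lp_norm unlock (leb_setT_gt0 oO Omega0).
apply: (@le_lt_trans _ _ (`|M|%:E)); last exact: ltry.
apply/ess_supP; apply: filterS uM => x h /=.
rewrite patchE; case: ifPn => [/set_mem Ox|_]; last by rewrite abse0 lee_fin.
by rewrite lee_fin; apply: le_trans (h Ox) (ler_norm M).
Qed.

Let Lp1_Rint (u : 'rV[R]_n -> R) : intg Omega u ->
  Lp_norm Omega 1 u = (\int[leb]_(x in Omega) `|u x|)%:E.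
Proof.
move=> iu; rewrite Lp_norm1E /Rintegral fineK//.
by apply: integrable_fin_num => //; exact: intg_norm.
Qed.

Lemma piecewise_affine_W1oo0 : in_W1oo0 Omega v.
Proof.
have mv := intg_measurable iv.
split; last first.
  split; first by apply: (@Lpoo_of_bounded _ W) => //; apply: aeW => x _.
    by exists G.
  move=> i; apply: (@Lpoo_of_bounded _ L); first exact: intg_measurable (wg_intg i).
  have F := ae_filter_ringOfSetsType leb.
  by apply: filterS2 (g_le i) (wg_ae i) => x h1 h2 Ox; rewrite -h2// h1.
split; first by split; [exact: Lp1_of_intg|exists G|move=> i; exact: Lp1_of_intg].
move=> e e0.
have ip k : intg Omega (phi k).
  by apply: (integrableS measurableT mO) => //; exact: test_integrable (phi_test k).
have ip' i k : intg Omega (partial i (phi k)).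
  apply: (integrableS measurableT mO) => //.
  exact: test_integrable (test_partial i (phi_test k)).
have W11E k : W11_norm Omega (v \- phi k) = (\int[leb]_(x in Omega) `|v x - phi k x| +
    \sum_i \int[leb]_(x in Omega) `|partial i (phi k) x - g i x|)%:E.
  rewrite /W11_norm Lp1_Rint; last exact: intgB.
  rewrite EFinD -sumEFin; congr (_ + _)%E; apply: eq_bigr => i _.
  have D := weak_gradientB oO vG (smooth_weak_gradient Omega (test_smooth (phi_test k))).
  have Dae := weak_gradient_ae oO D.
  have [_ lD _] := weak_gradientP (ex_intro _ _ D).
  have mD := loc_integrable_measurable oO (lD i).
  have [ig _] := dphi_cvg i.
  have igp : intg Omega (fun x => g i x - partial i (phi k) x) by exact: intgB.
  have DE : ae_eq leb Omega (fun x => g i x - partial i (phi k) x)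
      (fun x => weak_gradient Omega (v \- phi k) x 0 i).
    by apply: filterS Dae => x h Ox; rewrite h// !mxE.
  rewrite Lp1_Rint; last exact: ae_eq_intg igp mD DE.
  congr EFin; apply: ae_eq_Rint => //.
  - exact: measurableT_comp.
  - by apply: measurableT_comp => //; apply: intg_measurable; apply: intgB.
  - by apply: filterS DE => x h Ox; rewrite -h// distrC.
have lim : 2 * eps k * fine (leb Omega) +
    \sum_i \int[leb]_(x in Omega) `|partial i (phi k) x - g i x| @[k --> \oo] --> (0 : R).
  have : 2 * eps k * fine (leb Omega) +
    \sum_i \int[leb]_(x in Omega) `|partial i (phi k) x - g i x| @[k --> \oo] -->
    2 * 0 * fine (leb Omega) + \sum_(i < n) (0 : R).
    apply: cvgD.
      apply: cvgM; last exact: cvg_cst.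
      by apply: cvgM; [exact: cvg_cst|exact: eps_cvg].
    elim: (index_enum _) => [|i r IH].
      by rewrite big_nil; under eq_fun do rewrite big_nil; exact: cvg_cst.
    rewrite big_cons; under eq_fun do rewrite big_cons.
    by apply: cvgD IH; have [_ h] := dphi_cvg i; exact: h.
  by rewrite mulr0 mul0r add0r big1_eq.
have lim_e : \forall k \near \oo, 2 * eps k * fine (leb Omega) +
    \sum_i \int[leb]_(x in Omega) `|partial i (phi k) x - g i x| < e.
  by apply: cvgr_lt lim _ e0.
have [k hk] := filter_ex lim_e.
exists (phi k); first exact: phi_test.
by rewrite W11E lte_fin; apply: le_lt_trans hk; rewrite lerD2r phi_cvg.
Qed.

End piecewise_affine_sobolev.

(** * Distance functions of polyhedral gauges *)

Section finite_sequences.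
Context {R : realType} {T : eqType}.

Lemma seq_argmin (f : T -> R) (s : seq T) y0 : y0 \in s ->
  exists2 y, y \in s & forall z, z \in s -> f y <= f z.
Proof.
elim: s y0 => // a s IH y0 _; have [s0|[b bs]] : s = [::] \/ exists b, b \in s.
- by case: (s) => [|b t]; [left|right; exists b; rewrite mem_head].
- by exists a; rewrite ?mem_head// s0 => z; rewrite inE => /eqP ->.
have [y ys ymin] := IH _ bs; have [ay|ya] := leP (f a) (f y).
- exists a; rewrite ?mem_head// => z; rewrite inE => /orP[/eqP -> //|/ymin].
  exact: le_trans.
- exists y; rewrite ?inE ?ys ?orbT// => z; rewrite inE => /orP[/eqP ->|/ymin //].
  exact: ltW.
Qed.

Lemma seq_gap (f : T -> R) (s : seq T) : exists2 e : R, 0 < e &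
  forall z, z \in s -> 0 < f z -> e <= f z.
Proof.
elim: s => [|a s [e e0 IH]]; first by exists 1.
have [fa|fa] := ltP 0 (f a); last first.
  exists e => // z; rewrite inE => /orP[/eqP ->|]; last exact: IH.
  by rewrite ltNge fa.
exists (Num.min e (f a)); first by rewrite lt_min e0.
move=> z; rewrite inE ge_min => /orP[/eqP -> _|zs fz].
  by rewrite lexx orbT.
by rewrite IH.
Qed.

End finite_sequences.

Section polyhedral_gauge.
Context {R : realType} {n : nat}.
Variables (A : seq 'rV[R]_n) (d : R).
Hypothesis n_gt0 : (0 < n)%N.
Hypothesis d_gt0 : 0 < d.
Hypothesis Ad : forall x, x != 0 -> exists2 a, a \in A & d * `|x| <= dotrV a x.
Implicit Types (x y z a : 'rV[R]_n).

(** The support function of the convex hull of [B] and the origin; under the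
    assumption on [A] it is an asymmetric norm. *)
Definition gauge (B : seq 'rV[R]_n) x : R := \big[Num.max/0]_(a <- B) dotrV a x.

Local Notation rho := (gauge A).

Lemma gauge_ge a x : a \in A -> dotrV a x <= rho x.
Proof. by move=> aA; exact: (le_bigmax_seq 0 a xpredT (fun b => dotrV b x)). Qed.

Lemma gauge_ub x c : 0 <= c -> (forall a, a \in A -> dotrV a x <= c) -> rho x <= c.
Proof. by move=> c0 Ac; rewrite /gauge big_seq; exact: bigmax_le. Qed.

Lemma gauge_ge0 x : 0 <= rho x.
Proof. exact: bigmax_ge_id. Qed.

Lemma gauge_lb x : d * `|x| <= rho x.
Proof.
have [->|x0] := eqVneq x 0; first by rewrite normr0 mulr0 gauge_ge0.
by have [a aA /le_trans] := Ad x0; apply; exact: gauge_ge.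
Qed.

Lemma gauge_attained x : exists2 a, a \in A & rho x = dotrV a x.
Proof.
have sel (B : seq 'rV[R]_n) : gauge B x = 0 \/ exists2 a, a \in B & gauge B x = dotrV a x.
  elim: B => [|b B IH]; first by left; rewrite /gauge big_nil.
  rewrite /gauge big_cons -/(gauge B x); case: (leP (dotrV b x) (gauge B x)) => _.
    by case: IH => [->|[a aB ->]]; [left|right; exists a; rewrite // inE aB orbT].
  by right; exists b; rewrite ?mem_head.
have [r0|//] := sel A; have [x0|x0] := eqVneq x 0.
  have [|a aA _] := @Ad (const_mx 1).
    apply/eqP => /rowP/(_ (Ordinal n_gt0)); rewrite !mxE => /eqP.
    by rewrite oner_eq0.
  by exists a => //; rewrite r0 x0 dotrV0r.
have := gauge_lb x; rewrite r0 leNgt => /negP[].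
by rewrite mulr_gt0// normr_gt0.
Qed.

Definition gauge_lip : R := \sum_(a <- A) \sum_i `|a 0 i|.

Lemma gauge_lip_ge0 : 0 <= gauge_lip.
Proof. by apply: sumr_ge0 => a _; apply: sumr_ge0. Qed.

Lemma gauge_lip_dot a x : a \in A -> `|dotrV a x| <= gauge_lip * `|x|.
Proof.
move=> aA; apply: le_trans (norm_dotrV_le _ _) _; rewrite ler_wpM2r//.
rewrite /gauge_lip (big_rem a)//= lerDl.
by apply: sumr_ge0 => b _; apply: sumr_ge0.
Qed.

Lemma gauge_le x : rho x <= gauge_lip * `|x|.
Proof.
apply: gauge_ub => [|a aA]; first by rewrite mulr_ge0// gauge_lip_ge0.
exact: le_trans (ler_norm _) (gauge_lip_dot x aA).
Qed.

Lemma gaugeD x y : rho (x + y) <= rho x + rho y.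
Proof.
apply: gauge_ub => [|a aA]; first by rewrite addr_ge0// gauge_ge0.
by rewrite dotrVDr lerD// gauge_ge.
Qed.

End polyhedral_gauge.

Section gauge_distance.
Context {R : realType} {n : nat}.
Variables (A : seq 'rV[R]_n) (d : R).
Hypothesis n_gt0 : (0 < n)%N.
Hypothesis d_gt0 : 0 < d.
Hypothesis Ad : forall x, x != 0 -> exists2 a, a \in A & d * `|x| <= dotrV a x.
Variable Z : set 'rV[R]_n.
Hypothesis Z0 : Z !=set0.
Implicit Types (x y z a : 'rV[R]_n).
Local Notation rho := (gauge A).
Local Notation L := (gauge_lip A).

Definition gauge_dist x : R := inf [set rho (x - z) | z in Z].

Let has_inf_dist x : has_inf [set rho (x - z) | z in Z].
Proof.
split; first by case: Z0 => z Zz; exists (rho (x - z)), z.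
by exists 0 => _ [z _ <-]; exact: gauge_ge0.
Qed.

Lemma gauge_dist_le x z : Z z -> gauge_dist x <= rho (x - z).
Proof. by move=> Zz; apply: inf_lbound; [case: (has_inf_dist x)|exists z]. Qed.

Lemma gauge_dist_ge x c : (forall z, Z z -> c <= rho (x - z)) -> c <= gauge_dist x.
Proof.
move=> h; apply: lb_le_inf; first by case: (has_inf_dist x).
by move=> _ [z Zz <-]; exact: h.
Qed.

Lemma gauge_dist_ge0 x : 0 <= gauge_dist x.
Proof. by apply: gauge_dist_ge => z _; exact: gauge_ge0. Qed.

Lemma gauge_dist_eq0 x : Z x -> gauge_dist x = 0.
Proof.
move=> Zx; apply/eqP; rewrite eq_le gauge_dist_ge0 andbT.
apply: le_trans (gauge_dist_le x Zx) _; rewrite subrr.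
by apply: le_trans (gauge_le A 0) _; rewrite normr0 mulr0.
Qed.

Lemma gauge_dist_lipschitz x y : `|gauge_dist x - gauge_dist y| <= L * `|x - y|.
Proof.
have H x' y' : gauge_dist x' - gauge_dist y' <= L * `|x' - y'|.
  rewrite lerBlDr addrC -lerBlDr; apply: gauge_dist_ge => z Zz; rewrite lerBlDr.
  apply: le_trans (gauge_dist_le x' Zz) _.
  rewrite (_ : x' - z = (y' - z) + (x' - y')); last first.
    by apply/rowP => i; rewrite !mxE; ring.
  by apply: le_trans (gaugeD _ _ _) _; rewrite lerD2l gauge_le.
by rewrite ler_norml lerNl opprB distrC H distrC H.
Qed.

(** Where the distance is locally attained in a finite set of centres, it is
    locally a selection of finitely many affine functions; if moreover only one
    slope is active at [x], it is affine around [x]. *)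
Lemma gauge_dist_affine x (F : seq 'rV[R]_n) s : 0 < s ->
  (forall z, `|z - x| < s -> exists2 y, y \in F & gauge_dist z = rho (z - y)) ->
  (forall a a' y y', a \in A -> a' \in A -> y \in F -> y' \in F ->
     dotrV a (x - y) = dotrV a' (x - y') -> a = a') ->
  exists2 a, a \in A & exists2 t : R, 0 < t &
    forall z, `|z - x| < t -> gauge_dist z = gauge_dist x + dotrV a (z - x).
Proof.
move=> s0 loc uniq_slope; pose E := [seq (a, y) | a <- A, y <- F].
have sel z : `|z - x| < s -> exists a y, [/\ a \in A, y \in F &
    gauge_dist z = dotrV a (z - y)].
  move=> /loc[y yF ->]; have [a aA ->] := gauge_attained n_gt0 d_gt0 Ad (z - y).
  by exists a, y.
have [|a [y [aA yF vx]]] := sel x; first by rewrite subrr normr0.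
pose f (p : 'rV[R]_n * 'rV[R]_n) := `|dotrV p.1 (x - p.2) - gauge_dist x|.
have [e e0 He] := seq_gap f E.
have L1 : 0 < 2 * L + 1 by rewrite ltr_wpDl// mulr_ge0// gauge_lip_ge0.
exists a => //; exists (Num.min s (e / (2 * L + 1))); first by rewrite lt_min s0 divr_gt0.
move=> z; rewrite lt_min => /andP[zs]; rewrite ltr_pdivlMr// => ze.
have [b [y' [bA yF' vz]]] := sel z zs.
have zx0 := normr_ge0 (z - x).
have bE : dotrV b (z - y') = dotrV b (x - y') + dotrV b (z - x).
  by rewrite -dotrVDr; congr dotrV; apply/rowP => i; rewrite !mxE; ring.
have active : dotrV b (x - y') = gauge_dist x.
  apply/eqP; rewrite -subr_eq0 -normr_eq0 eq_le normr_ge0 andbT leNgt; apply/negP => fp.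
  have := He (b, y') _ fp; rewrite /f/= => /(_ (allpairs_f pair bA yF')).
  have h1 := gauge_lip_dot (z - x) bA; have h2 := gauge_dist_lipschitz z x.
  rewrite (_ : dotrV b (x - y') - gauge_dist x =
    (gauge_dist z - gauge_dist x) - dotrV b (z - x)); last by rewrite vz bE; ring.
  by have := ler_normB (gauge_dist z - gauge_dist x) (dotrV b (z - x)); lra.
have ab : a = b by apply: (uniq_slope a b y y') => //; rewrite -vx active.
by rewrite vz bE active ab.
Qed.

End gauge_distance.

(** * A piecewise affine function with prescribed slopes *)

Section locally_finite_grid.
Context {R : realType} {n : nat}.
Variable Omega : set 'rV[R]_n.
Hypothesis n_gt0 : (0 < n)%N.
Hypothesis oO : open Omega.
Variable m : nat.
Hypothesis m_gt0 : (0 < m)%N.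
Hypothesis Om : forall x, Omega x -> `|x| <= m%:R.
Implicit Types (x y z : 'rV[R]_n).

Definition grid_step q : R := m%:R / q.+1%:R.

Definition grid_point (p : nat * {ffun 'I_n -> nat}) : 'rV[R]_n :=
  \row_i ((p.2 i)%:R * grid_step p.1 - m%:R).

(** Grid points of mesh [h] are kept only within distance [C h] of the
    complement of [Omega], so that they can accumulate only at the boundary. *)
Definition boundary_grid (C : R) : set 'rV[R]_n :=
  [set y | exists q (f : {ffun 'I_n -> nat}), [/\ y = grid_point (q, f),
     forall i, (f i < (2 * q.+1).+1)%N &
     exists2 z, ~ Omega z & `|y - z| <= C * grid_step q]].

Lemma grid_step_gt0 q : 0 < grid_step q.
Proof. by rewrite divr_gt0// ltr0n. Qed.

Lemma grid_near q x : `|x| <= m%:R -> exists f : {ffun 'I_n -> nat},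
  (forall i, (f i < (2 * q.+1).+1)%N) /\ `|x - grid_point (q, f)| <= grid_step q.
Proof.
move=> xm; have h0 := grid_step_gt0 q; set h := grid_step q in h0 *.
have hm : h * q.+1%:R = m%:R by rewrite /h /grid_step divfK// pnatr_eq0.
exists [ffun i => Num.truncn ((x 0 i + m%:R) / h)].
have xi i : 0 <= x 0 i + m%:R <= h * (2 * q.+1%:R).
  have := le_trans (coord_le_norm x i) xm; rewrite ler_norml => /andP[? ?].
  by rewrite mulrCA hm; apply/andP; split; lra.
have tr i : (Num.truncn ((x 0 i + m%:R) / h))%:R * h <= x 0 i + m%:R <
    (Num.truncn ((x 0 i + m%:R) / h)).+1%:R * h.
  have /andP[x0 _] := xi i.
  rewrite -ler_pdivlMr// -ltr_pdivrMr// truncnS_gt andbT.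
  by rewrite truncn_le// divr_ge0// ltW.
split=> [i|].
  rewrite ffunE ltnS -(ler_nat R) natrM.
  have /andP[t1 _] := tr i; have /andP[_ x1] := xi i.
  by rewrite -(ler_pM2r h0) (le_trans t1)// mulrC.
apply: norm_leP => [|i]; first exact: ltW.
rewrite !mxE ffunE -/h; have /andP[t1 t2] := tr i.
rewrite -natr1 mulrDl mul1r in t2.
by rewrite ler_norml; apply/andP; split; lra.
Qed.

Lemma compl_point : exists z, ~ Omega z.
Proof.
exists (const_mx (m%:R + 1)) => /Om; rewrite leNgt => /negP; apply.
have := coord_le_norm (const_mx (m%:R + 1) : 'rV[R]_n) (Ordinal n_gt0).
by rewrite mxE ger0_norm ?addr_ge0//; apply: lt_le_trans; rewrite ltrDl.
Qed.

Lemma compl_distance x : Omega x -> exists D : R, [/\ 0 < D,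
  forall z, ~ Omega z -> D <= `|x - z| & exists2 z, ~ Omega z & `|x - z| <= 2 * D].
Proof.
move=> Ox; pose S := [set `|x - z| | z in ~` Omega].
have Sinf : has_inf S.
  split; first by have [z Oz] := compl_point; exists `|x - z|, z.
  by exists 0 => _ [z _ <-].
have lbD z : ~ Omega z -> inf S <= `|x - z|.
  by move=> Oz; apply: inf_lbound; [case: Sinf|exists z].
have D0 : 0 < inf S.
  move: oO; rewrite openE => /(_ _ Ox)/nbhs_ballP[e /= e0 eO].
  apply: lt_le_trans e0 _; apply: lb_le_inf; first by case: Sinf.
  move=> _ [z Oz <-]; rewrite leNgt; apply/negP => xz; apply: Oz; apply: eO.
  by rewrite ball_rVE.
exists (inf S); split => //.
have [_ [z Oz <-] zD] := inf_adherent D0 Sinf.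
by exists z => //; rewrite ltW// mulr_natl mulr2n.
Qed.

Lemma boundary_grid_finite (C e : R) : 0 < e -> 0 <= C ->
  exists F : seq 'rV[R]_n, forall y, boundary_grid C y ->
    (forall z, ~ Omega z -> e <= `|y - z|) -> y \in F.
Proof.
move=> e0 C0; pose Q := (Num.truncn (C * m%:R / e)).+1.
pose pts q := [seq grid_point (q, [ffun i => nat_of_ord (j i)])
  | j : {ffun 'I_n -> 'I_(2 * q.+1).+1}].
exists (flatten [seq pts q | q <- iota 0 Q]).
move=> y [q [f [yE fq [z Oz yz]]]] far; apply/flattenP; exists (pts q).
  apply/mapP; exists q => //; rewrite mem_iota /= add0n.
  have : e <= C * grid_step q by exact: le_trans (far z Oz) yz.
  rewrite /grid_step mulrA ler_pdivlMr ?ltr0n// mulrC -ler_pdivlMr// => h.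
  apply: ltnW; rewrite -(ltr_nat R); exact: le_lt_trans h (truncnS_gt _).
apply/mapP; exists [ffun i => Ordinal (fq i)]; first by rewrite mem_enum.
rewrite yE; congr (grid_point (_, _)); apply/ffunP => i.
by rewrite !ffunE.
Qed.

End locally_finite_grid.

Section piecewise_affine_exists.
Context {R : realType} {n : nat}.
Local Notation leb := (@lebesgue_rV R n).
Variable Omega : set 'rV[R]_n.
Hypothesis n_gt0 : (0 < n)%N.
Hypothesis oO : open Omega.
Hypothesis bO : bounded_set Omega.
Variables (A : seq 'rV[R]_n) (d : R).
Hypothesis d_gt0 : 0 < d.
Hypothesis Ad : forall x, x != 0 -> exists2 a, a \in A & d * `|x| <= dotrV a x.
Implicit Types (x y z : 'rV[R]_n).
Local Notation L := (gauge_lip A).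

(** Each coincidence of two distinct slopes, for two given grid points, takes
    place on a hyperplane. *)
Lemma countable_coincidence_null m : leb.-negligible
  [set x | exists a a' p p', [/\ a \in A, a' \in A, a <> a' &
    dotrV a (x - grid_point m p) = dotrV a' (x - grid_point m p')]].
Proof.
pose I := ((nat * {ffun 'I_n -> nat}) * nat * ((nat * {ffun 'I_n -> nat}) * nat))%type.
pose H (t : I) : set 'rV[R]_n :=
  let a := nth 0 A t.1.2 in let a' := nth 0 A t.2.2 in
  if a == a' then set0 else
  [set x | dotrV (a - a') x = dotrV a (grid_point m t.1.1) - dotrV a' (grid_point m t.2.1)].
apply: (@negligibleS _ _ _ _ (\bigcup_t H t)).
  move=> x [a [a' [p [p' [/(nthP 0)[k kA aE] /(nthP 0)[k' k'A a'E] aa' E]]]]].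
  exists ((p, k), (p', k')) => //; rewrite /H /= aE a'E; case: eqP => // _ /=.
  by move: E; rewrite !dotrVBr dotrVBl => E; lra.
apply: negligible_bigcup_countable => t; rewrite /H /=; case: ifPn => [_|aa'].
  exact: negligible_set0.
apply/negligibleP; last by apply: leb_hyperplane; rewrite subr_eq0.
rewrite -[X in measurable X]setTI.
exact: (cont_measurable (@dotrV_continuous _ _ _) measurableT (measurable_set1 _)).
Qed.

(** Take for [v] the distance, for the polyhedral gauge of [A], to the complement
    of [Omega] together with the grid points. Near a point of [Omega] at distance
    [D] from the complement, a grid point whose mesh is a small fraction of [D]
    beats the complement and all the centres close to the complement. Only finitely many
    centres then compete, and [v] is locally a selection of affine functions with
    slopes in [A]. The distance to the complement alone would involve infinitely
    many centres, and their envelope may have slopes outside [A]. *)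
Theorem piecewise_affine_exists : exists v : 'rV[R]_n -> R,
  [/\ forall x, 0 <= v x, forall x, ~ Omega x -> v x = 0,
      forall x y, `|v x - v y| <= L * `|x - y| &
      {ae leb, forall x, Omega x -> exists2 a, a \in A &
        exists2 t : R, 0 < t &
        forall z, `|z - x| < t -> v z = v x + dotrV a (z - x)}].
Proof.
have [m [m_gt0 Om]] : exists m : nat, (0 < m)%N /\ forall x, Omega x -> `|x| <= m%:R.
  case: bO => r [_ hr]; exists (Num.truncn `|r|).+1; split => // x Ox.
  by apply: (hr _ _ x Ox); apply: le_lt_trans (ler_norm r) (truncnS_gt _).
have L0 := gauge_lip_ge0 A.
pose kap := 4 * L / d + 4.
have kap4 : 4 <= kap by rewrite lerDr// divr_ge0 ?mulr_ge0// ltW.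
have kapL : 4 * L <= kap * d.
  have -> : kap * d = 4 * L + 4 * d by rewrite /kap; field; rewrite gt_eqF.
  by rewrite lerDl mulr_ge0// ltW.
have [z1 Oz1] := compl_point n_gt0 Om.
have m0 : 0 < m%:R :> R by rewrite ltr0n.
(* large enough that the mesh chosen below for [x], of order [D / kap], keeps
   the grid point next to [x] *)
pose C := 1 + 2 * (m%:R * kap + (m%:R + `|z1|)) / m%:R.
have C1 : 1 <= C.
  by rewrite lerDl divr_ge0// ?mulr_ge0// !addr_ge0// mulr_ge0//; lra.
pose Z := boundary_grid Omega m C `|` ~` Omega.
have Z0 : Z !=set0 by exists z1; right.
pose v := gauge_dist A Z.
exists v; split.
- exact: gauge_dist_ge0.
- by move=> x Ox; apply: gauge_dist_eq0 => //; right.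
- exact: gauge_dist_lipschitz.
apply: negligibleS (countable_coincidence_null m) => x /not_implyP[Ox].
apply: contraPP => xN; apply.
have [D [D0 Dlb [z0 Oz0 z0D]]] := compl_distance n_gt0 oO Om Ox.
have DM : D <= m%:R + `|z1|.
  apply: le_trans (Dlb z1 Oz1) _; apply: le_trans (ler_normB _ _) _.
  by rewrite lerD2r Om.
(* mesh comparable to the distance to the complement *)
pose q := Num.truncn (m%:R * kap / D); pose h : R := grid_step m q.
have h0 : 0 < h by exact: grid_step_gt0.
have hm : h * q.+1%:R = m%:R by rewrite /h /grid_step divfK// pnatr_eq0.
have q1 : m%:R * kap < q.+1%:R * D.
  by rewrite -ltr_pdivrMr//; exact: truncnS_gt.
have q2 : q%:R * D <= m%:R * kap.
  rewrite -ler_pdivlMr//; rewrite /q truncn_le// divr_ge0//.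
    by rewrite mulr_ge0//; lra.
  exact: ltW.
have hkap : h * kap <= D.
  rewrite -(ler_pM2r (_ : 0 < q.+1%:R :> R)) ?ltr0n// mulrAC hm.
  by rewrite [leRHS]mulrC ltW.
have hD : 4 * h <= D by nra.
have LhD : 4 * (L * h) <= d * D by nra.
have ChD : h + 2 * D <= C * h.
  have e1 : (C - 1) * m%:R = 2 * (m%:R * kap + (m%:R + `|z1|)).
    by rewrite /C addrAC subrr add0r divfK// gt_eqF.
  have e2 : m%:R * D <= h * (m%:R * kap + D).
    rewrite -{1}hm -mulrA ler_pM2l// -natr1 mulrDl mul1r lerD2r.
    exact: q2.
  have e3 : m%:R * (2 * D) <= m%:R * ((C - 1) * h).
    rewrite [leRHS](_ : _ = h * ((C - 1) * m%:R)); last by ring.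
    rewrite e1; nra.
  by move: e3; rewrite ler_pM2l//; lra.
have [f [fq xf]] := grid_near m_gt0 q (Om x Ox).
set y0 := grid_point m (q, f) in xf.
have y0Y : boundary_grid Omega m C y0.
  exists q, f; split => //; exists z0 => //; rewrite -/h.
  have := ler_distD x y0 z0; rewrite (distrC y0 x) => h1.
  by rewrite (le_trans h1)// (le_trans _ ChD)// lerD.
have [F0 HF0] := @boundary_grid_finite R n Omega m C (3 / 8 * D)
  ltac:(lra) ltac:(lra).
pose F := [seq y <- F0 | `[< boundary_grid Omega m C y >]].
have L1 : 0 < L + 1 by lra.
pose s := Num.min (D / 8) (d * D / (4 * (L + 1))).
have s0 : 0 < s by rewrite lt_min !divr_gt0// ?mulr_gt0.
have near_in z t : `|t - x| < s -> Z z -> gauge A (t - z) <= gauge A (t - y0) -> z \in F.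
  rewrite lt_min => /andP[ts1]; rewrite ltr_pdivlMr ?mulr_gt0// => ts2 Zz tz.
  have tx0 := normr_ge0 (t - x).
  have b1 : d * `|t - z| <= L * (`|t - x| + h).
    apply: le_trans (gauge_lb Ad _) _; apply: le_trans tz _.
    apply: le_trans (gauge_le A _) _; rewrite ler_wpM2l//.
    by apply: le_trans (ler_distD x t y0) _; rewrite lerD2l.
  have b2 : `|t - z| <= D / 2.
    by rewrite -(ler_pM2l d_gt0); nra.
  have b3 : `|x - z| <= 5 / 8 * D.
    by have := ler_distD t x z; rewrite (distrC x t); lra.
  have Oz : Omega z by apply: contrapT => /Dlb; lra.
  have Yz : boundary_grid Omega m C z by case: Zz.
  rewrite mem_filter; apply/andP; split; first exact/asboolP.
  apply: HF0 => // z' /Dlb; have := ler_distD z x z'; lra.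
have y0F : y0 \in F.
  by apply: (near_in y0 x) => //; [rewrite subrr normr0|left].
apply: (gauge_dist_affine (F := F) n_gt0 d_gt0 Ad Z0 s0) => [t tx|].
  have [y yF ymin] := seq_argmin (fun y => gauge A (t - y)) y0F.
  have Yy : Z y by left; move: yF; rewrite mem_filter => /andP[/asboolP].
  exists y => //; apply/eqP; rewrite eq_le; apply/andP; split.
    exact: gauge_dist_le.
  apply: gauge_dist_ge => // z Zz.
  have [tz|tz] := leP (gauge A (t - z)) (gauge A (t - y0)).
    by apply: ymin; exact: near_in tx Zz tz.
  exact: le_trans (ymin _ y0F) (ltW tz).
move=> a a' y y' aA a'A yF y'F E; apply: contrapT => aa'; apply: xN.
move: yF y'F; rewrite !mem_filter => /andP[/asboolP[p [g [yE _ _]]] _].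
move=> /andP[/asboolP[p' [g' [y'E _ _]]] _].
by exists a, a', (p, g), (p', g'); split => //; rewrite -yE -y'E.
Qed.

End piecewise_affine_exists.

(** * The supremal problem *)

Section supremal_energy.
Context {R : realType} {n : nat}.
Local Notation leb := (@lebesgue_rV R n).
Variable Omega : set 'rV[R]_n.
Hypothesis oO : open Omega.
Hypothesis Omega0 : Omega !=set0.
Hypothesis bO : bounded_set Omega.

Let mO : measurable Omega := open_measurable_mx oO.

Let leb_fin : (leb Omega < +oo)%E.
Proof. exact: leb_bounded_lty. Qed.

Let leb_gt0 : 0 < fine (leb Omega).
Proof. by rewrite fine_gt0// leb_fin leb_open_gt0. Qed.

(** The weak gradient has mean zero and [Omega] has positive measure. *)
Lemma mean_dir_ge0 v al s : in_W1oo0 Omega v ->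
  {ae leb, forall x, Omega x -> dotrV (weak_gradient Omega v x) al <= s} -> 0 <= s.
Proof.
move=> v0 Gs; have [iG G0] := mean_weak_gradient_dot oO v0 al.
have iS : leb.-integrable Omega (EFin \o (fun=> s)).
  apply: measurable_bounded_integrable => //.
  by exists `|s|; split=> // M sM x _ /=; exact: ltW.
have := ae_le_Rint mO iG iS Gs.
by rewrite G0 Rintegral_cst// pmulr_lge0.
Qed.

Lemma dir_le0_eq0 v al : in_W1oo0 Omega v ->
  {ae leb, forall x, Omega x -> dotrV (weak_gradient Omega v x) al <= 0} ->
  {ae leb, forall x, Omega x -> dotrV (weak_gradient Omega v x) al = 0}.
Proof.
move=> v0 Gle; have [iG G0] := mean_weak_gradient_dot oO v0 al.
apply: (Rint_norm_eq0 mO iG).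
have iN := intgZ (-1) mO iG.
rewrite (ae_eq_Rint (g := fun x => -1 * dotrV (weak_gradient Omega v x) al) mO).
- by rewrite RintegralZl// G0 mulr0.
- by apply: intg_measurable; exact: intg_norm.
- exact: intg_measurable iN.
- by apply: filterS Gle => x + Ox => /(_ Ox) ?; rewrite ler0_norm// mulN1r.
Qed.

Variables (f : 'rV[R]_n -> R) (xi0 : 'rV[R]_n) (c : R).

Lemma sup_energy_leP u (k : R) : (sup_energy Omega f u <= k%:E)%E <->
  {ae leb, forall x, Omega x -> f (weak_gradient Omega u x) <= k}.
Proof.
split=> [/ess_supP H|H]; [|apply/ess_supP]; apply: filterS H => x.
  by rewrite /patch => + Ox; rewrite mem_set// lee_fin.
by rewrite /patch; case: ifPn => [/set_mem Ox /(_ Ox)|]; rewrite ?lee_fin// leNye.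
Qed.

Lemma admissible_gradient u : admissible Omega xi0 c u ->
  {ae leb, forall x, Omega x ->
    weak_gradient Omega u x = weak_gradient Omega (u \- affine_rV xi0 c) x + xi0}.
Proof.
move=> [[[_ exG _] _] _].
have := weak_gradientD oO (weak_gradientP exG) (affine_weak_gradient Omega xi0 c).
rewrite (_ : (fun x => _) = u) => [|]; last by apply/funext => x /=; rewrite subrK.
exact: weak_gradient_ae.
Qed.

(** If a closed convex level set of a competitor of the envelope missed [xi0], a
    hyperplane would separate it strictly from [xi0]; the gradient of [u], whose
    mean is [xi0], would lie almost everywhere beyond this hyperplane. *)
Lemma lslc_le_sup_energy u m : lslc f xi0 = m%:E -> admissible Omega xi0 c u ->
  (m%:E <= sup_energy Omega f u)%E.
Proof.
move=> mE adm.
have real_bound k : (sup_energy Omega f u <= k%:E)%E -> m <= k.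
  move=> /sup_energy_leP Hk; rewrite -lee_fin -mE.
  apply: ge_ereal_sup => _ [g [glsc gconv gf] <-].
  rewrite leNgt; apply/negP => kg.
  have [al [s [Hs sx]]] : exists (al : 'rV[R]_n) (s : R),
      (forall x, (g x <= k%:E)%E -> dotrV x al <= s) /\ s < dotrV xi0 al.
    apply: (convex_separation (C := [set xi | (g xi <= k%:E)%E])) => //.
    - by have /lower_semicontinuous_sublevel := glsc; exact.
    - by rewrite /= leNgt kg.
  suff : 0 <= s - dotrV xi0 al by lra.
  apply: (mean_dir_ge0 (al := al) adm).
  apply: filterS2 Hk (admissible_gradient adm) => x fk E Ox.
  have := Hs (weak_gradient Omega u x); rewrite (E Ox) dotrVDl -(E Ox).
  rewrite -lerBrDr; apply; apply: le_trans (gf _) _.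
  by rewrite lee_fin fk.
case E : (sup_energy Omega f u) => [r| |]; last 2 first.
- exact: leey.
- have h : m <= m - 1 by apply: real_bound; rewrite E leNye.
  by exfalso; move: {E} h; lra.
- by rewrite lee_fin real_bound// E.
Qed.

(** Finitely many points of the level set already surround [xi0]: they are the
    gradients of a piecewise affine competitor. The slope [0] of the perturbation
    is excluded because [xi0] is not in the level set. *)
Lemma surrounds_sup_energy k : (0 < n)%N -> k < f xi0 ->
  surrounds [set xi | f xi <= k] xi0 ->
  exists2 u, admissible Omega xi0 c u & (sup_energy Omega f u <= k%:E)%E.
Proof.
move=> n0 kf /surrounds_finite[A [d [d0 AK Ad]]].
have [v [v0 vout vL vaff]] := piecewise_affine_exists n0 oO bO d0 Ad.
have A0 : ~ [set` A] 0 by move=> /= /AK; rewrite addr0 /= leNgt kf.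
have L0 := gauge_lip_ge0 A.
have vW : in_W1oo0 Omega v := piecewise_affine_W1oo0 oO Omega0 bO L0 v0 vout vL A0 vaff.
have Gv := piecewise_affine_gradient_in oO bO L0 v0 vout vL A0 vaff.
pose u x := v x + affine_rV xi0 c x.
have uv : u \- affine_rV xi0 c = v by apply/funext => x /=; rewrite addrK.
have adm : admissible Omega xi0 c u by rewrite /admissible /= uv.
exists u => //; apply/sup_energy_leP.
apply: filterS2 Gv (admissible_gradient adm) => x GA E Ox.
by rewrite E// uv addrC; apply: AK; exact: GA.
Qed.

(** If the level set of [k] lay on one side of a hyperplane through [xi0], the
    gradient of [u], whose mean is [xi0], would stay in this hyperplane. The
    perturbation would be constant in a direction, hence zero, and [u] affine
    with gradient [xi0], which is not in the level set. *)
Lemma energy_le_surrounds u k : k < f xi0 -> admissible Omega xi0 c u ->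
  (sup_energy Omega f u <= k%:E)%E -> surrounds [set xi | f xi <= k] xi0.
Proof.
move=> kf adm /sup_energy_leP Hk al al0; apply: contrapT => noz.
have Gu := admissible_gradient adm.
have G0 : {ae leb, forall x, Omega x ->
    dotrV (weak_gradient Omega (u \- affine_rV xi0 c) x) al = 0}.
  apply: (dir_le0_eq0 adm); apply: filterS2 Hk Gu => x fk E Ox.
  rewrite leNgt; apply/negP => pos; apply: noz.
  by exists (weak_gradient Omega u x); [exact: fk|rewrite E// addrK].
have Gv0 := weak_gradient_dir0_eq0 oO Omega0 bO adm al0 G0.
have : leb.-negligible Omega.
  have H : {ae leb, forall x, Omega x -> False}.
    apply: filterS3 Hk Gu Gv0 => x fk E E0 Ox.
    by have := fk Ox; rewrite (E Ox) (E0 Ox) add0r leNgt kf.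
  by apply: negligibleS H => x Ox; exact.
move=> /negligibleP => /(_ mO) h; have := leb_open_gt0 oO Omega0.
by rewrite h ltxx.
Qed.

End supremal_energy.

Theorem corollary4p13 (R : realType) (n : nat) (n_gt0 : (0 < n)%N)
    (Omega : set 'rV[R]_n) (xi0 : 'rV[R]_n) (c : R)
    (f : 'rV[R]_n -> R) (gamma : R -> R)
    (Omega_neq0 : Omega !=set0) (Omega_open : open Omega)
    (Omega_bounded : bounded_set Omega)
    (Omega_lipschitz : lipschitz_boundary Omega)
    (f_continuous : continuous f)
    (gamma_ge0 : forall t, 0 <= t -> 0 <= gamma t)
    (gamma_continuous : {within `[0, +oo[, continuous gamma})
    (gamma_increasing : {in `[0, +oo[ &, {homo gamma : s t / s <= t}})
    (gamma_cvgy : gamma t @[t --> +oo] --> +oo)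
    (f_ge_gamma : forall xi, gamma (normE xi) <= f xi)
    (lslc_lt_f : (lslc f xi0 < (f xi0)%:E)%E) :
  has_solution Omega f xi0 c <->
  ~ strictly_level_convex_some_dir (lslc f) xi0.
Proof.
have f_ge0 xi : 0 <= f xi by rewrite (le_trans _ (f_ge_gamma xi))// gamma_ge0// sqrtr_ge0.
have f_coercive k : bounded_set [set xi | f xi <= k].
  have /cvgryPgt/(_ k)[M [_ HM]] := gamma_cvgy.
  exists M; split; first exact: num_real.
  move=> r Mr xi /= fk; rewrite leNgt; apply/negP => rxi.
  have := HM (normE xi) (lt_trans Mr (lt_le_trans rxi (norm_le_normE xi))).
  by rewrite ltNge (le_trans (f_ge_gamma xi)).
have [m mE m_ge0] := lslc_fin f_ge0 xi0.
have mf : m < f xi0 by rewrite -lte_fin -mE.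
have infE : ereal_inf [set sup_energy Omega f u | u in admissible Omega xi0 c] = m%:E.
  apply/eqP; rewrite eq_le; apply/andP; split; last first.
    by apply: le_ereal_inf_tmp => _ [u adm <-]; exact: lslc_le_sup_energy mE adm.
  apply/lee_addgt0Pr => e e0.
  pose k := Num.min (m + e) ((m + f xi0) / 2).
  have mk : m < k by rewrite lt_min; apply/andP; split; lra.
  have kf : k < f xi0 by rewrite gt_min; apply/orP; right; lra.
  have [u adm uk] := surrounds_sup_energy Omega_open Omega_neq0 Omega_bounded c n_gt0 kf
    (surrounds_above f_continuous f_coercive mE mk).
  apply: le_trans (_ : k%:E <= _)%E; last by rewrite -EFinD lee_fin ge_min lexx.
  by apply: le_trans uk; apply: ereal_inf_lbound; exists u.
split=> [[u adm uE]|nstrict].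
  apply: (not_strictly_level_convex_of_surrounds f_ge0 mE).
  apply: (energy_le_surrounds Omega_open Omega_neq0 Omega_bounded mf adm).
  by rewrite uE infE.
have sur : surrounds [set xi | f xi <= m] xi0.
  apply: contrapT => nsur; apply: nstrict.
  exact: strictly_level_convex_of_not_surrounds mE nsur.
have [u adm um] := surrounds_sup_energy Omega_open Omega_neq0 Omega_bounded c n_gt0 mf sur.
exists u => //; rewrite infE; apply/eqP; rewrite eq_le um.
exact: lslc_le_sup_energy mE adm.
Qed.
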